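(* There exists an absolute constant $c>0$ such that for every finite nonempty set $S\subset\mathbb{Z}^2$ and every $\phi\in L^2(\mathbb{T}^2)$, \[ \|e^{it\Delta}P_S\phi\|_{L^4_{t,x}([0,2\pi]\times\mathbb{T}^2)}\le c\,(\log\#S)^{1/4}\,\|\phi\|_{L^2(\mathbb{T}^2)}. \]
   Context: $\mathbb{T}^2=(\mathbb{R}/2\pi\mathbb{Z})^2$. For $f:\mathbb{T}^2\to\mathbb{C}$, $\widehat f(\xi)$, $\xi\in\mathbb{Z}^2$, denotes its Fourier coefficients. For $S\subset\mathbb{Z}^2$, $P_S$ is the Fourier multiplier $\widehat{P_Sf}=\chi_S\widehat f$ ($\chi_S$ the indicator of $S$). For $t\in\mathbb{R}$, $e^{it\Delta}\phi$ is defined by $\widehat{e^{it\Delta}\phi}(\xi)=e^{-it|\xi|^2}\widehat\phi(\xi)$. $\#S$ is the cardinality of $S$, and $\log x:=\max\{1,\log_e x\}$ for $x>0$. *)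

(* Defs.v *)
From HB Require Import structures.
From mathcomp Require Import all_boot all_order all_algebra.
From mathcomp Require Import all_classical all_reals all_analysis.
Set Implicit Arguments. Unset Strict Implicit. Unset Printing Implicit Defensive.
Import Order.TTheory GRing.Theory Num.Theory.
Import numFieldNormedType.Exports.
From mathcomp Require Import finmap complex.
Local Open Scope classical_set_scope.
Local Open Scope ring_scope.
Local Open Scope complex_scope.

Section Defs.
Variable R : realType.

Definition leb2 := (@lebesgue_measure R \x @lebesgue_measure R)%E.
Definition leb3 :=
  ((@lebesgue_measure R \x @lebesgue_measure R) \x @lebesgue_measure R)%E.

Definition torus_dom : set (R * R) :=
  [set x | (0 <= x.1 < 2 * pi) /\ (0 <= x.2 < 2 * pi)].

Definition spacetime_dom : set ((R * R) * R) :=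
  [set z | z.1 \in torus_dom /\ (0 <= z.2 <= 2 * pi)].

Definition cexpi (theta : R) : R[i] := (cos theta +i* sin theta)%C.

Definition cmod (z : R[i]) : R := Num.sqrt (Re z ^+ 2 + Im z ^+ 2).

Definition zdot (xi : int * int) (x : R * R) : R :=
  xi.1%:~R * x.1 + xi.2%:~R * x.2.
Definition znorm2 (xi : int * int) : R := (xi.1%:~R) ^+ 2 + (xi.2%:~R) ^+ 2.

Definition fourier_coef (f : R * R -> R[i]) (xi : int * int) : R[i] :=
  ((2 * pi) ^+ 2)^-1%:C *
  (Rintegral leb2 torus_dom (fun x => Re (f x * cexpi (- zdot xi x)))
   +i* Rintegral leb2 torus_dom (fun x => Im (f x * cexpi (- zdot xi x))))%C.

Definition proj_fourier (S : {fset (int * int)}) (f : R * R -> R[i])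
    (x : R * R) : R[i] :=
  \sum_(xi <- S) fourier_coef f xi * cexpi (zdot xi x).

Definition schrod_proj (S : {fset (int * int)}) (f : R * R -> R[i])
    (t : R) (x : R * R) : R[i] :=
  \sum_(xi <- S) cexpi (- (t * znorm2 xi)) * fourier_coef f xi * cexpi (zdot xi x).

Definition L2norm_T2 (f : R * R -> R[i]) : \bar R :=
  Lnorm leb2 2%:E (fun x => (\1_torus_dom x * cmod (f x))%:E).

Definition L4norm_spacetime (u : R -> R * R -> R[i]) : \bar R :=
  Lnorm leb3 4%:E (fun z => (\1_spacetime_dom z * cmod (u z.2 z.1))%:E).

Definition in_L2_T2 (f : R * R -> R[i]) : Prop :=
  measurable_fun torus_dom (fun x => Re (f x)) /\
  measurable_fun torus_dom (fun x => Im (f x)) /\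
  (L2norm_T2 f < +oo)%E.

(* log x := max(1, ln x) *)
Definition logm (x : R) : R := Num.max 1 (ln x).

End Defs.

(* Main.v *)
(* Expanding the fourth power of the modulus of u = e^{it Delta} P_S phi and
   integrating leaves (2 pi)^3 times the sum of c_a conj(c_b) c_c conj(c_d) over the
   quadruples in S with a + c = b + d and |a|^2 + |c|^2 = |b|^2 + |d|^2, i.e. over the
   (possibly degenerate) rectangles abcd with vertices in S. The degenerate ones
   contribute at most 2 (sum |c|^2)^2, and Bessel's inequality bounds sum |c|^2, so
   everything reduces to a weighted count of genuine rectangles.

   Cut the coefficients into level sets |c| ~ 8^-j. The number of rectangles with
   a, b, c, d in given sets A, B, C, D is estimated by sorting the two perpendicular
   lines ab and ad through the corner a dyadically by the number of points of B and D
   they carry, and applying the Szemeredi-Trotter theorem (proved through the crossing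
   lemma) to both families of lines: a pair of perpendicular lines determines a, and
   every dyadic class costs at most |A|^(2/3) |B|^(2/3) |D|^(2/3), with geometric decay
   when the two richnesses are unbalanced. Only the sum over the log #S balanced
   classes loses a logarithm; after the symmetries of the rectangle are used to order
   the levels, the sum over quadruples of levels converges geometrically. *)
Require Import Defs.
From HB Require Import structures.
From mathcomp Require Import all_boot all_order all_algebra.
From mathcomp Require Import all_classical all_reals all_analysis.
Import Order.TTheory GRing.Theory Num.Theory.
Import numFieldNormedType.Exports.
From mathcomp Require Import finmap complex.
From mathcomp Require Import measurable_realfun zify ring lra.
Local Open Scope ring_scope.
Set Implicit Arguments. Unset Strict Implicit. Unset Printing Implicit Defensive.

(** * Crossing numbers and incidences *)

(** Incidence bounds say nothing about lines that carry a single point, since any number of lines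
    pass through one point. Rectangles whose line ab meets B only in b therefore escape the dyadic
    sorting, and for levels with c < d the trivial count |A| |B| of the pairs (a, b) is too weak to
    sum. The fourth vertex set helps: if ab carries at least r points of A, the incidence bound for
    A limits these pairs; if it carries fewer, then b and c determine the line ab and leave fewer
    than r choices of a. The threshold r is tuned to the levels.

    The exponents 2/3 are avoided by working with cube roots: u^3 = |A| and the like turn every
    estimate into a polynomial inequality. Cutting the coefficients at powers of 8 serves the same
    end: a level a has 2^(6a) points times its mass, whose cube root contains 2^(2a), and the
    comparison of levels becomes linear arithmetic in integer exponents. The crossing inequality
    keeps its sampling parameter q as a free integer for the same reason; q is chosen only where
    sizes are known. *)

Section PlaneGraphs.
Variables (F : realFieldType) (T : finType) (X Y : T -> F).
Hypothesis X_inj : injective X.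
Implicit Types (e g : T * T) (u v w : T) (x : F).

Definition slope e : F := (Y e.2 - Y e.1) / (X e.2 - X e.1).
Definition height e x : F := Y e.1 + slope e * (x - X e.1).
Definition over e x : bool := (X e.1 < x) && (x < X e.2).
(** Overlapping collinear edges cross in this sense; edges that only share an endpoint do not,
    because [over] is strict. *)
Definition crosses e g : Prop :=
  exists x, [/\ over e x, over g x & height e x = height g x].

Lemma height_left e : height e (X e.1) = Y e.1.
Proof. by rewrite /height subrr mulr0 addr0. Qed.

Lemma height_right e : X e.1 < X e.2 -> height e (X e.2) = Y e.2.
Proof.
move=> h; rewrite /height /slope mulfVK ?subr_eq0 ?gt_eqF //.
by rewrite addrC subrK.
Qed.

Lemma height_shift e x x0 : height e x = height e x0 + slope e * (x - x0).
Proof. rewrite /height; ring. Qed.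

Lemma height_meet e g x1 x2 : x1 < x2 ->
  height e x1 < height g x1 -> height g x2 < height e x2 ->
  exists x, [/\ x1 < x, x < x2 & height e x = height g x].
Proof.
rewrite (height_shift e x2 x1) (height_shift g x2 x1) => x12 h1 h2.
set s := height g x1 - height e x1.
set t := slope e - slope g.
have s0 : 0 < s by rewrite subr_gt0.
have st : s < t * (x2 - x1) by rewrite /s /t mulrBl; lra.
have d0 : 0 < x2 - x1 by rewrite subr_gt0.
have t0 : 0 < t by rewrite -(pmulr_lgt0 _ d0); apply: lt_trans st.
exists (x1 + s / t); split.
- by rewrite ltrDl divr_gt0.
- by rewrite -ltrBrDl ltr_pdivrMr // mulrC.
- rewrite (height_shift e _ x1) (height_shift g _ x1).
  have -> : x1 + s / t - x1 = s / t by ring.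
  have : t * (s / t) = s by rewrite mulrC divfK // gt_eqF.
  by rewrite {1}/t /s mulrBl; lra.
Qed.

Lemma over_crosses e g x1 x2 :
  X e.1 <= x1 -> X g.1 <= x1 -> x2 <= X e.2 -> x2 <= X g.2 -> x1 < x2 ->
  height e x1 < height g x1 -> height g x2 < height e x2 -> crosses e g.
Proof.
move=> e1 g1 e2 g2 x12 h1 h2.
have [x [a b c]] := height_meet x12 h1 h2.
exists x; split=> //; apply/andP; split.
- exact: le_lt_trans a.
- exact: lt_le_trans e2.
- exact: le_lt_trans a.
- exact: lt_le_trans g2.
Qed.

Variables (V : {set T}) (E : {set T * T}).
Hypothesis E_vert : forall e, e \in E -> [/\ e.1 \in V, e.2 \in V & X e.1 < X e.2].
Hypothesis E_free : forall e w, e \in E -> w \in V -> over e (X w) ->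
  Y w != height e (X w).
Hypothesis E_plane : forall e g, e \in E -> g \in E -> e != g -> ~ crosses e g.

Lemma left_slope_inj e g : e \in E -> g \in E -> e.1 = g.1 ->
  slope e = slope g -> e = g.
Proof.
move=> eE gE eg1 es; apply/eqP; apply: contraT => /(E_plane eE gE) []; move: es.
have [_ _ he] := E_vert eE; have [_ _ hg] := E_vert gE.
move=> es; have [x x1 x2]: exists2 x, X e.1 < x & (x < X e.2) && (x < X g.2).
  have := midf_lt (_ : X e.1 < Num.min (X e.2) (X g.2)).
  rewrite lt_min he /= eg1 hg => /(_ isT); rewrite lt_min => -[a /andP[b c]].
  by exists ((X g.1 + Num.min (X e.2) (X g.2)) / 2); rewrite ?b.
move/andP: x2 => [x2 x3]; exists x; split; rewrite /over ?x1 ?x2 -?eg1 ?x1 ?x3 //.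
by rewrite /height es eg1.
Qed.

Lemma right_slope_inj e g : e \in E -> g \in E -> e.2 = g.2 ->
  slope e = slope g -> e = g.
Proof.
move=> eE gE eg2 es; apply/eqP; apply: contraT => /(E_plane eE gE) []; move: es.
have [_ _ he] := E_vert eE; have [_ _ hg] := E_vert gE.
move=> es; have [x x2 x1]: exists2 x, x < X e.2 & (X e.1 < x) && (X g.1 < x).
  have := midf_lt (_ : Num.max (X e.1) (X g.1) < X e.2).
  rewrite gt_max he /= eg2 hg => /(_ isT); rewrite gt_max => -[/andP[a b] c].
  by exists ((Num.max (X e.1) (X g.1) + X g.2) / 2); rewrite ?a.
move/andP: x1 => [x1 x3]; exists x; split; rewrite /over ?x1 ?x2 -?eg2 ?x2 ?x3 //.
rewrite (height_shift e x (X e.2)) (height_shift g x (X g.2)) es !height_right //.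
by rewrite eg2.
Qed.

Definition top_right := [set e in E | [forall g in E, (g.1 == e.1) ==> (slope g <= slope e)]].
(** Among edges with a common right end the uppermost is the one of least slope, hence the reversed
    inequality. *)
Definition top_left := [set e in E | [forall g in E, (g.2 == e.2) ==> (slope e <= slope g)]].

Lemma card_top_right : (#|top_right| <= #|V|)%N.
Proof.
have inj : {in top_right &, injective (fun e => e.1)}.
  move=> e g; rewrite !inE => /andP[eE /forall_inP he] /andP[gE /forall_inP hg] eg.
  apply: left_slope_inj => //; apply/eqP; rewrite eq_le.
  by rewrite (implyP (hg e eE)) ?eg //= (implyP (he g gE)) ?eg.
rewrite -(card_in_imset inj); apply/subset_leq_card/fintype.subsetP => u /imsetP[e].
by rewrite inE => /andP[/E_vert[]] h _ _ _ ->.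
Qed.

Lemma card_top_left : (#|top_left| <= #|V|)%N.
Proof.
have inj : {in top_left &, injective (fun e => e.2)}.
  move=> e g; rewrite !inE => /andP[eE /forall_inP he] /andP[gE /forall_inP hg] eg.
  apply: right_slope_inj => //; apply/eqP; rewrite eq_le.
  by rewrite (implyP (he g gE)) ?eg //= (implyP (hg e eE)) ?eg.
rewrite -(card_in_imset inj); apply/subset_leq_card/fintype.subsetP => u /imsetP[e].
by rewrite inE => /andP[/E_vert[]] _ h _ _ ->.
Qed.

(** [e] is the highest edge strictly below [w]; a vertex is therefore seen by at most one edge,
    which makes it a possible target for charging [e]. *)
Definition sees e w : bool :=
  [&& w \in V, over e (X w), height e (X w) < Y w &
   [forall g in E, over g (X w) ==>
     ((height g (X w) <= height e (X w)) || (Y w <= height g (X w)))]].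

Lemma sees_inj e g w : e \in E -> g \in E -> sees e w -> sees g w -> e = g.
Proof.
move=> eE gE /and4P[_ oe he /forall_inP ve] /and4P[_ og hg /forall_inP vg].
have /orP[h1|] := implyP (ve g gE) og; last by rewrite leNgt hg.
have /orP[h2|] := implyP (vg e eE) oe; last by rewrite leNgt he.
apply/eqP; apply: contraT => /(E_plane eE gE) []; exists (X w); split=> //.
by apply/eqP; rewrite eq_le h1 h2.
Qed.

(* The vertex that sees [e] from above is the leftmost vertex of the wedge
   between [e] and the next edge leaving the left endpoint of [e]. *)
Lemma sees_exists e : e \in E -> e \notin top_right -> e \notin top_left ->
  exists w, sees e w.
Proof.
move=> eE; have [uV vV uv] := E_vert eE.
rewrite !inE eE /= => /forall_inPn[e' e'E]; rewrite negb_imply -ltNge => /andP[/eqP e'1 se'].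
move=> /forall_inPn[e2 e2E]; rewrite negb_imply -ltNge => /andP[/eqP e22 se2].
pose up g := [&& g \in E, g.1 == e.1 & slope e < slope g].
have up' : up e' by rewrite /up e'E e'1 eqxx se'.
case: (arg_minP (P := up) slope up') => e1 /and3P[e1E /eqP e11 se1] e1min.
have [_ v1V] := E_vert e1E; rewrite e11 => uv1.
have above x : X e.1 < x -> height e x < height e1 x.
  by move=> xu; rewrite /height e11 ltrD2l ltr_pM2r ?subr_gt0.
have e1nee : e1 != e by apply: contraTneq se1 => ->; rewrite ltxx.
have above2 x : x < X e.2 -> height e x < height e2 x.
  have [_ _ hg] := E_vert e2E.
  move=> xv; rewrite (height_shift e x (X e.2)) (height_shift e2 x (X e2.2)).
  by rewrite !height_right // e22 ltrD2l ltr_nM2r ?subr_lt0.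
pose W w := [&& w \in V, over e (X w), X w <= X e1.2, height e (X w) < Y w &
               Y w <= height e1 (X w)].
have [w0 Ww0] : exists w, W w.
  have [lt1|gt1|/X_inj eq1] := ltgtP (X e1.2) (X e.2).
  - exists e1.2; rewrite /W v1V /over uv1 lt1 lexx /=.
    rewrite -[Y _]height_right ?e11 // lexx andbT.
    exact: above.
  (* [e1] runs beyond the right end of [e]. The edge [e2] comes into that end from above [e] and
     cannot cross [e1], so its left end is trapped in the wedge. *)
  - have [zV _ zv] := E_vert e2E; rewrite e22 in zv.
    have e12 : e1 != e2 by apply: contraTneq gt1 => ->; rewrite e22 ltxx.
    have uz : X e.1 < X e2.1.
      rewrite ltNge; apply/negP; rewrite le_eqVlt => /orP[/eqP/X_inj zu|zu].
        have ee : e2 = e by rewrite [e2]surjective_pairing zu e22 -surjective_pairing.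
        by move: se2; rewrite ee ltxx.
      apply: (E_plane e1E e2E) => //; apply: (@over_crosses _ _ (X e.1) (X e.2)) => //.
      + by rewrite e11.
      + exact: ltW.
      + exact: ltW.
      + by rewrite e22.
      + by rewrite -{1}e11 height_left e11 -height_left above2.
      + by rewrite -{1}e22 height_right e22 // -height_right // above.
    exists e2.1; rewrite /W zV /over uz zv (ltW (lt_trans zv gt1)) /=.
    rewrite -height_left above2 //= leNgt; apply/negP => h.
    apply: (E_plane e1E e2E) => //; apply: (@over_crosses _ _ (X e2.1) (X e.2)) => //.
    + by rewrite e11 ltW.
    + exact: ltW.
    + by rewrite e22.
    + by rewrite -{1}e22 height_right e22 // -height_right // above.
  - exfalso; move/eqP: e1nee; apply.
    by rewrite [e1]surjective_pairing e11 eq1 -surjective_pairing.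
case: (arg_minP (P := W) X Ww0) => w /and5P[wV /andP[uw wv] wv1 hw hw1] wmin.
exists w; rewrite /sees wV /over uw wv hw /=.
apply/forall_inP => g gE; apply/implyP => /andP[pw wr].
rewrite -[_ || _]negbK negb_or -!ltNge; apply/negP => /andP[hg1 hg2].
have gw1 : height g (X w) < height e1 (X w) by exact: lt_le_trans hw1.
have gne : g != e by apply: contraTneq hg1 => ->; rewrite ltxx.
have gne1 : g != e1 by apply: contraTneq gw1 => ->; rewrite ltxx.
have [pV _ pr] := E_vert gE.
have noe x : X e.1 <= x -> X g.1 <= x -> x < X w -> height e x <= height g x.
  move=> x1 x2 x3; rewrite leNgt; apply/negP => h.
  by apply: (E_plane gE eE gne); apply: (@over_crosses _ _ x (X w)) => //; exact: ltW.
have noe1 x : X e.1 <= x -> X g.1 <= x -> x < X w -> height g x <= height e1 x.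
  move=> x1 x2 x3; rewrite leNgt; apply/negP => h.
  apply: (E_plane e1E gE); first by rewrite eq_sym.
  by apply: (@over_crosses _ _ x (X w)) => //; rewrite ?e11 //; exact: ltW.
(* Traced to the left, an edge [g] between [e] and [w] cannot leave the wedge by a crossing. It
   would pass through the apex, or start in the wedge left of [w], or start at the apex with a slope
   between those of [e] and [e1]; each is impossible. *)
have [pu|up1|/X_inj pu] := ltgtP (X g.1) (X e.1).
- have ou : over g (X e.1) by rewrite /over pu (lt_trans uw wr).
  move/eqP: (E_free gE uV ou); apply; apply/eqP; rewrite eq_le.
  have := noe _ (lexx _) (ltW pu) uw; rewrite height_left => -> /=.
  have := noe1 _ (lexx _) (ltW pu) uw.
  by rewrite -[in height e1 _]e11 height_left e11.
- have Wp : W g.1.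
    have op : over e (X g.1) by rewrite /over up1 (lt_trans pw wv).
    have := noe1 _ (ltW up1) (lexx _) pw; rewrite height_left => h1.
    have := noe _ (ltW up1) (lexx _) pw; rewrite height_left => h2.
    by rewrite /W pV op (ltW (lt_le_trans pw wv1)) h1 lt_neqAle eq_sym (E_free eE pV op) h2.
  by have := wmin _ Wp; rewrite leNgt pw.
- have sg : slope e < slope g.
    move: hg1; rewrite /height pu ltrD2l ltr_pM2r // subr_gt0 //.
  have := e1min g; rewrite /up gE pu eqxx sg => /(_ isT) /=; rewrite leNgt => /negP; apply.
  by move: gw1; rewrite /height pu e11 ltrD2l ltr_pM2r // subr_gt0.
Qed.

(** A charging argument in place of Euler's formula: an edge is charged to its left end if it is the
    uppermost edge leaving it, to its right end if it is the uppermost edge arriving there, and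
    otherwise to a vertex it sees. No vertex is charged twice in the same way. *)
Lemma plane_graph_edges : (#|E| <= 3 * #|V|)%N.
Proof.
pose E3 := E :\: (top_right :|: top_left).
have sub : (#|E| <= #|top_right| + #|top_left| + #|E3|)%N.
  apply: leq_trans (leq_add (leq_card_setU _ _) (leqnn _)).
  rewrite -[X in (X <= _)%N](cardsID (top_right :|: top_left) E) leq_add2r.
  exact/subset_leq_card/subsetIr.
have h3 : (#|E3| <= #|V|)%N.
  have ex e : e \in E3 -> exists w, sees e w.
    rewrite !inE negb_or => /andP[/andP[h1 h2] eE].
    by apply: sees_exists => //; rewrite !inE.
  pose f e := odflt e.1 [pick w | sees e w].
  have fP e : e \in E3 -> sees e (f e).
    move=> /ex[w hw]; rewrite /f; case: pickP => //= h; by rewrite h in hw.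
  have inj : {in E3 &, injective f}.
    move=> e g he hg efg; have hh := fP _ he; have hh' := fP _ hg.
    rewrite efg in hh; apply: sees_inj hh hh'.
      by move: he; rewrite inE => /andP[].
    by move: hg; rewrite inE => /andP[].
  rewrite -(card_in_imset inj); apply/subset_leq_card/fintype.subsetP => u /imsetP[e he ->].
  by have /and4P[] := fP _ he.
have := card_top_right; have := card_top_left; lia.
Qed.

End PlaneGraphs.

(** * The crossing inequality *)

Section CrossingNumber.
Variables (F : realFieldType) (T : finType) (X Y : T -> F).
Hypothesis X_inj : injective X.
Implicit Types (e g : T * T) (V P : {set T}) (E : {set T * T}).

Definition drawing V E : Prop :=
  (forall e, e \in E -> [/\ e.1 \in V, e.2 \in V & X e.1 < X e.2]) /\
  (forall e w, e \in E -> w \in V -> over X e (X w) -> Y w != height X Y e (X w)).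

Definition crossings E : {set (T * T) * (T * T)} :=
  [set p | [&& p.1 \in E, p.2 \in E, p.1 != p.2 & `[< crosses X Y p.1 p.2 >]]].

(** Deleting one edge of a crossing destroys at least that crossing, and a drawing without crossings
    obeys the planar bound. *)
Lemma drawing_edges V E : drawing V E -> (#|E| <= 3 * #|V| + #|crossings E|)%N.
Proof.
have [n] := ubnP #|E|; elim: n E => // n IH E En [E1 E2].
have [E0|[p pE]] := set_0Vmem (crossings E).
  rewrite E0 cards0 addn0.
  apply: (plane_graph_edges X_inj E1 E2) => e g eE gE eg ce.
  suff : (e, g) \in finset.set0 by rewrite inE.
  by rewrite -E0 inE /= eE gE eg; apply/asboolP.
move: (pE); rewrite inE => /and4P[p1 p2 p12 _].
have c1 : #|E| = #|E :\ p.1|.+1 by rewrite (cardsD1 p.1) p1.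
have : (#|crossings (E :\ p.1)| < #|crossings E|)%N.
  apply: proper_card; apply/properP; split.
    apply/fintype.subsetP => x; rewrite !inE => /and4P[/andP[_ ->] /andP[_ ->] -> ->] //.
  by exists p => //; rewrite !inE eqxx.
have := IH (E :\ p.1); rewrite -ltnS -c1 => /(_ En).
have dE : drawing V (E :\ p.1).
  split=> [e|e w]; rewrite inE => /andP[_ eE]; [exact: E1|exact: E2].
move=> /(_ dE); lia.
Qed.

Section Drawing.
Variables (V : {set T}) (E : {set T * T}).
Hypothesis VE : drawing V E.

(** Crossing edges of equal slope lie on one line. No vertex lies inside an edge, so neither can
    start or end inside the other, and they coincide. *)
Lemma crosses_slope e g : e \in E -> g \in E -> e != g -> crosses X Y e g ->
  slope X Y e != slope X Y g.
Proof.
case: VE => V1 V2 eE gE eg [x [/andP[e1 e2] /andP[g1 g2] h]].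
apply: contraNneq eg => es; apply/eqP.
have hh y : height X Y e y = height X Y g y.
  by rewrite (height_shift _ _ e y x) (height_shift _ _ g y x) h es.
have [eu ev euv] := V1 _ eE; have [gu gv guv] := V1 _ gE.
have le1 : e.1 = g.1.
  apply: X_inj; apply/eqP; rewrite eq_le !leNgt; apply/andP; split; apply/negP => lt.
    have o : over X g (X e.1) by rewrite /over lt (lt_trans e1 g2).
    by have := V2 _ _ gE eu o; rewrite -hh height_left eqxx.
  have o : over X e (X g.1) by rewrite /over lt (lt_trans g1 e2).
  by have := V2 _ _ eE gu o; rewrite hh height_left eqxx.
have le2 : e.2 = g.2.
  apply: X_inj; apply/eqP; rewrite eq_le !leNgt; apply/andP; split; apply/negP => lt.
    have o : over X e (X g.2) by rewrite /over lt (lt_trans e1 g2).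
    by have := V2 _ _ eE gv o; rewrite hh height_right ?eqxx.
  have o : over X g (X e.2) by rewrite /over lt (lt_trans g1 e2).
  by have := V2 _ _ gE ev o; rewrite -hh height_right ?eqxx.
by rewrite [e]surjective_pairing le1 le2 -surjective_pairing.
Qed.

(** A shared end would be a second common point of two lines of different slopes. The four distinct
    ends give a crossing the survival probability [q ^- 4] in the sampling below. *)
Lemma crosses_disjoint e g : e \in E -> g \in E -> e != g -> crosses X Y e g ->
  [&& e.1 != e.2, g.1 != g.2, e.1 != g.1, e.1 != g.2, e.2 != g.1 & e.2 != g.2].
Proof.
move=> eE gE eg ceg; have sl := crosses_slope eE gE eg ceg.
case: VE => V1 V2; case: ceg => x [/andP[e1 e2] /andP[g1 g2] h].
have [_ _ euv] := V1 _ eE; have [_ _ guv] := V1 _ gE.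
have meet u : height X Y e (X u) = height X Y g (X u) -> x != X u -> False.
  rewrite (height_shift _ _ e _ x) (height_shift _ _ g _ x) h => /addrI hh xu.
  move/eqP: sl; apply; apply: mulIf hh; by rewrite subr_eq0 eq_sym.
apply/and5P; split; last (apply/andP; split); apply/eqP => E0.
- by rewrite E0 ltxx in euv.
- by rewrite E0 ltxx in guv.
- by apply: (meet e.1); rewrite ?gt_eqF // {2}E0 !height_left E0.
- by have := lt_trans e1 g2; rewrite E0 ltxx.
- by have := lt_trans g1 e2; rewrite E0 ltxx.
- by apply: (meet e.2); rewrite ?lt_eqF // {2}E0 !height_right // E0.
Qed.

(** A function into ['I_q.+1] encodes the random set of its zeros; a given [W] lies in that set with
    probability [q.+1 ^- #|W|]. *)
Lemma card_vanishing q (W : {set T}) :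
  (#|[set h : {ffun T -> 'I_q.+1} | [forall u in W, h u == ord0]]| * q.+1 ^ #|W|
   = q.+1 ^ #|T|)%N.
Proof.
have -> : #|[set h : {ffun T -> 'I_q.+1} | [forall u in W, h u == ord0]]| =
    #|family (fun u : T => if u \in W then pred1 (ord0 : 'I_q.+1) else predT)|.
  apply: eq_card => h; rewrite inE; apply/forall_inP/familyP => H u.
    by case: ifP => [/H|].
  by move=> uW; have := H u; rewrite uW.
rewrite card_family foldrE big_map big_enum /=.
have -> : (q.+1 ^ #|W| = \prod_(u : T) if u \in W then q.+1 else 1)%N.
  by rewrite -big_mkcond prod_nat_const.
rewrite -big_split /=; transitivity (\prod_(u : T) q.+1)%N; last first.
  by rewrite big_const iter_muln_1.
by apply: eq_bigr => u _; case: ifP; rewrite ?card1 ?card_ord ?muln1 ?mul1n.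
Qed.

(* Average [drawing_edges] over the random subsets of [V] obtained by keeping
   each vertex independently with probability [1/q]. *)
Lemma crossing_number q : (0 < q)%N ->
  (q ^ 2 * #|E| <= 3 * #|V| * q ^ 3 + #|crossings E|)%N.
Proof.
case: q => // q _.
pose H := {ffun T -> 'I_q.+1}.
pose Vh (h : H) := [set u in V | h u == ord0].
pose Eh (h : H) := [set e in E | (h e.1 == ord0) && (h e.2 == ord0)].
pose Z (W : {set T}) := #|[set h : H | [forall u in W, h u == ord0]]|.
have dh h : drawing (Vh h) (Eh h).
  case: VE => V1 V2; split=> [e|e w].
    by rewrite !inE => /and3P[/V1[-> -> ->] -> ->].
  by rewrite !inE => /and3P[eE _ _] /andP[wV _]; exact: V2.
have sub : (\sum_(h : H) #|Eh h| <= \sum_(h : H) (3 * #|Vh h| + #|crossings (Eh h)|))%N.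
  by apply: leq_sum => h _; apply: drawing_edges.
(* One double count serves vertices, edges and crossings: an object that depends on [k] vertices
   survives for a fraction [q.+1 ^- k] of the functions. *)
have count (I : finType) (A : {set I}) (W : I -> {set T}) (B : H -> {set I}) k :
    (forall h, B h = [set i in A | [forall u in W i, h u == ord0]]) ->
    (forall i, i \in A -> #|W i| = k) ->
    ((\sum_(h : H) #|B h|) * q.+1 ^ k = #|A| * q.+1 ^ #|T|)%N.
  move=> hB hW.
  have -> : (\sum_(h : H) #|B h| = \sum_(i in A) Z (W i))%N.
    transitivity (\sum_(h : H) \sum_(i in A | [forall u in W i, h u == ord0]) 1)%N.
      by apply: eq_bigr => h _; rewrite hB -sum1_card; apply: eq_bigl => i; rewrite inE.
    rewrite (exchange_big_dep (mem A)) /=; last by move=> h i _ /andP[].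
    apply: eq_bigr => i iA; rewrite sum1_card /Z; apply: eq_card => h.
    by rewrite !inE unfold_in iA.
  rewrite big_distrl /= -sum_nat_const; apply: eq_bigr => i iA.
  by rewrite -(card_vanishing q (W i)) hW.
have sV := count _ V (fun u => [set u]) Vh 1%N.
have sE := count _ E (fun e => [set e.1; e.2]) Eh 2%N.
have sX := count _ (crossings E) (fun p => [set p.1.1; p.1.2; p.2.1; p.2.2])
  (fun h => crossings (Eh h)) 4%N.
have {}sV : ((\sum_(h : H) #|Vh h|) * q.+1 ^ 1 = #|V| * q.+1 ^ #|T|)%N.
  apply: sV => [h|u _]; last by rewrite cards1.
  apply/setP => u; rewrite !inE; congr andb; apply/eqP/forall_inP => [h0 w|].
    by rewrite inE => /eqP ->; apply/eqP.
  by move=> /(_ u); rewrite inE eqxx => /(_ isT)/eqP.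
have {}sE : ((\sum_(h : H) #|Eh h|) * q.+1 ^ 2 = #|E| * q.+1 ^ #|T|)%N.
  apply: sE => [h|e eE].
    apply/setP => e; rewrite !inE; congr andb; apply/andP/forall_inP => [[h1 h2] w|hw].
      by rewrite !inE => /orP[] /eqP ->.
    by split; apply: hw; rewrite !inE eqxx ?orbT.
  case: VE => /(_ _ eE)[_ _ uv] _; rewrite cards2.
  by case: eqP uv => // ->; rewrite ltxx.
have {}sX : ((\sum_(h : H) #|crossings (Eh h)|) * q.+1 ^ 4 = #|crossings E| * q.+1 ^ #|T|)%N.
  apply: sX => [h|p].
    apply/setP => p; rewrite !inE.
    have -> : [forall u in [set p.1.1; p.1.2; p.2.1; p.2.2], h u == ord0] =
      [&& h p.1.1 == ord0, h p.1.2 == ord0, h p.2.1 == ord0 & h p.2.2 == ord0].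
      apply/forall_inP/and4P => [hw|[h1 h2 h3 h4] w].
        by split; apply: hw; rewrite !inE eqxx ?orbT.
      by rewrite !inE -!orbA => /or4P[] /eqP ->.
    move: (p.1 \in E) (p.2 \in E) (p.1 != p.2) `[< _ >] (h p.1.1 == _) (h p.1.2 == _).
    by move: (h p.2.1 == _) (h p.2.2 == _); do 8!case.
  rewrite inE => /and4P[p1 p2 p12 /asboolP cp].
  have /and5P[h1 h2 h3 h4 /andP[h5 h6]] := crosses_disjoint p1 p2 p12 cp.
  rewrite -!finset.setUA cardsU1 cardsU1 cards2 !inE.
  by rewrite (negPf h1) (negPf h2) (negPf h3) (negPf h4) (negPf h5) (negPf h6).
rewrite -(leq_pmul2r (m := (q.+1 ^ #|T|)%N)) ?expn_gt0 //.
have : ((\sum_(h : H) #|Eh h|) * q.+1 ^ 4 <=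
    3 * ((\sum_(h : H) #|Vh h|) * q.+1 ^ 1) * q.+1 ^ 3 + (\sum_(h : H) #|crossings (Eh h)|) *
      q.+1 ^ 4)%N.
  rewrite big_split /= -big_distrr /= in sub.
  apply: leq_trans (leq_mul sub (leqnn _)) _.
  by rewrite mulnDl leq_add2r expnS -!mulnA expn1.
rewrite sV sX.
have -> : ((\sum_(h : H) #|Eh h|) * q.+1 ^ 4 = q.+1 ^ 2 * #|E| * q.+1 ^ #|T|)%N.
  by rewrite -mulnA -sE (expnD _ 2 2) mulnA mulnC.
by rewrite mulnDl (mulnA 3%N) (mulnAC (3 * #|V|)%N).
Qed.

End Drawing.
End CrossingNumber.

(** * Szemeredi-Trotter for points with distinct abscissas *)

Section AffineIncidences.
Variables (F : realFieldType) (T : finType) (X Y : T -> F).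
Hypothesis X_inj : injective X.

Definition adet u v w : F := (X v - X u) * (Y w - Y u) - (X w - X u) * (Y v - Y u).
Definition aline u v : {set T} := [set w | adet u v w == 0].

Lemma mem_alineP u v w : u != v ->
  reflect (Y w = height X Y (u, v) (X w)) (w \in aline u v).
Proof.
move=> uv; have d : X v - X u != 0 by rewrite subr_eq0 (inj_eq X_inj) eq_sym.
rewrite inE /adet /height /slope /=.
apply: (iffP eqP) => [h|->]; last by field.
have -> : Y w = Y u + (Y w - Y u) by ring.
congr (_ + _); apply: (mulfI d); move/eqP: h; rewrite subr_eq0 => /eqP ->; by field.
Qed.

Lemma aline_eq u v x y : u != v -> x != y -> x \in aline u v -> y \in aline u v ->
  aline x y = aline u v /\ height X Y (x, y) =1 height X Y (u, v).
Proof.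
move=> uv xy /mem_alineP-/(_ uv) hx /mem_alineP-/(_ uv) hy.
have d : X y - X x != 0 by rewrite subr_eq0 (inj_eq X_inj) eq_sym.
have hh : height X Y (x, y) =1 height X Y (u, v).
  move=> z; rewrite {1}/height {1}/slope /= hx hy.
  by rewrite (height_shift _ _ _ (X y) (X x)) (height_shift _ _ _ z (X x)); field.
split=> //; apply/setP => w; apply/mem_alineP/mem_alineP => //; by rewrite hh.
Qed.

(** Join consecutive points of [P] on each line: a line with m > 0 points gives m - 1 edges, so
    edges and lines together dominate the incidences. Crossing edges lie on two different lines, and
    this pair of lines determines the crossing, which leaves at most [#|Ls| ^ 2] of them. *)
Lemma affine_incidences (P : {set T}) (Ls : {set {set T}}) q : (0 < q)%N ->
  (forall l, l \in Ls -> exists u v, u != v /\ l = aline u v) ->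
  (q ^ 2 * \sum_(l in Ls) #|l :&: P| <= 3 * #|P| * q ^ 3 + #|Ls| ^ 2 + q ^ 2 * #|Ls|)%N.
Proof.
move=> q0 hL.
pose ln (e : T * T) := aline e.1 e.2.
pose E := [set e : T * T | [&& e.1 \in P, e.2 \in P, X e.1 < X e.2, ln e \in Ls &
  [forall w in P, (w \in ln e) ==> ~~ over X e (X w)]]].
have EP e : e \in E -> [/\ e.1 \in P, e.2 \in P, e.1 != e.2, X e.1 < X e.2 & ln e \in Ls].
  rewrite inE => /and5P[-> -> h -> _]; rewrite h; split=> //.
  by apply: contraTneq h => ->; rewrite ltxx.
have Efree e w : e \in E -> w \in P -> w \in ln e -> ~~ over X e (X w).
  by rewrite inE => /and5P[_ _ _ _ /forall_inP h] wP; apply: implyP; apply: h.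
have mem1 e : e \in E -> (e.1 \in ln e) && (e.2 \in ln e).
  by rewrite !inE /adet => _; apply/andP; split; apply/eqP; ring.
have dE : drawing X Y P E.
  split=> [e /EP[]//|e w eE wP ow].
  have [_ _ e12 _ _] := EP _ eE.
  apply: contraL ow => /eqP h; apply: Efree => //; apply/(mem_alineP w e12).
  by rewrite h; case: (e).
have cE : (\sum_(l in Ls) #|l :&: P| <= #|E| + #|Ls|)%N.
  rewrite -sum1_card (partition_big ln (mem Ls)) /=; last by move=> e /EP[].
  rewrite -[#|Ls|]sum1_card -big_split /=; apply: leq_sum => l lL.
  have [x0 [y0 [xy0 le]]] := hL _ lL.
  rewrite sum1_card addn1.
  have [->|[x xl]] := set_0Vmem (l :&: P); first by rewrite cards0.
  have [z zl zmax] : exists2 z, z \in l :&: P & forall w, w \in l :&: P -> X w <= X z.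
    by case: (arg_maxP (P := mem (l :&: P)) X xl) => z zl zmax; exists z.
  rewrite (cardsD1 z) zl ltnS.
  (* The next point to the right of [u] on the line. Only the rightmost point [z] has none, and it
     serves as the default. *)
  pose nx u := [arg min_(v < z | (v \in l :&: P) && (X u < X v)) X v]%O.
  have nxP u : u \in (l :&: P) :\ z ->
      [/\ nx u \in l :&: P, X u < X (nx u) &
       forall w, w \in l :&: P -> X u < X w -> X (nx u) <= X w].
    move=> /setD1P[uz ulP].
    have zu : (z \in l :&: P) && (X u < X z).
      rewrite zl lt_neqAle (inj_eq X_inj) uz; exact: zmax.
    rewrite /nx; case: (arg_minP (P := fun v => (v \in l :&: P) && (X u < X v)) X zu) => w
      /andP[h1 h2] h3; split=> // w' h4 h5.
    by apply: h3; rewrite h4.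
  have injn : {in (l :&: P) :\ z &, injective (fun u => (u, nx u))} by move=> u v _ _ [].
  rewrite -(card_in_imset injn); apply/subset_leq_card/fintype.subsetP => e /imsetP[u uD ->].
  have [n1 n2 n3] := nxP _ uD.
  move: uD; rewrite inE => /andP[_]; rewrite inE => /andP[ul uP].
  move: n1; rewrite inE => /andP[nl nP].
  have un : u != nx u by apply: contraTneq n2 => <-; rewrite ltxx.
  have ll : ln (u, nx u) = l by rewrite /ln /= le; apply: (aline_eq _ _ _ _).1 => //; rewrite -le.
  rewrite unfold_in; apply/andP; split; last by apply/eqP.
  rewrite inE ll uP nP n2 lL /=; apply/forall_inP => w wP; apply/implyP => wl.
  apply/negP => /andP[h1 h2]; have := n3 w; rewrite inE wl wP => /(_ isT h1).
  by rewrite leNgt h2.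
have cX : (#|crossings X Y E| <= #|Ls| ^ 2)%N.
  rewrite -mulnn -cardsX.
  have lnE e g : e \in E -> g \in E -> ln e = ln g -> height X Y e =1 height X Y g.
    move=> eE gE eg; have /andP[m1 m2] := mem1 _ eE.
    have [_ _ e12 _ _] := EP _ eE; have [_ _ g12 _ _] := EP _ gE.
    have := (@aline_eq g.1 g.2 e.1 e.2 g12 e12).
    rewrite -/(ln g) -eg m1 m2 => /(_ isT isT)[_ h] z.
    by move: (h z); case: (e); case: (g).
  (* Edges of one line join consecutive points, so overlapping ones are equal. *)
  have same e g x : e \in E -> g \in E -> ln e = ln g -> over X e x -> over X g x -> e = g.
    move=> eE gE eg /andP[e1 e2] /andP[g1 g2].
    have [ep1 ep2 _ _ _] := EP _ eE; have [gp1 gp2 _ _ _] := EP _ gE.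
    have /andP[m1 m2] := mem1 _ eE; have /andP[m3 m4] := mem1 _ gE.
    rewrite [e]surjective_pairing [g]surjective_pairing; congr (_, _);
      apply: X_inj; apply/eqP; rewrite eq_le !leNgt; apply/andP; split; apply/negP => lt.
    - have := Efree g e.1 gE ep1; rewrite -eg m1 => /(_ isT); rewrite /over lt.
      by rewrite (lt_trans e1 g2).
    - have := Efree e g.1 eE gp1; rewrite eg m3 => /(_ isT); rewrite /over lt.
      by rewrite (lt_trans g1 e2).
    - have := Efree e g.2 eE gp2; rewrite eg m4 => /(_ isT); rewrite /over lt.
      by rewrite (lt_trans e1 g2).
    - have := Efree g e.2 gE ep2; rewrite -eg m2 => /(_ isT); rewrite /over lt.
      by rewrite (lt_trans g1 e2).
  have crE p : (p \in crossings X Y E) =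
      [&& p.1 \in E, p.2 \in E, p.1 != p.2 & `[< crosses X Y p.1 p.2 >]].
    exact: finset.in_set.
  have inj : {in crossings X Y E &, injective (fun p => (ln p.1, ln p.2))}.
    move=> [e g] [e' g']; rewrite !crE /= => /and4P[eE gE eg /asboolP c].
    move=> /and4P[eE' gE' eg' /asboolP c'] [l1 l2].
    have sl := crosses_slope X_inj dE eE gE eg c.
    case: c => x [oe og h]; case: c' => y [oe' og' h'].
    have xy : y = x.
      move: h'; rewrite -(lnE _ _ eE eE' l1) -(lnE _ _ gE gE' l2).
      rewrite (height_shift _ _ e y x) (height_shift _ _ g y x) h => /addrI/eqP.
      rewrite -subr_eq0 -mulrBl mulf_eq0 !subr_eq0 (negPf sl) => /eqP ->//.
    rewrite xy in oe' og'.
    by rewrite (same e e' x) // (same g g' x).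
  rewrite -(card_in_imset inj); apply/subset_leq_card/fintype.subsetP => s /imsetP[p].
  by rewrite crE => /and4P[/EP[_ _ _ _ h1] /EP[_ _ _ _ h2] _ _] ->; rewrite inE h1 h2.
apply: leq_trans (leq_mul (leqnn (q ^ 2)%N) cE) _; rewrite mulnDr leq_add2r.
apply: leq_trans (crossing_number X_inj dE q0) _; by rewrite leq_add2l.
Qed.

End AffineIncidences.

(** * Lines and rectangles in the lattice *)

Section LatticeGeometry.
Variables (T : finType) (pt : T -> int * int).
Hypothesis pt_inj : injective pt.
Implicit Types (a b c d u v w : T) (P A B C D : {set T}).

Definition dx u v : int := (pt v).1 - (pt u).1.
Definition dy u v : int := (pt v).2 - (pt u).2.
Definition cross3 u v w : int := dx u v * dy u w - dx u w * dy u v.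
Definition dot3 u v w : int := dx u v * dx u w + dy u v * dy u w.
(** Lines are represented by their traces on the finite point set, so that a family of lines is
    again a finite set. *)
Definition line u v : {set T} := [set w | cross3 u v w == 0].
Definition lines : {set {set T}} := [set line e.1 e.2 | e in [set e : T * T | e.1 != e.2]].
Definition perp a b d : bool := [&& a != b, a != d & dot3 a b d == 0].

Lemma dxy_eq0 u v : dx u v = 0 -> dy u v = 0 -> u = v.
Proof.
rewrite /dx /dy => h1 h2; apply: pt_inj.
by rewrite [pt u]surjective_pairing [pt v]surjective_pairing; congr (_, _); lia.
Qed.

(** Lattice points may share an abscissa, which the drawings above exclude. The shear
    [(x, y) -> (M x + y, y)] preserves lines, and its first coordinate is injective as soon as [M]
    exceeds all differences of ordinates. *)
Definition shear_modulus : nat := (\sum_w `|(pt w).2| + \sum_w `|(pt w).2|).+1.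
Definition shearX w : rat := (shear_modulus%:Z * (pt w).1 + (pt w).2)%:~R.
Definition shearY w : rat := (pt w).2%:~R.

Lemma shearX_inj : injective shearX.
Proof.
move=> u v /intr_inj h.
have hs w : (`|(pt w).2| <= \sum_w `|(pt w).2|)%N by rewrite (bigD1 w) //= leq_addr.
have := hs u; have := hs v; move: h; rewrite /shear_modulus.
set s := (\sum_w _)%N => h h1 h2.
have h3 : (s + s).+1%:Z * dx u v = - dy u v by rewrite /dx /dy; lia.
have h4 : `|dy u v| <= (s + s)%:Z by rewrite /dy; lia.
have dx0 : dx u v = 0.
  by case: (ltrgtP (dx u v) 0) => // h5; nia.
by apply: dxy_eq0 => //; move: h3; rewrite dx0; lia.
Qed.

Lemma alineE u v : aline shearX shearY u v = line u v.
Proof.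
apply/setP => w; rewrite !inE /adet /shearX /shearY.
have -> : (shear_modulus%:Z * (pt v).1 + (pt v).2)%:~R - (shear_modulus%:Z * (pt u).1 + (pt
  u).2)%:~R
  = (shear_modulus%:Z * dx u v + dy u v)%:~R :> rat by rewrite -intrB /dx /dy; congr (_%:~R); ring.
have -> : (shear_modulus%:Z * (pt w).1 + (pt w).2)%:~R - (shear_modulus%:Z * (pt u).1 + (pt
  u).2)%:~R
  = (shear_modulus%:Z * dx u w + dy u w)%:~R :> rat by rewrite -intrB /dx /dy; congr (_%:~R); ring.
rewrite -!intrB -!intrM -intrB intr_eq0 -/(dy u v) -/(dy u w).
have -> : (shear_modulus%:Z * dx u v + dy u v) * dy u w - (shear_modulus%:Z * dx u w + dy u w) *
  dy u v
  = shear_modulus%:Z * cross3 u v w by rewrite /cross3; ring.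
by rewrite mulf_eq0.
Qed.

Lemma line_eq u v x y : u != v -> x != y -> x \in line u v -> y \in line u v ->
  line x y = line u v.
Proof.
rewrite -!alineE => uv xy hx hy.
by have [] := aline_eq shearX_inj uv xy hx hy.
Qed.

Lemma line_left u v : u \in line u v.
Proof. by rewrite inE /cross3 /dx /dy !subrr mul0r mulr0 subrr. Qed.

Lemma line_right u v : v \in line u v.
Proof. by rewrite inE /cross3 mulrC subrr. Qed.

Lemma lineC u v : line u v = line v u.
Proof.
have [->//|uv] := eqVneq u v.
by apply: line_eq; rewrite // ?line_left ?line_right // eq_sym.
Qed.

Lemma line_lines u v : u != v -> line u v \in lines.
Proof. by move=> uv; apply/imsetP; exists (u, v); rewrite ?inE. Qed.

Lemma incidences P (Ls : {set {set T}}) q : (0 < q)%N -> Ls \subset lines ->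
  (q ^ 2 * \sum_(l in Ls) #|l :&: P| <= 3 * #|P| * q ^ 3 + #|Ls| ^ 2 + q ^ 2 * #|Ls|)%N.
Proof.
move=> q0 sub; apply: (@affine_incidences _ _ shearX shearY shearX_inj P Ls q q0) => l lL.
have /imsetP[e] := fintype.subsetP sub _ lL; rewrite inE => e12 ->.
by exists e.1, e.2; rewrite alineE.
Qed.

Definition rich P k : {set {set T}} := [set l in lines | (k <= #|l :&: P|)%N].

Lemma rich_sub P k : rich P k \subset lines.
Proof. by apply/fintype.subsetP => l; rewrite inE => /andP[]. Qed.

Lemma card_rich P k : (#|rich P k| * k <= \sum_(l in rich P k) #|l :&: P|)%N.
Proof. by rewrite -sum_nat_const; apply: leq_sum => l; rewrite inE => /andP[]. Qed.

(** Apply [incidences] with the least [q >= 1] such that [4 y <= q ^ 2 k], where [y] is the number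
    of rich lines and [I] their incidences. As [y k <= I] and [2 <= k], both terms in [y] are
    absorbed, leaving [I <= 12 n q]. For [q = 1] this is the linear term; otherwise minimality gives
    [q ^ 2 k ^ 2 <= 16 I], and [2304 = 12 ^ 2 * 16]. *)
Lemma rich_incidences P k : (1 < k)%N ->
  ((\sum_(l in rich P k) #|l :&: P|) * k ^ 2 <= 2304 * #|P| ^ 2 + 12 * #|P| * k ^ 2)%N.
Proof.
move=> k1; have := card_rich P k; have := @incidences P (rich P k) _ _ (rich_sub P k).
set I := (\sum_(l in _) _)%N; set y := #|rich P k|; set n := #|P| => st yk.
have exq : exists q, (4 * y <= q.+1 ^ 2 * k)%N by exists (4 * y)%N; nia.
case: (ex_minnP exq) => q hq qmin.
have {}st := st q.+1 isT.
have st2 : (I <= 12 * n * q.+1)%N.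
  have h1 : (q.+1 ^ 2 * y * 2 <= q.+1 ^ 2 * I)%N by nia.
  have h2 : (4 * (y * y) <= q.+1 ^ 2 * I)%N.
    have : (4 * y * y <= q.+1 ^ 2 * (y * k))%N by nia.
    nia.
  have h3 : (q.+1 ^ 2 * I <= q.+1 ^ 2 * (12 * n * q.+1))%N.
    have -> : (q.+1 ^ 2 * (12 * n * q.+1) = 12 * n * q.+1 ^ 3)%N by rewrite !expnS expn0; lia.
    rewrite -mulnn in st; lia.
  by rewrite leq_pmul2l in h3; rewrite ?expn_gt0.
case: q hq qmin st2 {st} => [|q] hq qmin st2.
  by apply: leq_trans (leq_mul st2 (leqnn _)) _; rewrite muln1 leq_addl.
have h4 : (q.+1 ^ 2 * k < 4 * y)%N.
  by rewrite ltnNge; apply/negP => /qmin; rewrite ltnn.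
have h5 : (q.+2 ^ 2 * k ^ 2 <= 16 * I)%N.
  have : (q.+2 ^ 2 <= 4 * q.+1 ^ 2)%N by rewrite -!mulnn; nia.
  have : (q.+1 ^ 2 * k * k <= 4 * I)%N by nia.
  rewrite -(mulnn k); nia.
have h6 : (I * I * k ^ 2 <= 2304 * n ^ 2 * I)%N.
  apply: (@leq_trans ((12 * n * q.+2) ^ 2 * k ^ 2)).
    by rewrite mulnn leq_mul2r leq_sqr st2 orbT.
  rewrite !expnMn -mulnA -[(12 ^ 2)%N]/144%N.
  apply: leq_trans (leq_mul (leqnn (144 * n ^ 2)%N) h5) _; lia.
have [->|I0] := posnP I; first by rewrite mul0n.
apply: leq_trans (leq_addr _ _).
rewrite -(leq_pmul2r I0); apply: leq_trans h6; lia.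
Qed.

(** * Perpendicular lines and rectangles *)

Lemma perpC a b d : perp a b d = perp a d b.
Proof. by rewrite /perp andbCA /dot3 mulrC (mulrC (dy a b)). Qed.

Lemma collinear_orthogonal (p1 p2 p1' p2' q1 q2 : int) :
  (p1 != 0) || (p2 != 0) -> p1 * p2' - p1' * p2 = 0 -> p1 * q1 + p2 * q2 = 0 ->
  p1' * q1 + p2' * q2 = 0.
Proof.
move=> p0 h1 h2.
have e1 : p1 * (p1' * q1 + p2' * q2) = 0.
  transitivity (p1' * (p1 * q1 + p2 * q2) + (p1 * p2' - p1' * p2) * q2); first by ring.
  by rewrite h1 h2 mulr0 mul0r addr0.
have e2 : p2 * (p1' * q1 + p2' * q2) = 0.
  transitivity (p2' * (p1 * q1 + p2 * q2) + (p1 * p2' - p1' * p2) * (- q1)); first by ring.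
  by rewrite h1 h2 mulr0 mul0r addr0.
move/eqP: e1; move/eqP: e2; rewrite !mulf_eq0 => e2 e1.
case/orP: p0 => p0.
  by move: e1; rewrite (negPf p0) => /eqP.
by move: e2; rewrite (negPf p0) => /eqP.
Qed.

Lemma orthogonal_collinear (p1 p2 q1 q2 r1 r2 : int) :
  (p1 != 0) || (p2 != 0) -> p1 * q1 + p2 * q2 = 0 -> p1 * r1 + p2 * r2 = 0 ->
  q1 * r2 - r1 * q2 = 0.
Proof.
move=> p0 h1 h2.
have := @collinear_orthogonal p1 p2 (- q2) q1 r1 r2 p0.
rewrite h2 => h; have : - q2 * r1 + q1 * r2 = 0 by apply: h => //; lia.
lia.
Qed.

Lemma dxy_neq0 u v : u != v -> (dx u v != 0) || (dy u v != 0).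
Proof.
move=> uv; rewrite -negb_and; apply: contra uv => /andP[/eqP h1 /eqP h2].
by apply/eqP; apply: dxy_eq0.
Qed.

Lemma perp_line a b b' d d' : perp a b d -> perp a b' d' -> line a b = line a b' ->
  line a d = line a d'.
Proof.
move=> /and3P[ab ad /eqP h] /and3P[ab' ad' /eqP h'] ll.
have h'' : dot3 a b d' = 0.
  apply: (@collinear_orthogonal (dx a b') (dy a b')); rewrite ?dxy_neq0 //.
  have : b \in line a b' by rewrite -ll line_right.
  by rewrite inE => /eqP.
apply: line_eq; rewrite // ?line_left // inE; apply/eqP.
exact: (orthogonal_collinear (dxy_neq0 ab) h'' h).
Qed.

Lemma dot3_self u v : dot3 u v v = 0 -> u = v.
Proof.
rewrite /dot3 => h; apply: dxy_eq0; nia.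
Qed.

(** Uniqueness of the foot of the perpendicular from [b]: both [b - a] and [b - a'] are orthogonal
    to [a' - a], so [a' - a] has length zero. *)
Lemma perp_foot a a' b d d' : perp a b d -> perp a' b d' -> line a d = line a' d' -> a = a'.
Proof.
move=> /and3P[ab ad /eqP h] /and3P[ab' ad' /eqP h'] ll; apply: dot3_self.
have e1 : dot3 a a' b = 0.
  apply: (@collinear_orthogonal (dx a d) (dy a d)); rewrite ?dxy_neq0 //.
    have : a' \in line a d by rewrite ll line_left.
    by rewrite inE => /eqP.
  by move: h; rewrite /dot3; lia.
have e2 : dot3 a' a b = 0.
  apply: (@collinear_orthogonal (dx a' d') (dy a' d')); rewrite ?dxy_neq0 //.
    have : a \in line a' d' by rewrite -ll line_left.
    by rewrite inE => /eqP.
  by move: h'; rewrite /dot3; lia.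
have -> : dot3 a a' a' = dot3 a a' b + dot3 a' a b by rewrite /dot3 /dx /dy; ring.
by rewrite e1 e2.
Qed.

Lemma perp_corner a a' b b' d d' : perp a b d -> perp a' b' d' ->
  line a b = line a' b' -> line a d = line a' d' -> a = a'.
Proof.
move=> /and3P[ab ad /eqP h] /and3P[ab' ad' /eqP h'] l1 l2; apply/eqP; apply: contraT => aa'.
have : a' \in line a b by rewrite l1 line_left.
have : a' \in line a d by rewrite l2 line_left.
rewrite !inE => /eqP e1 /eqP e2.
have e3 : dot3 a a' b = 0.
  apply: (@collinear_orthogonal (dx a d) (dy a d)); rewrite ?dxy_neq0 //.
  by move: h; rewrite /dot3; lia.
have : dot3 a a' a' = 0.
  apply: (@collinear_orthogonal (dx a b) (dy a b)); rewrite ?dxy_neq0 //.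
  by move: e3; rewrite /dot3; lia.
by move/dot3_self => /eqP; rewrite (negPf aa').
Qed.

Definition rect a b c d : bool := [&& perp a b d, dx a b == dx d c & dy a b == dy d c].

Lemma rect_perp a b c d : rect a b c d -> perp a b d. Proof. by case/andP. Qed.

Lemma rect_rot a b c d : rect a b c d -> rect b c d a.
Proof.
move=> /and3P[/and3P[ab ad /eqP h] /eqP h1 /eqP h2].
have h3 : dx b c = dx a d by move: h1; rewrite /dx; lia.
have h4 : dy b c = dy a d by move: h2; rewrite /dy; lia.
have h5 : dx b a = - dx a b by rewrite /dx; lia.
have h6 : dy b a = - dy a b by rewrite /dy; lia.
apply/and3P; split; last 2 first.
- by apply/eqP.
- by apply/eqP.
apply/and3P; split.
- have := dxy_neq0 ad; rewrite -h3 -h4; apply: contraTneq => ->.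
  by rewrite /dx /dy !subrr eqxx.
- by rewrite eq_sym.
- by apply/eqP; move: h; rewrite /dot3 h3 h4 h5 h6; lia.
Qed.

Lemma rect_flip a b c d : rect a b c d -> rect a d c b.
Proof.
move=> /and3P[p /eqP h1 /eqP h2]; apply/and3P; split; first by rewrite perpC.
  by apply/eqP; move: h1; rewrite /dx; lia.
by apply/eqP; move: h2; rewrite /dy; lia.
Qed.

Lemma rect_fourth a b c c' d : rect a b c d -> rect a b c' d -> c = c'.
Proof.
move=> /and3P[_ /eqP h1 /eqP h2] /and3P[_ /eqP h3 /eqP h4].
by apply: dxy_eq0; move: h1 h2 h3 h4; rewrite /dx /dy; lia.
Qed.

Local Notation quad := (T * T * T * T)%type.
Definition qa (q : quad) := q.1.1.1.
Definition qb (q : quad) := q.1.1.2.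
Definition qc (q : quad) := q.1.2.
Definition qd (q : quad) := q.2.
Definition qrect q := rect (qa q) (qb q) (qc q) (qd q).
Definition rects A B C D : {set quad} :=
  [set q | [&& qa q \in A, qb q \in B, qc q \in C, qd q \in D & qrect q]].

Lemma quad_eq q q' : qrect q -> qrect q' -> qa q = qa q' -> qb q = qb q' -> qd q = qd q' ->
  q = q'.
Proof.
case: q => [[[a b] c] d]; case: q' => [[[a' b'] c'] d'] r r' /= h1 h2 h3.
rewrite /qrect /qa /qb /qc /qd /= in r r' h1 h2 h3; subst a' b' d'.
by rewrite (rect_fourth r r').
Qed.

Lemma quad_eq_abc q q' : qrect q -> qrect q' -> qa q = qa q' -> qb q = qb q' -> qc q = qc q' ->
  q = q'.
Proof.
case: q => [[[a b] c] d]; case: q' => [[[a' b'] c'] d'] r r' /= h1 h2 h3.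
rewrite /qrect /qa /qb /qc /qd /= in r r' h1 h2 h3; subst a' b' c'.
by rewrite (rect_fourth (rect_rot r) (rect_rot r')).
Qed.

Lemma card_fibers (I J : finType) (f : I -> J) (S : {set I}) M :
  (forall y, y \in f @: S -> #|[set x in S | f x == y]| <= M)%N ->
  (#|S| <= M * #|f @: S|)%N.
Proof.
move=> h; rewrite -sum1_card (partition_big_imset f) /= mulnC -sum_nat_const.
apply: leq_sum => y yS; rewrite sum1_card; apply: leq_trans (h y yS).
by rewrite leq_eqVlt; apply/orP; left; apply/eqP/eq_card => x; rewrite !inE.
Qed.

Lemma card_inj_into (I J : finType) (f : I -> J) (S : {set I}) (U : {set J}) :
  {in S &, injective f} -> (forall x, x \in S -> f x \in U) -> (#|S| <= #|U|)%N.
Proof.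
move=> inj h; rewrite -(card_in_imset inj); apply/subset_leq_card/fintype.subsetP => y.
by case/imsetP => x /h hx ->.
Qed.

Definition flags P (Ls : {set {set T}}) : {set T * {set T}} :=
  [set p | [&& p.1 \in P, p.2 \in Ls & p.1 \in p.2]].

Lemma card_flags P Ls : #|flags P Ls| = (\sum_(l in Ls) #|l :&: P|)%N.
Proof.
rewrite -sum1_card (partition_big (fun p => p.2) (mem Ls)) /=; last first.
  by move=> p; rewrite inE => /and3P[].
apply: eq_bigr => l lL; rewrite sum1_card.
have inj : injective (fun u : T => (u, l)) by move=> u v [].
rewrite -(card_imset _ inj); apply: eq_card => p; rewrite unfold_in inE.
apply/andP/imsetP => [[/and3P[h1 h2 h3] /eqP h4]|[u]].
  by exists p.1; rewrite ?inE -?h4 ?h3 ?h1 // -surjective_pairing.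
by rewrite inE => /andP[h1 h2] ->; rewrite /= h1 h2 lL eqxx.
Qed.

Definition heavy P : {set {set T}} :=
  [set l in lines | (1 < #|l :&: P|)%N && (#|P| <= #|l :&: P| ^ 2)%N].

(** From richness [sqrt #|P|] on, the quadratic term of [rich_incidences] is no larger than a
    multiple of the linear one; [2316 = 2304 + 12]. *)
Lemma heavy_incidences P : (\sum_(l in heavy P) #|l :&: P| <= 2316 * #|P|)%N.
Proof.
have ex : exists k, (1 < k)%N && (#|P| <= k ^ 2)%N.
  by exists (#|P| + 2)%N; rewrite addn2 /= -mulnn; nia.
case: (ex_minnP ex) => k /andP[k1 kP] kmin.
have -> : heavy P = rich P k.
  apply/setP => l; rewrite !inE; congr andb; apply/andP/idP => [[h1 h2]|h].
    by apply: kmin; rewrite h1.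
  by split; [exact: leq_trans h|apply: leq_trans kP _; rewrite leq_sqr].
have k0 : (0 < k ^ 2)%N by rewrite expn_gt0 (ltnW k1).
rewrite -(leq_pmul2r k0); apply: leq_trans (rich_incidences P k1) _.
have : (#|P| ^ 2 <= #|P| * k ^ 2)%N by rewrite -mulnn leq_mul2l kP orbT.
move: (k ^ 2)%N => z; lia.
Qed.

(** * Rectangles sorted by the richness of the two lines through a corner *)

Section RectangleCount.
Variables (A B C D : {set T}).
Notation Q := (rects A B C D).
Definition bl q := #|line (qa q) (qb q) :&: B|.
Definition dl q := #|line (qa q) (qd q) :&: D|.
Definition al q := #|line (qa q) (qb q) :&: A|.

Lemma rectsP q : q \in Q ->
  [/\ qa q \in A, qb q \in B, qc q \in C, qd q \in D & qrect q].
Proof. by rewrite inE => /and5P[]. Qed.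

Lemma rects_lines q : q \in Q -> (line (qa q) (qb q) \in lines) && (line (qa q) (qd q) \in lines).
Proof.
by case/rectsP => _ _ _ _ /rect_perp/and3P[ab ad _]; rewrite !line_lines.
Qed.

(** The points [a] and [b] fix the line [ad], and [d] is its only point in [D]. *)
Lemma rects_dl1 : (#|[set q in Q | dl q <= 1]| <= #|A| * #|B|)%N.
Proof.
rewrite -cardsX; apply: (card_inj_into (f := fun q => (qa q, qb q))) => [q q'|q]; last first.
  by rewrite !inE => /andP[/and5P[-> ->]].
rewrite [q \in _]inE [q' \in _]inE => /andP[/rectsP[_ _ _ h1 r] c] /andP[/rectsP[_ _ _ h2 r'] _]
  [ea eb].
apply: quad_eq => //; move/card_le1_eqP: c; apply; rewrite inE ?line_right ?h1 //= h2 andbT.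
have p := rect_perp r; have p' := rect_perp r'; rewrite -ea -eb in p'.
by rewrite (perp_line p p' erefl) line_right.
Qed.

(** A point [b] and an incidence of [d] with the line [ad] determine the rectangle, since [a] is the
    foot of the perpendicular from [b]. *)
Lemma rects_dl_heavy :
  (#|[set q in Q | (1 < dl q) && (#|D| <= dl q ^ 2)]| <= 2316 * (#|B| * #|D|))%N.
Proof.
apply: leq_trans (_ : #|B| * #|flags D (heavy D)| <= _)%N; last first.
  by rewrite card_flags mulnCA leq_mul2l heavy_incidences orbT.
rewrite -cardsX.
apply: (card_inj_into (f := fun q => (qb q, (qd q, line (qa q) (qd q))))) => [q q'|q].
  rewrite [q \in _]inE [q' \in _]inE => /andP[/rectsP[_ _ _ h1 r] _] /andP[/rectsP[_ _ _ h2 r']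
    _] [eb ed el].
  apply: quad_eq => //; have p := rect_perp r; have p' := rect_perp r'.
  by rewrite -eb in p'; apply: perp_foot p p' el.
rewrite [q \in _]inE => /andP[qQ h]; have /andP[_ ln] := rects_lines qQ.
have [_ h2 _ h4 r] := rectsP qQ.
by rewrite finset.in_setX h2 finset.in_set /= h4 line_right finset.in_set ln h.
Qed.

Lemma rects_bl_heavy :
  (#|[set q in Q | (1 < bl q) && (#|B| <= bl q ^ 2)]| <= 2316 * (#|B| * #|D|))%N.
Proof.
apply: leq_trans (_ : #|D| * #|flags B (heavy B)| <= _)%N; last first.
  by rewrite card_flags [(#|B| * _)%N]mulnC mulnCA leq_mul2l heavy_incidences orbT.
rewrite -cardsX.
apply: (card_inj_into (f := fun q => (qd q, (qb q, line (qa q) (qb q))))) => [q q'|q].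
  rewrite [q \in _]inE [q' \in _]inE => /andP[/rectsP[_ _ _ h1 r] _] /andP[/rectsP[_ _ _ h2 r']
    _] [ed eb el].
  apply: quad_eq => //; have p := rect_perp r; have p' := rect_perp r'.
  by rewrite -ed perpC in p'; rewrite perpC in p; apply: perp_foot p p' el.
rewrite [q \in _]inE => /andP[qQ h]; have /andP[ln _] := rects_lines qQ.
have [_ h2 _ h4 r] := rectsP qQ.
by rewrite finset.in_setX h4 finset.in_set /= h2 line_right finset.in_set ln h.
Qed.

Definition in_class (n i : nat) := (4 ^ i <= n < 4 ^ i.+1)%N.
(** The maximum with 2 matters for [i = 0], since [rich_incidences] requires a threshold above 1. *)
Definition rich4 P i := rich P (maxn 2 (4 ^ i)).

(* Both numbers of points are dyadically localised and below the square root
   barrier; [lb] and [ld] are the two lines through the corner [a]. *)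
Definition light_class i l := [set q in Q |
  [&& (1 < bl q)%N, (bl q ^ 2 < #|B|)%N, in_class (bl q) i,
      (1 < dl q)%N, (dl q ^ 2 < #|D|)%N & in_class (dl q) l]].

Definition corner q := (qa q, line (qa q) (qb q), line (qa q) (qd q)).

Lemma rich4_line P i l : l \in lines -> (1 < #|l :&: P|)%N -> in_class #|l :&: P| i ->
  l \in rich4 P i.
Proof.
by move=> ln h1 /andP[h2 h3]; rewrite inE ln geq_max h1 h2.
Qed.

(** Once the corner and its two lines are fixed, only [b] and [d] on these lines remain free. The
    corner data in turn are determined by [a] and either line, or by the two lines alone, which
    yields three competing bounds. *)
Lemma card_light_class i l :
  [/\ (#|light_class i l| <= 16 * 4 ^ i * 4 ^ l * #|corner @: light_class i l|)%N,
     (#|corner @: light_class i l| <= \sum_(m in rich4 B i) #|m :&: A|)%N,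
     (#|corner @: light_class i l| <= \sum_(m in rich4 D l) #|m :&: A|)%N &
     (#|corner @: light_class i l| <= #|rich4 B i| * #|rich4 D l|)%N].
Proof.
have LC q : q \in light_class i l -> [/\ q \in Q, qrect q,
    line (qa q) (qb q) \in rich4 B i, line (qa q) (qd q) \in rich4 D l &
    (bl q < 4 ^ i.+1)%N && (dl q < 4 ^ l.+1)%N].
  rewrite [q \in _]inE => /andP[qQ /and5P[h1 h2 h3 h4 /andP[h5 h6]]].
  have /andP[l1 l2] := rects_lines qQ; have [_ _ _ _ r] := rectsP qQ.
  split=> //; [exact: rich4_line|exact: rich4_line|].
  by move: h3 h6 => /andP[_ ->] /andP[_ ->].
have inA q : q \in light_class i l -> qa q \in A by case/LC => /rectsP[].
split.
- apply: card_fibers => y /imsetP[q0 q0L ->].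
  have [q0Q r0 _ _ /andP[hb hd]] := LC _ q0L.
  apply: (@leq_trans (bl q0 * dl q0)%N); last first.
    apply: leq_trans (leq_mul (ltnW hb) (ltnW hd)) _; rewrite !expnS; lia.
  rewrite -cardsX; apply: (card_inj_into (f := fun q => (qb q, qd q))) => [q q'|q].
    rewrite [q \in _]inE [q' \in _]inE => /andP[/LC[_ r _ _ _] /eqP[e1 _ _]].
    move=> /andP[/LC[_ r' _ _ _] /eqP[e1' _ _]] [e2 e3].
    by apply: quad_eq => //; rewrite e1 e1'.
  rewrite [q \in _]inE => /andP[/LC[/rectsP[_ h1 _ h2 _] _ _ _ _] /eqP[e1 e2 e3]].
  by rewrite finset.in_setX !finset.in_setI h1 h2 -e2 -e3 !line_right.
- rewrite -card_flags; apply: (card_inj_into (f := fun y => (y.1.1, y.1.2))) => [y y'|y].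
    move=> /imsetP[q /LC[_ /rect_perp p _ _ _] ->] /imsetP[q' /LC[_ /rect_perp p' _ _ _] ->] /=
      [e1 e2].
    rewrite /corner e1; congr (_, _, _); first by rewrite -e2 e1.
    by rewrite e1 in p e2 *; apply: perp_line p p' e2.
  case/imsetP => q qL ->; have [_ _ h _ _] := LC _ qL.
  by rewrite finset.in_set /= h (inA _ qL) line_left.
- rewrite -card_flags; apply: (card_inj_into (f := fun y => (y.1.1, y.2))) => [y y'|y].
    move=> /imsetP[q /LC[_ /rect_perp p _ _ _] ->] /imsetP[q' /LC[_ /rect_perp p' _ _ _] ->] /=
      [e1 e2].
    rewrite /corner e1; congr (_, _, _); last by rewrite -e2 e1.
    by rewrite perpC e1 in p; rewrite perpC in p'; rewrite e1 in e2; apply: perp_line p p' e2.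
  case/imsetP => q qL ->; have [_ _ _ h _] := LC _ qL.
  by rewrite finset.in_set /= h (inA _ qL) line_left.
- rewrite -cardsX; apply: (card_inj_into (f := fun y : T * {set T} * {set T} => (y.1.2, y.2))) =>
  [y y'|y].
    move=> /imsetP[q /LC[_ /rect_perp p _ _ _] ->] /imsetP[q' /LC[_ /rect_perp p' _ _ _] ->] /=
      [e1 e2].
    by rewrite /corner e1 e2 (perp_corner p p' e1 e2).
  by case/imsetP => q qL ->; have [_ _ h1 h2 _] := LC _ qL; rewrite finset.in_setX h1 h2.
Qed.

(** Below the square root barrier the quadratic term of [rich_incidences] dominates, so there are at
    most a constant times [#|P| ^ 2 / k ^ 3] rich lines. *)
Lemma rich4_bound P i : (maxn 2 (4 ^ i) ^ 2 <= #|P|)%N ->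
  (#|rich4 P i| * 64 ^ i <= 2316 * #|P| ^ 2)%N.
Proof.
set k := maxn 2 (4 ^ i) => kP.
have k1 : (1 < k)%N by rewrite leq_max.
have h1 := rich_incidences P k1; have h2 := card_rich P k.
have h3 : (64 ^ i <= k ^ 3)%N.
  have -> : (64 ^ i = (4 ^ i) ^ 3)%N by rewrite -expnM mulnC expnM.
  by rewrite leq_exp2r // leq_max leqnn orbT.
apply: leq_trans (leq_mul (leqnn _) h3) _.
have -> : (#|rich4 P i| * k ^ 3 = #|rich P k| * k * k ^ 2)%N by rewrite -mulnA -expnS.
apply: leq_trans (leq_mul h2 (leqnn _)) _; apply: leq_trans h1 _.
have : (#|P| * k ^ 2 <= #|P| ^ 2)%N by rewrite -mulnn leq_mul2l kP orbT.
rewrite -mulnA; lia.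
Qed.

Lemma light_class_bound i l : light_class i l != finset.set0 ->
  (#|rich4 B i| * 64 ^ i <= 2316 * #|B| ^ 2)%N /\
  (#|rich4 D l| * 64 ^ l <= 2316 * #|D| ^ 2)%N.
Proof.
case/set0Pn => q; rewrite inE => /andP[_ /and5P[h1 h2 /andP[h3 _] h4 /andP[h5 /andP[h6 _]]]].
by split; apply: rich4_bound; [apply: leq_trans (ltnW h2)|apply: leq_trans (ltnW h5)];
  rewrite leq_sqr geq_max ?h1 ?h3 ?h4 ?h6.
Qed.

Definition thin_class r l := [set q in Q |
  [&& (bl q <= 1)%N, (r <= al q)%N,
      (1 < dl q)%N, (dl q ^ 2 < #|D|)%N & in_class (dl q) l]].

Definition corner_foot q := (qa q, qb q, line (qa q) (qd q)).

(** Here [b] is the only point of [B] on the line [ab], so that line determines [b]. With [a], [b]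
    and the line [ad] fixed, only [d] is free. Such a triple is determined by [a] and [b], by [a]
    and [ad], by [b] and [ad] through the foot of the perpendicular, or by [a] and the line [ab],
    which is rich in [A]. *)
Lemma card_thin_class r l :
  [/\ (#|thin_class r l| <= 4 * 4 ^ l * #|corner_foot @: thin_class r l|)%N,
     (#|corner_foot @: thin_class r l| <= #|A| * #|B|)%N,
     (#|corner_foot @: thin_class r l| <= \sum_(m in rich4 D l) #|m :&: A|)%N,
     (#|corner_foot @: thin_class r l| <= #|B| * #|rich4 D l|)%N &
     (#|corner_foot @: thin_class r l| <= \sum_(m in rich A r) #|m :&: A|)%N].
Proof.
have LC q : q \in thin_class r l -> [/\ q \in Q, qrect q, (bl q <= 1)%N && (dl q < 4 ^ l.+1)%N,
    line (qa q) (qd q) \in rich4 D l & line (qa q) (qb q) \in rich A r].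
  rewrite [q \in _]inE => /andP[qQ /and5P[h1 h2 h3 h4 h5]].
  have /andP[l1 l2] := rects_lines qQ; have [_ _ _ _ r'] := rectsP qQ.
  split=> //; first by move: h5 => /andP[_ ->]; rewrite h1.
    exact: rich4_line.
  by rewrite inE l1.
have inA q : q \in thin_class r l -> (qa q \in A) && (qb q \in B).
  by case/LC => /rectsP[-> ->].
have uniqb q q' : q \in thin_class r l -> q' \in thin_class r l ->
    line (qa q) (qb q) = line (qa q') (qb q') -> qb q = qb q'.
  move=> qL qL' e; have [_ _ /andP[c _] _ _] := LC _ qL.
  have /andP[_ hb] := inA _ qL; have /andP[_ hb'] := inA _ qL'.
  move/card_le1_eqP: c; apply; rewrite finset.in_setI ?hb ?hb' ?line_right //.
  by rewrite e line_right.
split.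
- apply: (card_fibers (f := corner_foot)) => y /imsetP[q0 q0L ->].
  have [q0Q r0 /andP[_ hd] _ _] := LC _ q0L.
  apply: (@leq_trans (dl q0)%N); last by rewrite expnS in hd; exact: ltnW.
  apply: (card_inj_into (f := qd)) => [q q'|q].
    rewrite [q \in _]inE [q' \in _]inE => /andP[/LC[_ r1 _ _ _] /eqP[e1 e2 _]].
    move=> /andP[/LC[_ r1' _ _ _] /eqP[e1' e2' _]] e3.
    by apply: quad_eq => //; rewrite ?e1 ?e1' ?e2 ?e2'.
  rewrite [q \in _]inE => /andP[/LC[/rectsP[_ _ _ h2 _] _ _ _ _] /eqP[e1 e2 e3]].
  by rewrite finset.in_setI h2 -e3 line_right.
- rewrite -cardsX; apply: (card_inj_into (f := fun y => (y.1.1, y.1.2))) => [y y'|y].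
    move=> /imsetP[q /LC[_ /rect_perp p _ _ _] ->] /imsetP[q' /LC[_ /rect_perp p' _ _ _] ->] /=
      [e1 e2].
    rewrite /corner_foot e1 e2; congr (_, _, _).
    by rewrite e1 e2 in p *; apply: perp_line p p' erefl.
  by case/imsetP => q qL ->; rewrite finset.in_setX; apply: inA.
- rewrite -card_flags; apply: (card_inj_into (f := fun y => (y.1.1, y.2))) => [y y'|y].
    move=> /imsetP[q qL ->] /imsetP[q' qL' ->] /= [e1 e2].
    have [_ /rect_perp p _ _ _] := LC _ qL; have [_ /rect_perp p' _ _ _] := LC _ qL'.
    rewrite perpC in p; rewrite perpC in p'.
    have e3 : line (qa q) (qb q) = line (qa q') (qb q').
      by rewrite e1 in p e2 *; apply: perp_line p p' e2.
    by rewrite /corner_foot e2 (uniqb _ _ qL qL' e3) e1.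
  case/imsetP => q qL ->; have [_ _ _ h _] := LC _ qL.
  by have /andP[hA _] := inA _ qL; rewrite finset.in_set /= hA h line_left.
- rewrite -cardsX; apply: (card_inj_into (f := fun y : T * T * {set T} => (y.1.2, y.2))) => [y
  y'|y].
    move=> /imsetP[q /LC[_ /rect_perp p _ _ _] ->] /imsetP[q' /LC[_ /rect_perp p' _ _ _] ->] /=
      [e1 e2].
    rewrite /corner_foot e1 e2; congr (_, _, _).
    by rewrite e1 in p; apply: perp_foot p p' e2.
  case/imsetP => q qL ->; have [_ _ _ h _] := LC _ qL.
  by have /andP[_ hB] := inA _ qL; rewrite finset.in_setX /= hB h.
- rewrite -card_flags.
  apply: (card_inj_into (f := fun y => (y.1.1, line y.1.1 y.1.2))) => [y y'|y].
    move=> /imsetP[q qL ->] /imsetP[q' qL' ->] /= [e1 e2].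
    have [_ /rect_perp p _ _ _] := LC _ qL; have [_ /rect_perp p' _ _ _] := LC _ qL'.
    rewrite /corner_foot (uniqb _ _ qL qL' e2) e1; congr (_, _, _).
    by rewrite e1 in p e2 *; apply: perp_line p p' e2.
  case/imsetP => q qL ->; have [_ _ _ _ h] := LC _ qL.
  by have /andP[hA _] := inA _ qL; rewrite finset.in_set /= hA h line_left.
Qed.

Lemma thin_class_bound r l : thin_class r l != finset.set0 ->
  (#|rich4 D l| * 64 ^ l <= 2316 * #|D| ^ 2)%N.
Proof.
case/set0Pn => q; rewrite inE => /andP[_ /and5P[_ _ h1 h2 /andP[h3 _]]].
by apply: rich4_bound; apply: leq_trans (ltnW h2); rewrite leq_sqr geq_max ?h1 ?h3.
Qed.

(** [b] and [c] determine the line [ab] as the perpendicular to [bc] at [b], and [a] is one of its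
    fewer than [r] points of [A]. *)
Lemma rects_poor r : (#|[set q in Q | al q < r]| <= r * (#|B| * #|C|))%N.
Proof.
apply: leq_trans (_ : r * #|(fun q => (qb q, qc q)) @: [set q in Q | al q < r]| <= _)%N.
  apply: card_fibers => y /imsetP[q0]; rewrite [q0 \in _]inE => /andP[/rectsP[_ _ _ _ r0] h] ->.
  apply: leq_trans (ltnW h).
  apply: (card_inj_into (f := qa)) => [q q'|q].
    rewrite [q \in _]inE [q' \in _]inE => /andP[].
    rewrite [q \in _]inE [q' \in _]inE => /andP[/rectsP[_ _ _ _ r1] _] /eqP[e1 e2].
    move=> /andP[/andP[/rectsP[_ _ _ _ r2] _] /eqP[e1' e2']] e3.
    by apply: quad_eq_abc => //; rewrite ?e1 ?e2 ?e1' ?e2'.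
  rewrite [q \in _]inE => /andP[]; rewrite [q \in _]inE => /andP[/rectsP[h1 _ _ _ r1] _] /eqP[e1
    e2].
  rewrite finset.in_setI h1 andbT.
  have p := rect_perp (rect_rot r1); have p0 := rect_perp (rect_rot r0).
  rewrite e1 e2 in p.
  by rewrite lineC -(perp_line p p0 erefl) line_right.
rewrite leq_mul2l -cardsX; apply/orP; right; apply/subset_leq_card/fintype.subsetP => y.
case/imsetP => q; rewrite inE => /andP[/rectsP[_ h1 h2 _ _] _] ->.
by rewrite finset.in_setX h1 h2.
Qed.

(** 4632 is twice 2316, once for heavy lines [ad] and once for heavy lines [ab]. The classes may
    overlap, and only the covering is used. *)
Lemma rects_cover r n : (#|T| < 4 ^ n)%N ->
  (#|Q| <= #|A| * #|B| + 4632 * (#|B| * #|D|) + r * (#|B| * #|C|)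
     + \sum_(i < n) \sum_(l < n) #|light_class i l| + \sum_(l < n) #|thin_class r l|)%N.
Proof.
move=> Tn.
have cls k : (0 < k)%N -> (k <= #|T|)%N -> exists i : 'I_n, in_class k i.
  move=> k0 kT; have h := trunc_log_bounds (isT : (1 < 4)%N) k0.
  have hn : (trunc_log 4 k < n)%N.
    rewrite -(ltn_exp2l _ _ (isT : (1 < 4)%N)); case/andP: h => h _.
    exact: leq_ltn_trans h (leq_ltn_trans kT Tn).
  by exists (Ordinal hn).
pose S1 := [set q in Q | (dl q <= 1)%N].
pose S2 := [set q in Q | (1 < dl q)%N && (#|D| <= dl q ^ 2)%N].
pose S3 := [set q in Q | (1 < bl q)%N && (#|B| <= bl q ^ 2)%N].
pose S4 := [set q in Q | (al q < r)%N].
apply: (@leq_trans (\sum_(q in Q) ((q \in S1) + (q \in S2) + (q \in S3) + (q \in S4)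
   + \sum_(i < n) \sum_(l < n) (q \in light_class i l) + \sum_(l < n) (q \in thin_class r l)))%N).
  rewrite -sum1_card; apply: leq_sum => q qQ.
  rewrite [q \in S1]inE [q \in S2]inE [q \in S3]inE [q \in S4]inE qQ /=.
  have [//|d1] := leqP (dl q) 1; have [|d2] := leqP #|D| (dl q ^ 2)%N; first by lia.
  have [l hl] := cls (dl q) (ltnW d1) (max_card _).
  have [b1|b1] := leqP (bl q) 1.
    have [|a1] := ltnP (al q) r; first by lia.
    suff -> : (\sum_(l < n) (q \in thin_class r l) = (\sum_(l' < n | l' != l) (q \in thin_class r
      l')).+1)%N by lia.
    by rewrite (bigD1 l) //= inE qQ b1 a1 d1 d2 hl.
  have [|b2] := leqP #|B| (bl q ^ 2)%N; first by lia.
  have [i hi] := cls (bl q) (ltnW b1) (max_card _).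
  rewrite (bigD1 i) //= (bigD1 l) //= [q \in light_class i l]inE qQ b1 b2 hi d1 d2 hl; lia.
have cnt (S : {set quad}) : S \subset Q -> (\sum_(q in Q) (q \in S) = #|S|)%N.
  move=> /fintype.subsetP SQ; rewrite -sum1_card big_mkcond [RHS]big_mkcond /=.
  by apply: eq_bigr => q _; case: (boolP (q \in S)) => [/SQ ->|_] //=; rewrite if_same.
have sub (p : pred quad) : [set q in Q | p q] \subset Q.
  by apply/fintype.subsetP => q; rewrite inE => /andP[].
rewrite !big_split /= !cnt ?sub // exchange_big /=.
rewrite (eq_bigr (fun i : 'I_n => \sum_(l < n) #|light_class i l|)%N); last first.
  move=> i _; rewrite exchange_big /=; apply: eq_bigr => l _; exact: cnt (sub _).
rewrite [X in (_ + X <= _)%N]exchange_big /=.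
rewrite [X in (_ + X <= _)%N](eq_bigr (fun l : 'I_n => #|thin_class r l|)); last first.
  by move=> l _; exact: cnt (sub _).
rewrite !leq_add2r.
apply: leq_trans (leq_add (leq_add (leq_add rects_dl1 rects_dl_heavy) rects_bl_heavy) (rects_poor
  r)) _.
lia.
Qed.

End RectangleCount.

End LatticeGeometry.

(** * Counting rectangles *)

Section DyadicSums.
Variable R : realType.
Implicit Types (a b c d s t x y : R).

Lemma geometric_min c n : 0 < c ->
  \sum_(i < n) Num.min (c / 4 ^+ i) (c / 4 ^+ i)^-1 <= 2.
Proof.
move=> c0; apply: (@le_trans _ _ (5 / 3)); last by lra.
(* The induction replaces [c] by [c / 4]. The correction [(3 * c)^-1] makes the step an identity for
   [c > 4], and for [1 <= c <= 4] the step amounts to [(c - 1) (c - 4) <= 0]. *)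
suff [h1 h2] : (c <= 1 -> \sum_(i < n) Num.min (c / 4 ^+ i) (c / 4 ^+ i)^-1 <= 4 / 3 * c) /\
    (1 <= c -> \sum_(i < n) Num.min (c / 4 ^+ i) (c / 4 ^+ i)^-1 <= 5 / 3 - (3 * c)^-1).
  have [c1|c1] := leP c 1; first by apply: le_trans (h1 c1) _; lra.
  apply: le_trans (h2 (ltW c1)) _; rewrite gerBl invr_ge0; lra.
elim: n c c0 => [|n IH] c c0.
  rewrite big_ord0; split=> c1; first lra.
  rewrite subr_ge0; apply: (@le_trans _ _ 1); last lra.
  by rewrite invf_le1; lra.
have c40 : 0 < c / 4 by lra.
have [IH1 IH2] := IH _ c40.
rewrite big_ord_recl /= expr0 divr1.
have -> : \sum_(i < n) Num.min (c / 4 ^+ bump 0 i) (c / 4 ^+ bump 0 i)^-1 =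
          \sum_(i < n) Num.min (c / 4 / 4 ^+ i) (c / 4 / 4 ^+ i)^-1.
  by apply: eq_bigr => i _; rewrite /bump /= add1n exprS invfM mulrA.
split=> c1.
  have hc : Num.min c c^-1 <= c by rewrite ge_min lexx.
  have c41 : c / 4 <= 1 by lra.
  apply: le_trans (lerD hc (IH1 c41)) _; lra.
have hm : Num.min c c^-1 <= c^-1 by rewrite ge_min lexx orbT.
have e1 : (3 * c)^-1 = c^-1 / 3 by rewrite invfM mulrC.
have ci : c * c^-1 = 1 by rewrite mulfV // gt_eqF.
have [c4|c4] := leP (c / 4) 1.
  apply: le_trans (lerD hm (IH1 c4)) _; rewrite e1.
  have : 0 < c^-1 by rewrite invr_gt0.
  nra.
apply: le_trans (lerD hm (IH2 (ltW c4))) _; rewrite e1.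
have -> : (3 * (c / 4))^-1 = 4 * c^-1 / 3 by field; rewrite gt_eqF.
lra.
Qed.

Lemma geometric_half n : \sum_(i < n) (2^-1 : R) ^+ i <= 2.
Proof.
suff -> : \sum_(i < n) (2^-1 : R) ^+ i = 2 - 2 * 2^-1 ^+ n.
  by rewrite gerBl mulr_ge0 // exprn_ge0 // invr_ge0.
elim: n => [|n IH]; first by rewrite big_ord0 expr0 mulr1 subrr.
rewrite big_ord_recr /= IH exprS; lra.
Qed.

(** The minimum of two bounds is written as their geometric mean times a decay factor, the form that
    [geometric_min] sums. *)
Lemma min_inv_le x y a N : 0 < x -> 0 < y -> 0 <= a -> N <= a * x ^+ 2 -> N <= a * y ^+ 2 ->
  N <= a * (x * y) * Num.min (x / y) (x / y)^-1.
Proof.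
move=> x0 y0 a0 h1 h2; rewrite invf_div minEle; case: ifP => _.
  by have -> : a * (x * y) * (x / y) = a * x ^+ 2 by field; rewrite gt_eqF.
by have -> : a * (x * y) * (y / x) = a * y ^+ 2 by field; rewrite gt_eqF.
Qed.

Lemma le_max3 x y z N : N <= x + y + z ->
  [\/ N <= 3 * x /\ y <= x /\ z <= x, N <= 3 * y /\ x <= y /\ z <= y |
      N <= 3 * z /\ x <= z /\ y <= z].
Proof.
move=> h; have [xy|xy] := leP x y; have [yz|yz] := leP y z; have [xz|xz] := leP x z;
  by [apply: Or31; split; [lra|split; lra]|apply: Or32; split; [lra|split; lra]
     |apply: Or33; split; [lra|split; lra]].
Qed.

Local Notation mi z := (Num.min z z^-1).

(** [N] counts corners; [u], [x], [y] are cube roots of the numbers of points and of lines in the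
    two families. Each incidence bound is controlled by its largest term. A dominant [u ^+ 3] is
    played against [(x * y) ^+ 3], two dominant mixed terms against each other, and of two dominant
    line terms the smaller is at most [r ^+ 3]. *)
Lemma light_numeric (u x y r K N : R) : 0 < u -> 0 < x -> 0 < y -> 0 < r -> 0 < K ->
  r ^+ 2 = x * y ->
  N <= K * (u ^+ 3 + u ^+ 2 * x ^+ 2 + x ^+ 3) ->
  N <= K * (u ^+ 3 + u ^+ 2 * y ^+ 2 + y ^+ 3) ->
  N <= K * (x * y) ^+ 3 ->
  N <= 3 * K * (x * y) * (u ^+ 2 * (mi (x * y / u) + mi (x / y)) + r).
Proof.
move=> u0 x0 y0 r0 K0 rxy; rewrite !mulrDr => h1 h2 h3.
have xy0 : 0 < x * y by rewrite mulr_gt0.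
have mi0 (z : R) : 0 < z -> 0 <= mi z by move=> z0; rewrite le_min invr_ge0 andbb ltW.
have m1 := mi0 _ (divr_gt0 xy0 u0); have m2 := mi0 _ (divr_gt0 x0 y0).
have K3 : 0 < 3 * K * (x * y) by rewrite !mulr_gt0.
have n1 : 0 <= 3 * K * (x * y) * (u ^+ 2 * mi (x * y / u)) by rewrite !mulr_ge0 ?exprn_ge0 // ?ltW.
have n2 : 0 <= 3 * K * (x * y) * (u ^+ 2 * mi (x / y)) by rewrite !mulr_ge0 ?exprn_ge0 // ?ltW.
have n3 : 0 <= 3 * K * (x * y) * r by rewrite mulr_ge0 // ?ltW.
have S1 : N <= 3 * (K * u ^+ 3) -> N <= 3 * K * (x * y) * (u ^+ 2 * mi (x * y / u)).
  move=> h; have -> : 3 * K * (x * y) * (u ^+ 2 * mi (x * y / u)) =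
    3 * K * u * (x * y * u) * mi (x * y / u) by ring.
  apply: min_inv_le => //; first by rewrite !mulr_ge0 // ?ltW.
  2: by apply: le_trans h _; rewrite le_eqVlt; apply/orP; left; apply/eqP; ring.
  have xy2 : 0 <= (x * y) ^+ 2 by rewrite exprn_ge0 ?ltW.
  have uxy2 : 0 <= K * (u * (x * y) ^+ 2) by rewrite !mulr_ge0 ?ltW.
  have -> : 3 * K * u * (x * y) ^+ 2 = 3 * (K * (u * (x * y) ^+ 2)) by ring.
  have [c|c] := leP (x * y) u.
    have : K * (x * y) ^+ 3 <= K * (u * (x * y) ^+ 2).
      by rewrite exprS ler_pM2l // ler_wpM2r.
    lra.
  apply: le_trans h _; rewrite ler_pM2l // ler_pM2l // exprS ler_pM2l //.
  by rewrite ler_pXn2r ?nnegrE ?ltW.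
have S2 : N <= 3 * (K * (u ^+ 2 * x ^+ 2)) -> N <= 3 * (K * (u ^+ 2 * y ^+ 2)) ->
    N <= 3 * K * (x * y) * (u ^+ 2 * mi (x / y)).
  move=> e1 e2; have -> : 3 * K * (x * y) * (u ^+ 2 * mi (x / y)) =
    3 * K * u ^+ 2 * (x * y) * mi (x / y) by ring.
  apply: min_inv_le => //; first by rewrite !mulr_ge0 ?exprn_ge0 // ?ltW.
    by move: e1; rewrite -!mulrA.
  by move: e2; rewrite -!mulrA.
have S3 : N <= 3 * (K * x ^+ 3) -> N <= 3 * (K * y ^+ 3) -> N <= 3 * K * (x * y) * r.
  move=> e1 e2; rewrite -rxy -mulrA -exprSr -mulrA.
  have [c|c] := leP x r.
    apply: le_trans e1 _; rewrite ler_pM2l // ler_pM2l //.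
    by rewrite ler_pXn2r // nnegrE ltW.
  apply: le_trans e2 _; rewrite ler_pM2l // ler_pM2l //.
  rewrite ler_pXn2r ?nnegrE; [|by []|exact: ltW|exact: ltW].
  rewrite leNgt; apply/negP => c2; have : r ^+ 2 < x * y by rewrite expr2 ltr_pM // ltW.
  by rewrite rxy ltxx.
have sq (z w : R) : 0 < z -> 0 < w -> z <= w -> z ^+ 2 <= w ^+ 2.
  by move=> z0 w0 h; rewrite ler_pXn2r // nnegrE ltW.
have big (z : R) : 0 < z -> K * (u ^+ 2 * z ^+ 2) <= K * z ^+ 3 -> u ^+ 2 <= z.
  by move=> z0; rewrite ler_pM2l // [z ^+ 3]exprS ler_pM2r // exprn_gt0.
have small (z : R) : 0 < z -> K * z ^+ 3 <= K * (u ^+ 2 * z ^+ 2) -> z <= u ^+ 2.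
  by move=> z0; rewrite ler_pM2l // [z ^+ 3]exprS ler_pM2r // exprn_gt0.
have mono (z w : R) : 0 < z -> z <= w -> K * (u ^+ 2 * z ^+ 2) <= K * (u ^+ 2 * w ^+ 2).
  move=> z0 zw; rewrite ler_pM2l // ler_pM2l ?exprn_gt0 //.
  by apply: sq => //; exact: lt_le_trans zw.
case: (le_max3 h1) => -[h [e1 e2]].
- have := S1 h; lra.
- case: (le_max3 h2) => -[h' [e1' e2']].
  + have := S1 h'; lra.
  + have := S2 h h'; lra.
  (* Unlike dominant terms force [x <= u ^+ 2 <= y], so the mixed bound in [y] holds as well. *)
  + have xy := le_trans (small _ x0 e2) (big _ y0 e2').
    have := mono _ _ x0 xy => h4.
    have : N <= 3 * (K * (u ^+ 2 * y ^+ 2)) by lra.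
    move=> /(S2 h); lra.
- case: (le_max3 h2) => -[h' [e1' e2']].
  + have := S1 h'; lra.
  + have yx := le_trans (small _ y0 e2') (big _ x0 e2).
    have := mono _ _ y0 yx => h4.
    have h5 : N <= 3 * (K * (u ^+ 2 * x ^+ 2)) by lra.
    have := S2 h5 h'; lra.
  + have := S3 h h'; lra.
Qed.

(** Each decay factor is centred where two competing bounds cross: [G ^+ 2] and [u ^+ 2 * y ^+ 2] at
    [y = G / u], [u ^+ 3] and [u * (z * y) ^+ 2] at [y = u / z], [y ^+ 3] and [(u * z) ^+ 3] at
    [y = u * z]. *)
Lemma thin_numeric (u z y G K N : R) : 0 < u -> 0 < z -> 0 < y -> 0 < G -> 0 < K ->
  N <= K * (G ^+ 2 + u ^+ 3) -> N <= K * (u ^+ 3 * z ^+ 3) ->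
  N <= K * (u ^+ 3 + u ^+ 2 * y ^+ 2 + y ^+ 3) ->
  N <= K * (z ^+ 3 * y ^+ 3) ->
  N <= 3 * K * y * (u * G * mi (y / (G / u)) + u ^+ 2 * z * mi (y / (u / z))
                    + u ^+ 2 * z ^+ 2 * mi (y / (u * z))).
Proof.
move=> u0 z0 y0 G0 K0; rewrite !mulrDr => hG hAB h hBM.
have mi0 (w : R) : 0 < w -> 0 <= mi w by move=> w0; rewrite le_min invr_ge0 andbb ltW.
have m1 := mi0 _ (divr_gt0 y0 (divr_gt0 G0 u0)).
have m2 := mi0 _ (divr_gt0 y0 (divr_gt0 u0 z0)).
have m3 := mi0 _ (divr_gt0 y0 (mulr_gt0 u0 z0)).
have n1 : 0 <= 3 * K * y * (u * G * mi (y / (G / u))) by rewrite !mulr_ge0 ?exprn_ge0 // ?ltW.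
have n2 : 0 <= 3 * K * y * (u ^+ 2 * z * mi (y / (u / z))) by rewrite !mulr_ge0 ?exprn_ge0 // ?ltW.
have n3 : 0 <= 3 * K * y * (u ^+ 2 * z ^+ 2 * mi (y / (u * z))) by rewrite !mulr_ge0 ?exprn_ge0
  // ?ltW.
have S1 : N <= 3 * (K * G ^+ 2) -> N <= 3 * (K * (u ^+ 2 * y ^+ 2)) ->
    N <= 3 * K * y * (u * G * mi (y / (G / u))).
  move=> e1 e2; have -> : 3 * K * y * (u * G * mi (y / (G / u))) =
    3 * K * u ^+ 2 * (y * (G / u)) * mi (y / (G / u)) by field; rewrite gt_eqF.
  apply: min_inv_le => //; first by rewrite divr_gt0.
  - by rewrite !mulr_ge0 ?exprn_ge0 // ?ltW.
  - by move: e2; rewrite -!mulrA.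
  by apply: le_trans e1 _; rewrite le_eqVlt; apply/orP; left; apply/eqP; field; rewrite gt_eqF.
have S2 : N <= 3 * (K * u ^+ 3) -> N <= 3 * K * y * (u ^+ 2 * z * mi (y / (u / z))).
  move=> e1; have -> : 3 * K * y * (u ^+ 2 * z * mi (y / (u / z))) =
    3 * K * (u * z ^+ 2) * (y * (u / z)) * mi (y / (u / z)) by field; rewrite gt_eqF.
  apply: min_inv_le => //; first by rewrite divr_gt0.
    by rewrite !mulr_ge0 ?exprn_ge0 // ?ltW.
  2: by apply: le_trans e1 _; rewrite le_eqVlt; apply/orP; left; apply/eqP; field; rewrite gt_eqF.
  have zy2 : 0 <= (z * y) ^+ 2 by rewrite exprn_ge0 // mulr_ge0 ?ltW.
  have -> : 3 * K * (u * z ^+ 2) * y ^+ 2 = 3 * (K * (u * (z * y) ^+ 2)) by ring.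
  have n0 : 0 <= K * (u * (z * y) ^+ 2) by rewrite !mulr_ge0 ?ltW.
  have [c|c] := leP (z * y) u.
    have : K * (z ^+ 3 * y ^+ 3) <= K * (u * (z * y) ^+ 2).
      by rewrite -exprMn exprS ler_pM2l // ler_wpM2r.
    lra.
  apply: le_trans e1 _; rewrite ler_pM2l // ler_pM2l // exprS ler_pM2l //.
  by rewrite ler_pXn2r ?nnegrE ?mulr_ge0 ?ltW.
have S3 : N <= 3 * (K * y ^+ 3) -> N <= 3 * K * y * (u ^+ 2 * z ^+ 2 * mi (y / (u * z))).
  move=> e1; have -> : 3 * K * y * (u ^+ 2 * z ^+ 2 * mi (y / (u * z))) =
    3 * K * (u * z) * (y * (u * z)) * mi (y / (u * z)) by ring.
  have uz0 : 0 < u * z by rewrite mulr_gt0.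
  have n0 : 0 <= K * (u * z) ^+ 3 by rewrite mulr_ge0 ?exprn_ge0 ?ltW.
  apply: min_inv_le => //; first by rewrite !mulr_ge0 // ?ltW.
  2: have -> : 3 * K * (u * z) * (u * z) ^+ 2 = 3 * (K * (u * z) ^+ 3) by ring.
  2: move: hAB; rewrite -exprMn; lra.
  have -> : 3 * K * (u * z) * y ^+ 2 = 3 * (K * ((u * z) * y ^+ 2)) by ring.
  have n4 : 0 <= K * (u * z * y ^+ 2) by rewrite !mulr_ge0 ?exprn_ge0 // ?ltW.
  have [c|c] := leP y (u * z).
    apply: le_trans e1 _; rewrite ler_pM2l // ler_pM2l // exprS ler_wpM2r //.
    by rewrite exprn_ge0 ?ltW.
  have : K * (u * z) ^+ 3 <= K * ((u * z) * y ^+ 2).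
    by rewrite ler_pM2l // exprS ler_pM2l // ler_pXn2r ?nnegrE ?ltW.
  move: hAB; rewrite -exprMn; lra.
case: (le_max3 h) => -[e [e1 e2]].
- have := S2 e; lra.
- have [c|c] := leP (K * u ^+ 3) (K * G ^+ 2).
    have h5 : N <= 3 * (K * G ^+ 2).
      have : 0 <= K * G ^+ 2 by rewrite mulr_ge0 ?exprn_ge0 ?ltW.
      lra.
    have := S1 h5 e; lra.
  have h5 : N <= 3 * (K * u ^+ 3).
    have : 0 <= K * u ^+ 3 by rewrite mulr_ge0 ?exprn_ge0 ?ltW.
    lra.
  have := S2 h5; lra.
- have := S3 e; lra.
Qed.

End DyadicSums.

(** * Rectangles with vertices in four given sets *)

Section RectangleBound.
Variables (R : realType) (T : finType) (pt : T -> int * int).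
Hypothesis pt_inj : injective pt.
Implicit Types (P A B C D : {set T}) (u x y z t k G : R).

(** The parameter [q] is taken just above [x ^+ 2 / u], where [u ^+ 3 * q] and [x ^+ 6 / q ^+ 2]
    balance; this recovers the classical exponents 2/3. *)
Lemma incidence_bound P (Ls : {set {set T}}) u x k : 0 < u -> 0 < x -> 1 <= k ->
  u ^+ 3 = #|P|%:R -> Ls \subset lines pt -> #|Ls|%:R <= k * x ^+ 3 ->
  (\sum_(l in Ls) #|l :&: P|)%:R <= 6 * k ^+ 2 * (u ^+ 3 + u ^+ 2 * x ^+ 2 + x ^+ 3).
Proof.
move=> u0 x0 k1 uP sub hy.
set w := x ^+ 2 / u; have w0 : 0 < w by rewrite divr_gt0 ?exprn_gt0.
have [q [wq qw]] : exists q, w < q.+1%:R /\ q.+1%:R <= w + 1.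
  by exists (Num.truncn w); rewrite truncnS_gt -natr1 lerD2r truncn_le ltW.
have q0 : 0 < q.+1%:R :> R by rewrite ltr0n.
have := incidences pt_inj P (isT : (0 < q.+1)%N) sub.
move: q.+1 q0 wq qw => {}q q0 wq qw.
rewrite -(ler_nat R) !natrD !natrM -uP.
set I := (\sum_(l in _) _)%:R; set y : R := #|Ls|%:R in hy * => st.
have y0 : 0 <= y by rewrite ler0n.
have k0 : 0 < k by lra.
have kk : k <= k ^+ 2 by rewrite expr2 ler_pMr.
have q2 : 0 < q%:R ^+ 2 :> R by rewrite exprn_gt0.
have u3 : 0 < u ^+ 3 by rewrite exprn_gt0.
have x3 : 0 < x ^+ 3 by rewrite exprn_gt0.
have ux : 0 < u ^+ 2 * x ^+ 2 by rewrite mulr_gt0 ?exprn_gt0.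
have h1 : I <= 3 * u ^+ 3 * q%:R + y ^+ 2 / q%:R ^+ 2 + y.
  rewrite -(ler_pM2l q2).
  have -> : q%:R ^+ 2 * (3 * u ^+ 3 * q%:R + y ^+ 2 / q%:R ^+ 2 + y) =
    3 * u ^+ 3 * q%:R ^+ 3 + y ^+ 2 + q%:R ^+ 2 * y by field; rewrite gt_eqF.
  lra.
have h2 : y ^+ 2 / q%:R ^+ 2 <= k ^+ 2 * (u ^+ 2 * x ^+ 2).
  apply: (@le_trans _ _ ((k * x ^+ 3) ^+ 2 / w ^+ 2)).
    apply: ler_pM; rewrite ?exprn_ge0 ?invr_ge0 ?exprn_ge0 ?(ltW q0) //.
      by rewrite ler_pXn2r // nnegrE mulr_ge0 ?ltW.
    by rewrite lef_pV2 ?posrE ?exprn_gt0 // ler_pXn2r ?nnegrE ?ltW.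
  by rewrite le_eqVlt /w; apply/orP; left; apply/eqP; field; rewrite !gt_eqF.
have h3 : 3 * u ^+ 3 * q%:R <= 3 * (u ^+ 2 * x ^+ 2) + 3 * u ^+ 3.
  apply: (@le_trans _ _ (3 * u ^+ 3 * (w + 1))); first by rewrite ler_pM2l // mulr_gt0.
  by rewrite le_eqVlt /w; apply/orP; left; apply/eqP; field; rewrite gt_eqF.
have k2 : 1 <= k ^+ 2 by apply: le_trans kk.
apply: le_trans h1 _.
have g1 : 3 * u ^+ 3 <= 6 * k ^+ 2 * u ^+ 3 by rewrite ler_pM2r //; lra.
have g2 : (3 + k ^+ 2) * (u ^+ 2 * x ^+ 2) <= 6 * k ^+ 2 * (u ^+ 2 * x ^+ 2) by rewrite ler_pM2r
  //; lra.
have g3 : k * x ^+ 3 <= 6 * k ^+ 2 * x ^+ 3 by rewrite ler_pM2r //; lra.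
rewrite !mulrDr; move: g2; rewrite mulrDl; lra.
Qed.

Lemma rich4_card P i z k : k = 2316%:R -> 0 < z -> z ^+ 3 = #|P|%:R ->
  (#|rich4 pt P i| * 64 ^ i <= 2316 * #|P| ^ 2)%N ->
  #|rich4 pt P i|%:R <= k * (z ^+ 2 / 4 ^+ i) ^+ 3.
Proof.
move=> -> z0 zP; rewrite -(ler_nat R) !natrM natrX -zP => h.
have e64 : (64 : R) ^+ i = (4 ^+ i) ^+ 3 by rewrite -exprM mulnC exprM; congr (_ ^+ _); ring.
have p4 : 0 < (4 ^+ i : R) by rewrite exprn_gt0.
have p64 : 0 < (64 ^+ i : R) by rewrite exprn_gt0.
rewrite -(ler_pM2r p64); apply: le_trans h _; rewrite le_eqVlt; apply/orP; left; apply/eqP.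
by rewrite e64; field; rewrite gt_eqF.
Qed.

Variables (A B C D : {set T}) (n : nat) (u z t : R).
Hypothesis Tn : (#|T| < 4 ^ n)%N.
Hypotheses (u0 : 0 < u) (z0 : 0 < z) (t0 : 0 < t).
Hypotheses (uA : u ^+ 3 = #|A|%:R) (zB : z ^+ 3 = #|B|%:R) (tD : t ^+ 3 = #|D|%:R).

(** The [4 ^ i * 4 ^ l] choices of [b] and [d] cancel the powers of 4 in [x i * y l], so all
    balanced classes contribute alike. Summing the decay over [i] costs a constant, and the free
    index [l] costs [n]. *)
Lemma sum_light_class k : k = 2316%:R ->
  (\sum_(i < n) \sum_(l < n) #|light_class pt A B C D i l|)%:R
   <= 16 * 3 * (6 * k ^+ 2) * (4 * n%:R * (u ^+ 2 * z ^+ 2 * t ^+ 2) + 4 * (z ^+ 3 * t ^+ 3)).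
Proof.
move=> kE; have k1 : 1 <= k by rewrite kE ler1n.
have k0 : 0 < k by lra.
have K0 : 0 < 6 * k ^+ 2 by rewrite mulr_gt0 ?exprn_gt0.
have p4 i : 0 < (4 ^+ i : R) by rewrite exprn_gt0.
pose mi (c : R) := Num.min c c^-1.
have mi0 c : 0 < c -> 0 <= mi c by move=> c0; rewrite le_min invr_ge0 andbb ltW.
pose x i := z ^+ 2 / 4 ^+ i; pose y i := t ^+ 2 / 4 ^+ i.
have x0 i : 0 < x i by rewrite divr_gt0 ?exprn_gt0.
have y0 i : 0 < y i by rewrite divr_gt0 ?exprn_gt0.
(* The square root of [x i * y l]. It decays in both indices, so its double sum costs no factor
   [n]. *)
pose r i l := z * t * (2^-1 ^+ i * 2^-1 ^+ l).
have h2 (i : nat) : 0 < (2^-1 : R) ^+ i by rewrite exprn_gt0 ?invr_gt0.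
have r0 i l : 0 < r i l by rewrite !mulr_gt0.
have rxy i l : r i l ^+ 2 = x i * y l.
  have e (j : nat) : (2^-1 ^+ j) ^+ 2 = (4 ^+ j)^-1 :> R.
    by rewrite -exprM mulnC exprM -exprVn; congr (_ ^+ _); field.
  by rewrite /r !exprMn !e /x /y; ring.
have term i l : #|light_class pt A B C D i l|%:R <=
    16 * 3 * (6 * k ^+ 2) * (z ^+ 2 * t ^+ 2) *
     (u ^+ 2 * (mi (z ^+ 2 * y l / u / 4 ^+ i) + mi (z ^+ 2 / y l / 4 ^+ i)) + r i l).
  have [c1 c2 c3 c4] := card_light_class pt_inj A B C D i l.
  have [E|ne] := eqVneq (light_class pt A B C D i l) finset.set0.
    rewrite E cards0 !mulr_ge0 ?exprn_ge0 ?ltW // addr_gt0 // mulr_gt0 ?exprn_gt0 //.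
    rewrite addr_gt0 // lt_min invr_gt0 andbb !divr_gt0 ?mulr_gt0 ?exprn_gt0 //.
  have [b1 b2] := light_class_bound pt_inj ne.
  have {}b1 := rich4_card kE z0 zB b1; have {}b2 := rich4_card kE t0 tD b2.
  move: c1 c2 c3 c4; set N := #|corner pt @: _|; rewrite -!(ler_nat R) => c1 c2 c3 c4.
  have d2 := le_trans c2 (incidence_bound u0 (x0 i) k1 uA (rich_sub _ _ _) b1).
  have d3 := le_trans c3 (incidence_bound u0 (y0 l) k1 uA (rich_sub _ _ _) b2).
  have d4 : N%:R <= 6 * k ^+ 2 * (x i * y l) ^+ 3.
    apply: le_trans c4 _; rewrite natrM.
    apply: le_trans (ler_pM _ _ b1 b2) _; rewrite ?ler0n // -/(x i) -/(y l).
    have -> : k * x i ^+ 3 * (k * y l ^+ 3) = k ^+ 2 * (x i * y l) ^+ 3 by ring.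
    rewrite ler_pM2r ?exprn_gt0 ?mulr_gt0 //.
    by rewrite ler_peMl ?exprn_ge0 ?ltW //; lra.
  have := light_numeric u0 (x0 i) (y0 l) (r0 i l) K0 (rxy i l) d2 d3 d4.
  move=> h; apply: le_trans c1 _; rewrite !natrM !natrX.
  have e : 16 * 4 ^+ i * 4 ^+ l * N%:R <= 16 * 4 ^+ i * 4 ^+ l *
     (3 * (6 * k ^+ 2) * (x i * y l) * (u ^+ 2 * (mi (x i * y l / u) + mi (x i / y l)) + r i l)).
    by rewrite ler_pM2l // !mulr_gt0.
  apply: le_trans e _.
  have -> : x i * y l / u = z ^+ 2 * y l / u / 4 ^+ i by rewrite /x; field; rewrite !gt_eqF.
  have -> : x i / y l = z ^+ 2 / y l / 4 ^+ i by rewrite /x; field; rewrite !gt_eqF.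
  rewrite [X in X <= _](_ : _ = 16 * 3 * (6 * k ^+ 2) * (4 ^+ i * x i * (4 ^+ l * y l)) *
     (u ^+ 2 * (mi (z ^+ 2 * y l / u / 4 ^+ i) + mi (z ^+ 2 / y l / 4 ^+ i)) + r i l));
       last by ring.
  have -> : 4 ^+ i * x i = z ^+ 2 by rewrite /x; field; rewrite gt_eqF.
  by have -> : 4 ^+ l * y l = t ^+ 2 by rewrite /y; field; rewrite gt_eqF.
rewrite natr_sum; under eq_bigr do rewrite natr_sum.
apply: le_trans (_ : \sum_(i < n) \sum_(l < n) 16 * 3 * (6 * k ^+ 2) * (z ^+ 2 * t ^+ 2) *
     (u ^+ 2 * (mi (z ^+ 2 * y l / u / 4 ^+ i) + mi (z ^+ 2 / y l / 4 ^+ i)) + r i l) <= _).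
  by apply: ler_sum => i _; apply: ler_sum => l _.
under eq_bigr do rewrite -mulr_sumr.
rewrite -mulr_sumr -[X in X <= _]mulrA ler_pM2l ?mulr_gt0 ?exprn_gt0 //.
under eq_bigr do rewrite big_split -mulr_sumr big_split /=.
rewrite big_split -mulr_sumr big_split /=.
have s1 : \sum_(i < n) \sum_(l < n) mi (z ^+ 2 * y l / u / 4 ^+ i) <= 2 * n%:R.
  rewrite exchange_big /=; apply: (@le_trans _ _ (\sum_(l < n) 2)).
    by apply: ler_sum => l _; apply: geometric_min; rewrite divr_gt0 // mulr_gt0 ?exprn_gt0.
  by rewrite sumr_const card_ord mulr_natr.
have s2 : \sum_(i < n) \sum_(l < n) mi (z ^+ 2 / y l / 4 ^+ i) <= 2 * n%:R.
  rewrite exchange_big /=; apply: (@le_trans _ _ (\sum_(l < n) 2)).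
    by apply: ler_sum => l _; apply: geometric_min; rewrite divr_gt0 // ?exprn_gt0.
  by rewrite sumr_const card_ord mulr_natr.
have s3 : \sum_(i < n) \sum_(l < n) r i l <= z * t * 4.
  under eq_bigr do rewrite -mulr_sumr -mulr_sumr.
  rewrite -mulr_sumr ler_pM2l ?mulr_gt0 // -mulr_suml.
  have -> : (4 : R) = 2 * 2 by ring.
  by apply: ler_pM; rewrite ?geometric_half // sumr_ge0 // => i _; rewrite ltW.
have z2t2 : 0 < z ^+ 2 * t ^+ 2 by rewrite mulr_gt0 ?exprn_gt0.
have u2 : 0 < u ^+ 2 by rewrite exprn_gt0.
apply: (@le_trans _ _ (z ^+ 2 * t ^+ 2 * (u ^+ 2 * (4 * n%:R) + z * t * 4))).
  rewrite ler_pM2l // lerD // ler_pM2l //; lra.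
by rewrite le_eqVlt; apply/orP; left; apply/eqP; ring.
Qed.

Lemma sum_thin_class k G r : k = 2316%:R -> 0 < G ->
  (r = 0%N /\ u ^+ 3 * z ^+ 3 <= G ^+ 2) \/ ((1 < r)%N /\ G = u ^+ 3 / r%:R) ->
  (\sum_(l < n) #|thin_class pt A B C D r l|)%:R
   <= 4 * 3 * (6 * k ^+ 2) * (2 * (u * t ^+ 2 * G) + 4 * (u ^+ 2 * z ^+ 2 * t ^+ 2)).
Proof.
move=> kE G0 hG; have k1 : 2316%:R <= k by rewrite kE.
have k0 : 0 < k by rewrite kE ltr0n.
have k2 : k <= k ^+ 2 by rewrite expr2 ler_pMr // kE ler1n.
have K0 : 0 < 6 * k ^+ 2 by rewrite mulr_gt0 ?exprn_gt0.
have kK : k <= 6 * k ^+ 2 by lra.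
have K1 : 1 <= 6 * k ^+ 2 by apply: le_trans kK; rewrite kE ler1n.
have p4 i : 0 < (4 ^+ i : R) by rewrite exprn_gt0.
pose mi (c : R) := Num.min c c^-1.
pose y i := t ^+ 2 / 4 ^+ i.
have y0 i : 0 < y i by rewrite divr_gt0 ?exprn_gt0.
have u3 : 0 < u ^+ 3 by rewrite exprn_gt0.
have z1 : 1 <= z.
  rewrite leNgt; apply/negP => zl.
  have : z ^+ 3 < 1 by rewrite exprn_ilt1 // ltW.
  have : 0 < z ^+ 3 by rewrite exprn_gt0.
  by rewrite zB ltr0n ltrn1; case: #|B|.
have term l : #|thin_class pt A B C D r l|%:R <=
    4 * 3 * (6 * k ^+ 2) * t ^+ 2 *
     (u * G * mi (t ^+ 2 / (G / u) / 4 ^+ l) + u ^+ 2 * z * mi (t ^+ 2 / (u / z) / 4 ^+ l)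
      + u ^+ 2 * z ^+ 2 * mi (t ^+ 2 / (u * z) / 4 ^+ l)).
  have [c1 c2 c3 c4 c5] := card_thin_class pt_inj A B C D r l.
  have [E|ne] := eqVneq (thin_class pt A B C D r l) finset.set0.
    have mi0 c : 0 < c -> 0 <= mi c by move=> c0; rewrite le_min invr_ge0 andbb ltW.
    have c0 c : 0 < c -> 0 <= mi (t ^+ 2 / c / 4 ^+ l).
      by move=> c0; apply: mi0; rewrite !divr_gt0 ?exprn_gt0.
    have [g1 g2 g3] := And3 (c0 _ (divr_gt0 G0 u0)) (c0 _ (divr_gt0 u0 z0)) (c0 _ (mulr_gt0 u0 z0)).
    rewrite E cards0; apply: mulr_ge0; first by rewrite !mulr_ge0 ?exprn_ge0 // ltW.
    by apply: addr_ge0; [apply: addr_ge0|]; rewrite !mulr_ge0 ?exprn_ge0 // ltW.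
  have b2 := rich4_card kE t0 tD (thin_class_bound pt_inj ne).
  move: c1 c2 c3 c4 c5; set N := #|corner_foot pt @: _|; rewrite -!(ler_nat R) => c1 c2 c3 c4 c5.
  have d3 := le_trans c3 (incidence_bound u0 (y0 l) (le_trans _ k1) uA (rich_sub _ _ _) b2).
  rewrite ler1n in d3; have {}d3 := d3 isT.
  have d2 : N%:R <= 6 * k ^+ 2 * (u ^+ 3 * z ^+ 3).
    by apply: le_trans c2 _; rewrite natrM -uA -zB ler_peMl // mulr_ge0 ?exprn_ge0 // ltW.
  have d4 : N%:R <= 6 * k ^+ 2 * (z ^+ 3 * y l ^+ 3).
    apply: le_trans c4 _; rewrite natrM -zB.
    apply: le_trans (_ : _ <= z ^+ 3 * (k * y l ^+ 3)) _.
      by rewrite ler_pM2l ?exprn_gt0.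
    by rewrite mulrCA ler_pM2r ?mulr_gt0 ?exprn_gt0.
  (* Either all pairs [(a, b)] are counted, or only those on lines with at least [r] points of [A],
     for which [rich_incidences] gives [(#|A| / r) ^ 2] and a linear term. *)
  have d1 : N%:R <= 6 * k ^+ 2 * (G ^+ 2 + u ^+ 3).
    have G2 : 0 < G ^+ 2 by rewrite exprn_gt0.
    case: hG => -[hr hG].
      apply: le_trans c2 _; rewrite natrM -uA -zB; apply: le_trans hG _.
      apply: (@le_trans _ _ (G ^+ 2 + u ^+ 3)); first by rewrite lerDl ltW.
      by rewrite ler_peMl // addr_ge0 // ltW.
    have r0 : 0 < r%:R :> R by rewrite ltr0n (ltnW hr).
    have [m1 e1] : exists m1, m1 = 2304%N by exists 2304%N.
    have [m2 e2] : exists m2, m2 = 12%N by exists 12%N.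
    have := rich_incidences pt_inj A hr; rewrite -e1 -e2 -(ler_nat R) natrD !natrM -uA => h.
    have hm1 : m1%:R <= k by rewrite kE ler_nat e1.
    have hm2 : m2%:R <= k by rewrite kE ler_nat e2.
    apply: le_trans c5 _.
    have : (\sum_(m in rich pt A r) #|m :&: A|)%:R <= m1%:R * G ^+ 2 + m2%:R * u ^+ 3.
      rewrite -(ler_pM2r (exprn_gt0 2 r0)); apply: le_trans h _.
      by rewrite le_eqVlt hG; apply/orP; left; apply/eqP; field; rewrite gt_eqF.
    move=> e; apply: le_trans e _; rewrite mulrDr lerD // ler_pM2r //.
      by apply: (le_trans hm1).
    by apply: (le_trans hm2).
  have := thin_numeric u0 z0 (y0 l) G0 K0 d1 d2 d3 d4.
  move=> h; apply: le_trans c1 _; rewrite !natrM !natrX.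
  have e : 4 * 4 ^+ l * N%:R <= 4 * 4 ^+ l *
     (3 * (6 * k ^+ 2) * y l * (u * G * mi (y l / (G / u)) + u ^+ 2 * z * mi (y l / (u / z))
                    + u ^+ 2 * z ^+ 2 * mi (y l / (u * z)))).
    by rewrite ler_pM2l // !mulr_gt0.
  apply: le_trans e _.
  have ec c : y l / c = t ^+ 2 / c / 4 ^+ l by rewrite /y mulrAC.
  rewrite !ec.
  rewrite [X in X <= _](_ : _ = 4 * 3 * (6 * k ^+ 2) * (4 ^+ l * y l) *
     (u * G * mi (t ^+ 2 / (G / u) / 4 ^+ l) + u ^+ 2 * z * mi (t ^+ 2 / (u / z) / 4 ^+ l)
      + u ^+ 2 * z ^+ 2 * mi (t ^+ 2 / (u * z) / 4 ^+ l))); last by ring.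
  by have -> : 4 ^+ l * y l = t ^+ 2 by rewrite /y; field; rewrite gt_eqF.
rewrite natr_sum.
apply: le_trans (_ : \sum_(l < n) 4 * 3 * (6 * k ^+ 2) * t ^+ 2 *
     (u * G * mi (t ^+ 2 / (G / u) / 4 ^+ l) + u ^+ 2 * z * mi (t ^+ 2 / (u / z) / 4 ^+ l)
      + u ^+ 2 * z ^+ 2 * mi (t ^+ 2 / (u * z) / 4 ^+ l)) <= _).
  by apply: ler_sum => l _.
rewrite -mulr_sumr -[X in X <= _]mulrA ler_pM2l ?mulr_gt0 ?exprn_gt0 //.
rewrite !big_split /= -!mulr_sumr.
have s c : 0 < c -> \sum_(l < n) mi (t ^+ 2 / c / 4 ^+ l) <= 2.
  by move=> c0; apply: geometric_min; rewrite divr_gt0 ?exprn_gt0.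
have s1 := s _ (divr_gt0 G0 u0); have s2 := s _ (divr_gt0 u0 z0); have s3 := s _ (mulr_gt0 u0 z0).
have t2 : 0 < t ^+ 2 by rewrite exprn_gt0.
apply: (@le_trans _ _ (t ^+ 2 * (u * G * 2 + u ^+ 2 * z ^+ 2 * 2 + u ^+ 2 * z ^+ 2 * 2)));
  last first.
  by rewrite le_eqVlt; apply/orP; left; apply/eqP; ring.
rewrite ler_pM2l //; apply: lerD; last by rewrite ler_pM2l // mulr_gt0 ?exprn_gt0.
apply: lerD; first by rewrite ler_pM2l // mulr_gt0.
apply: (@le_trans _ _ (u ^+ 2 * z * 2)); first by rewrite ler_pM2l // mulr_gt0 ?exprn_gt0.
by rewrite ler_pM2r // ler_pM2l ?exprn_gt0 // expr2 ler_pMr.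
Qed.

End RectangleBound.

(* The free parameter [G] is the square root of a bound on the number of pairs
   [(a, b)] whose line meets [B] only in [b]; rectangles whose line [ab]
   contains fewer than [r] points of [A] are paid for by [r |B| |C|]. *)
Lemma rects_bound (R : realType) : exists2 K : R, 0 < K &
  forall (T : finType) (pt : T -> int * int) (A B C D : {set T}) n (u z t G : R) r,
  injective pt -> (#|T| < 4 ^ n)%N -> (0 < n)%N -> 0 < u -> 0 < z -> 0 < t -> 0 < G ->
  u ^+ 3 = #|A|%:R -> z ^+ 3 = #|B|%:R -> t ^+ 3 = #|D|%:R ->
  (r = 0%N /\ u ^+ 3 * z ^+ 3 <= G ^+ 2) \/ ((1 < r)%N /\ G = u ^+ 3 / r%:R) ->
  #|rects pt A B C D|%:R <= K * (u ^+ 3 * z ^+ 3 + z ^+ 3 * t ^+ 3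
     + n%:R * (u ^+ 2 * z ^+ 2 * t ^+ 2) + r%:R * (z ^+ 3 * #|C|%:R) + u * t ^+ 2 * G).
Proof.
have [k kE] : exists k : R, k = 2316%:R by exists 2316%:R.
have kk : 1 <= k by rewrite kE ler1n.
have k2 : k <= k ^+ 2 by rewrite expr2 ler_pMr // (lt_le_trans ltr01).
(* The light sum contributes 1152 = 16 * 3 * 6 * 4, the thin sum 288 = 4 * 3 * 6 * 4 and 144 = 4 * 3
   * 6 * 2, and [2 * k] is the 4632 of [rects_cover]. *)
have [c1 c2 c3 c4] : [/\ 1 <= 2000 * k ^+ 2, 2 * k + 1152 * k ^+ 2 <= 2000 * k ^+ 2,
    1152 * k ^+ 2 + 288 * k ^+ 2 <= 2000 * k ^+ 2 & 144 * k ^+ 2 <= 2000 * k ^+ 2].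
  by split; lra.
have c5 : 0 <= 288 * k ^+ 2 by lra.
exists (2000 * k ^+ 2); first exact: lt_le_trans c1.
move=> T pt A B C D n u z t G r pt_inj Tn n0 u0 z0 t0 G0 uA zB tD hG.
have [m em] : exists2 m, m = 4632%N &
    (#|rects pt A B C D| <= #|A| * #|B| + m * (#|B| * #|D|) + r * (#|B| * #|C|)
     + \sum_(i < n) \sum_(l < n) #|light_class pt A B C D i l|
     + \sum_(l < n) #|thin_class pt A B C D r l|)%N.
  by exists 4632%N => //; exact: rects_cover.
rewrite -(ler_nat R) !natrD !natrM -uA -zB -tD => cov.
have L := sum_light_class pt_inj C n u0 z0 t0 uA zB tD kE.
have H := sum_thin_class pt_inj C n u0 z0 t0 uA zB tD kE G0 hG.
apply: le_trans cov _; apply: le_trans (lerD (lerD (lexx _) L) H) _.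
set X1 := u ^+ 3 * z ^+ 3; set X2 := z ^+ 3 * t ^+ 3; set M := u ^+ 2 * z ^+ 2 * t ^+ 2.
set X4 := r%:R * _; set X5 := u * t ^+ 2 * G.
have p1 : 0 <= X1 by rewrite mulr_ge0 ?exprn_ge0 ?ltW.
have p2 : 0 <= X2 by rewrite mulr_ge0 ?exprn_ge0 ?ltW.
have p3 : 0 <= M by rewrite !mulr_ge0 ?exprn_ge0 ?ltW.
have p4 : 0 <= X4 by rewrite !mulr_ge0 ?ler0n ?exprn_ge0 ?ltW.
have p5 : 0 <= X5 by rewrite !mulr_ge0 ?exprn_ge0 ?ltW.
have nM : M <= n%:R * M by rewrite ler_peMl // ler1n.
have e : m%:R = 2 * k by rewrite em kE -natrM.
have mono c c' X : c <= c' -> 0 <= X -> c * X <= c' * X by move=> h1 h2; rewrite ler_wpM2r.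
have q1 : 1 * X1 <= 2000 * k ^+ 2 * X1 by apply: mono.
have q2 : (2 * k + 1152 * k ^+ 2) * X2 <= 2000 * k ^+ 2 * X2 by apply: mono.
have q3 : 288 * k ^+ 2 * M <= 288 * k ^+ 2 * (n%:R * M) by rewrite ler_wpM2l.
have q3' : (1152 * k ^+ 2 + 288 * k ^+ 2) * (n%:R * M) <= 2000 * k ^+ 2 * (n%:R * M).
  by apply: mono => //; exact: le_trans nM.
have q4 : 1 * X4 <= 2000 * k ^+ 2 * X4 by apply: mono.
have q5 : 144 * k ^+ 2 * X5 <= 2000 * k ^+ 2 * X5 by apply: mono.
rewrite e; move: q1 q2 q3 q3' q4 q5; clear.
lra.
Qed.

(** * Summation over level sets *)

Section LevelSums.
Variable R : realType.
Implicit Types (x y z : int).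

Definition tw x : R := 2 ^ x.
Definition decay x : R := tw (- `|x|).

Lemma twD x y : tw (x + y) = tw x * tw y.
Proof. by rewrite /tw expfzDr. Qed.

Lemma tw_gt0 x : 0 < tw x. Proof. exact: exprz_gt0. Qed.

Lemma tw_ge0 x : 0 <= tw x. Proof. exact: exprz_ge0. Qed.

Lemma tw_le x y : x <= y -> tw x <= tw y.
Proof. by rewrite /tw ler_eXz2l // ltr1n. Qed.

Lemma twX x (k : nat) : tw x ^+ k = tw (x * k%:Z).
Proof. by rewrite /tw -exprz_exp. Qed.

(** The nonnegative values of [phi] have distinct absolute values, and so do the negative ones; each
    kind gives part of a geometric series of sum 2. *)
Lemma decay_sum m (phi : 'I_m -> int) : injective phi -> \sum_(i < m) decay (phi i) <= 4.
Proof.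
move=> inj.
have half (A : {set 'I_m}) (nu : 'I_m -> nat) : {in A &, injective nu} ->
    \sum_(i in A) (2^-1 : R) ^+ nu i <= 2.
  move=> injA; pose M := (\sum_i nu i)%N.
  have nuM i : (nu i < M.+1)%N by rewrite ltnS /M (bigD1 i) //= leq_addr.
  have nE i : nu i = (inord (nu i) : 'I_M.+1) :> nat by rewrite inordK.
  rewrite (eq_bigr (fun i => (2^-1 : R) ^+ (inord (nu i) : 'I_M.+1))); last first.
    by move=> i _; rewrite -nE.
  rewrite -(big_imset (fun k : 'I_M.+1 => (2^-1 : R) ^+ k)) /=; last first.
    move=> i j iA jA e; apply: injA => //; by rewrite nE [RHS]nE e.
  apply: le_trans (geometric_half R M.+1).
  rewrite [leRHS](bigID (mem [set (inord (nu i) : 'I_M.+1) | i in A])) /=.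
  by rewrite lerDl sumr_ge0 // => i _; rewrite exprn_ge0 // invr_ge0.
have dE x : decay x = (2^-1) ^+ `|x|%N.
  have -> : decay x = 2 ^ (- (`|x|%N)%:Z) by rewrite /decay /tw; congr (_ ^ _); lia.
  by rewrite -exprnN exprVn.
rewrite (bigID (fun i => 0 <= phi i)) /=.
have -> : (4 : R) = 2 + 2 by ring.
apply: lerD.
  rewrite (eq_bigl (fun i => i \in [set i | 0 <= phi i])); last by move=> i; rewrite inE.
  rewrite (eq_bigr (fun i => (2^-1 : R) ^+ `|phi i|%N)); last by move=> i _; rewrite dE.
  apply: half => i j; rewrite !inE => h1 h2 e; apply: inj; lia.
rewrite (eq_bigl (fun i => i \in [set i | ~~ (0 <= phi i)])); last by move=> i; rewrite inE.
rewrite (eq_bigr (fun i => (2^-1 : R) ^+ `|phi i|%N)); last by move=> i _; rewrite dE.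
apply: half => i j; rewrite !inE => h1 h2 e; apply: inj; lia.
Qed.

Lemma decay_sum_affine m (phi : 'I_m -> int) k c : k != 0 ->
  (forall i, phi i = k * (i : nat)%:Z + c) -> \sum_(i < m) decay (phi i) <= 4.
Proof.
move=> k0 phiE; apply: decay_sum => i j; rewrite !phiE => /addIr/(mulfI k0) [].
exact: val_inj.
Qed.

Lemma decay_ge0 x : 0 <= decay x. Proof. exact: tw_ge0. Qed.

Lemma weighted_sum (I : finType) (p q : I -> R) (h1 : I -> I -> I -> R)
    (h2 : I -> I -> I -> I -> R) (P Q H1 H2 : R) :
  (forall i, 0 <= p i) -> (forall i, 0 <= q i) ->
  (forall i j k, 0 <= h1 i j k) -> 0 <= H1 -> 0 <= H2 -> 0 <= Q ->
  \sum_i p i <= P -> \sum_i q i <= Q -> (forall i j, \sum_k h1 i j k <= H1) ->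
  (forall i j k, \sum_l h2 i j k l <= H2) ->
  \sum_(x : I * I * I * I) p x.1.1.1 * q x.1.1.2 * (h1 x.1.1.1 x.1.1.2 x.1.2
      * h2 x.1.1.1 x.1.1.2 x.1.2 x.2) <= P * Q * (H1 * H2).
Proof.
move=> p0 q0 h10 H10 H20 Q0 pP qQ hH1 hH2.
rewrite -(pair_big xpredT xpredT (fun (x : I * I * I) l => p x.1.1 * q x.1.2 * (h1 x.1.1 x.1.2 x.2
      * h2 x.1.1 x.1.2 x.2 l))) /=.
rewrite -(pair_big xpredT xpredT (fun (x : I * I) k => \sum_l p x.1 * q x.2 * (h1 x.1 x.2 k
      * h2 x.1 x.2 k l))) /=.
rewrite -(pair_big xpredT xpredT (fun i j => \sum_k \sum_l p i * q j * (h1 i j k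
      * h2 i j k l))) /=.
apply: (@le_trans _ _ (\sum_i \sum_j p i * q j * (H1 * H2))).
  apply: ler_sum => i _; apply: ler_sum => j _.
  under eq_bigr do rewrite -mulr_sumr -mulr_sumr.
  rewrite -mulr_sumr ler_wpM2l ?mulr_ge0 //.
  apply: (@le_trans _ _ (\sum_k h1 i j k * H2)); first by apply: ler_sum => k _; rewrite ler_wpM2l.
  by rewrite -mulr_suml ler_wpM2r.
under eq_bigr do rewrite -mulr_suml -mulr_sumr.
rewrite -mulr_suml -mulr_suml ler_wpM2r ?mulr_ge0 //.
by apply: ler_pM => //; apply: sumr_ge0.
Qed.

(** [s] carries the part of [Q] outside [P] injectively into the part inside, preserving weights. *)
Lemma half_sum (J : finType) (W : J -> R) (s : J -> J) (P Q : pred J) :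
  (forall j, 0 <= W j) -> injective s -> (forall j, W (s j) = W j) ->
  (forall j, Q j -> ~~ P j -> Q (s j) && P (s j)) ->
  \sum_(j | Q j) W j <= 2 * \sum_(j | Q j && P j) W j.
Proof.
move=> W0 inj Ws h; rewrite (bigID P) /= mulr_natl mulr2n lerD2l.
have -> : \sum_(j | Q j && P j) W j = \sum_(j | Q (s j) && P (s j)) W j.
  by rewrite (reindex_inj inj) /=; apply: eq_bigr => j _; rewrite Ws.
rewrite [leRHS](bigID (fun j => Q j && ~~ P j)) /=.
apply: (@le_trans _ _ (\sum_(j | (Q (s j) && P (s j)) && (Q j && ~~ P j)) W j)).
  rewrite le_eqVlt; apply/orP; left; apply/eqP; apply: eq_bigl => j.
  by case: (boolP (Q j && ~~ P j)) => [/andP[a b]|_]; rewrite ?andbF // h.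
by rewrite lerDl sumr_ge0.
Qed.

End LevelSums.

(** * Exponents of two for the terms of the rectangle bound *)

Section ExponentBounds.
Variables a b c d E : int.
Hypotheses (ac : a <= c) (bd : b <= d) (abcd : b + d <= a + c).
Local Notation N3 := (- (3 * (a + b + c + d))).

(** [N3] is the exponent of four coefficients of sizes [8 ^- level], and [2 * k * a] that of
    [#|A| ^ (k / 3)] once the mass of the level is split off. The ordering of the levels turns each
    total into a negative multiple of distances. *)
Lemma exponent_ab : N3 + (2 * 3%:Z * a + 2 * 3%:Z * b) <= - `|c - a| + - `|d - b|.
Proof. lia. Qed.

Lemma exponent_bd : N3 + (2 * 3%:Z * b + 2 * 3%:Z * d) <= - `|a + c - b - d|.
Proof. lia. Qed.

Lemma exponent_abd : N3 + (2 * 2%:Z * a + 2 * 2%:Z * b + 2 * 2%:Z * d)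
  <= - `|c - a| + - `|2 * a - b - d|.
Proof. lia. Qed.

Lemma exponent_square : 2 * 3%:Z * a + 2 * 3%:Z * b <= (3 * a + 3 * b) * 2%:Z.
Proof. lia. Qed.

Lemma exponent_inner : d <= c ->
  N3 + (2 * a + 2 * 2%:Z * d + (3 * a + 3 * b)) <= - `|c - a| + - `|d - c|.
Proof. lia. Qed.

(** For [r = 2 ^ E] this value balances [r |B| |C|], of exponent [E + 6 b + 6 c], against
    [|A| ^ (4/3) |D| ^ (2/3) / r], of exponent [8 a + 4 d - E]. The alternative [E = 1] keeps
    [1 < r]. *)
Lemma exponent_choice : exists2 E : nat, (0 < E)%N &
  4 * a + 2 * d - 3 * b - 3 * c <= E%:Z /\
  (E%:Z = 4 * a + 2 * d - 3 * b - 3 * c \/ E = 1%N).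
Proof.
have [h|h] := leP (4 * a + 2 * d - 3 * b - 3 * c) 1.
  by exists 1%N => //; split=> //; right.
by exists `|(4 * a + 2 * d - 3 * b - 3 * c)%R|%N; [lia|split; [lia|left; lia]].
Qed.

Lemma exponent_bc : c < d -> E = 4 * a + 2 * d - 3 * b - 3 * c ->
  N3 + (E + (2 * 3%:Z * b + 6 * c)) <= - `|d - c| + - `|c - a|.
Proof. lia. Qed.

Lemma exponent_bc1 : c < d ->
  N3 + (2 * 3 * b + 6 * c) <= - `|d - c| + - `|a + c - b - d|.
Proof. lia. Qed.

Lemma exponent_outer : c < d -> 4 * a + 2 * d - 3 * b - 3 * c <= E ->
  N3 + (8 * a + 4 * d + - E) <= - `|c - a| + - `|d - c|.
Proof. lia. Qed.

End ExponentBounds.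

(** * One quadruple of levels, and the sum over all of them *)

Section LevelBound.
Variable R : realType.

Lemma mul3_le (x y z : R) : 0 <= x -> 0 <= y -> 0 <= z -> x * y * z <= x ^+ 3 + y ^+ 3 + z ^+ 3.
Proof.
move=> x0 y0 z0.
have x3 := exprn_ge0 3 x0; have y3 := exprn_ge0 3 y0; have z3 := exprn_ge0 3 z0.
have key w : x <= w -> y <= w -> z <= w -> x * y * z <= w ^+ 3.
  move=> h1 h2 h3; rewrite (_ : w ^+ 3 = w * w * w); last by ring.
  by apply: ler_pM => //; [exact: mulr_ge0|apply: ler_pM].
have [xy|/ltW xy] := leP x y; have [yz|/ltW yz] := leP y z; have [xz|/ltW xz] := leP x z.
- by have := key z xz yz (lexx _); lra.
- by have := key z (le_trans xy yz) yz (lexx _); lra.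
- by have := key y xy (lexx _) yz; lra.
- by have := key y xy (lexx _) yz; lra.
- by have := key z xz yz (lexx _); lra.
- by have := key x (lexx _) xy xz; lra.
- by have := key x (lexx _) xy (le_trans yz xy); lra.
- by have := key x (lexx _) xy xz; lra.
Qed.

Lemma split_inner (x y z v w : R) : 0 <= x * z -> 0 <= v -> 0 <= w ->
  (x + y) * (65 * z) <= 125 * (x * 1 * z) + 65 * (y * 1 * z) + v + 2 * w.
Proof. lra. Qed.

Lemma weight_total (N m x1 x2 x3 x4 x5 x6 x7 x8 x9 : R) :
  1 <= N -> m <= 2 * N -> x1 <= 65 * 65 * (4 * 4) -> x2 <= 65 * 65 * (m * 4) ->
  x3 <= 65 * 65 * (4 * 4) -> x4 <= 65 * 65 * (4 * 4) -> x5 <= 65 * 65 * (4 * 4) ->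
  x6 <= 65 * m * (4 * 4) -> x7 <= 65 * m * (4 * 4) ->
  x8 <= 65 * 65 * (4 * 4) -> x9 <= 65 * 65 * (4 * 4) ->
  x1 + x2 + N * x3 + N * x4 + N * x5 + 125 * x6 + 65 * x7 + x8 + 2 * x9 <= 65 ^+ 2 * 300 * N.
Proof.
move=> N1 mN h1 h2 h3 h4 h5 h6 h7 h8 h9.
have N0 : 0 <= N by lra.
have := ler_wpM2l N0 h3; have := ler_wpM2l N0 h4; have := ler_wpM2l N0 h5; lra.
Qed.

Variables (T : finType) (pt : T -> int * int) (n : nat) (lev : T -> 'I_n.+1).
Hypotheses (pt_inj : injective pt) (Tn : (#|T| < 4 ^ n)%N) (n0 : (0 < n)%N).
Local Notation I := 'I_n.+1.
Local Notation tw := (tw R).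
Local Notation decay := (decay R).
Implicit Types (a b c d : I).

Definition level a : {set T} := [set x | lev x == a].
(** Cardinality times the square of the nominal size [8 ^- a], so that the masses of a normalized
    function have bounded sum. *)
Definition level_mass a : R := #|level a|%:R * tw (- (6 * a%:Z)).
Local Notation p := level_mass.
Definition level_weight (j : I * I * I * I) : R :=
  tw (- (3 * (j.1.1.1%:Z + j.1.1.2%:Z + j.1.2%:Z + j.2%:Z))) *
  #|rects pt (level j.1.1.1) (level j.1.1.2) (level j.1.2) (level j.2)|%:R.

(** Summing any of these terms over the four levels costs at most a multiple of [n]: the terms with
    an explicit [n] have two masses and two decays, hence no free level, while a factor 1 in place
    of a mass or a decay marks one free level. *)
Definition weight_bound a b c d : R :=
  p a * p b * (decay (c%:Z - a%:Z) * decay (d%:Z - b%:Z))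
  + p b * p d * (1 * decay (a%:Z + c%:Z - b%:Z - d%:Z))
  + n%:R * (p a * p b * (decay (c%:Z - a%:Z) * decay (2 * a%:Z - b%:Z - d%:Z)))
  + n%:R * (p b * p d * (decay (2 * a%:Z - b%:Z - d%:Z) * decay (c%:Z - a%:Z)))
  + n%:R * (p a * p d * (decay (c%:Z - a%:Z) * decay (2 * a%:Z - b%:Z - d%:Z)))
  + 125 * (p a * 1 * (decay (c%:Z - a%:Z) * decay (d%:Z - c%:Z)))
  + 65 * (p d * 1 * (decay (d%:Z - c%:Z) * decay (c%:Z - a%:Z)))
  + p b * p c * (decay (d%:Z - c%:Z) * decay (c%:Z - a%:Z))
  + 2 * (p b * p c * (decay (d%:Z - c%:Z) * decay (a%:Z + c%:Z - b%:Z - d%:Z))).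

Hypothesis mass_le : \sum_a p a <= 65.

Lemma level_mass_ge0 a : 0 <= p a.
Proof. by rewrite mulr_ge0 ?ler0n ?tw_ge0. Qed.

Lemma level_mass_le a : p a <= 65.
Proof.
apply: le_trans mass_le; rewrite (bigD1 a) //= lerDl sumr_ge0 // => b _; exact: level_mass_ge0.
Qed.

Lemma rects_empty (A B C D : {set T}) : (A == finset.set0) || (B == finset.set0) || (D ==
  finset.set0) ->
  #|rects pt A B C D| = 0%N.
Proof.
move=> h; apply: eq_card0 => q; rewrite !inE.
by case/orP: h => [/orP[]|] /eqP ->; rewrite inE ?andbF.
Qed.

Lemma weight_bound_ge0 a b c d : 0 <= weight_bound a b c d.
Proof.
rewrite /weight_bound; have P := level_mass_ge0; have De x : 0 <= decay x by exact: decay_ge0.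
by do !apply: addr_ge0; rewrite !mulr_ge0 ?ler0n ?tw_ge0.
Qed.

Lemma level_weight_bound K :
  (forall (T : finType) (pt : T -> int * int) (A B C D : {set T}) n (u z t G : R) r,
  injective pt -> (#|T| < 4 ^ n)%N -> (0 < n)%N -> 0 < u -> 0 < z -> 0 < t -> 0 < G ->
  u ^+ 3 = #|A|%:R -> z ^+ 3 = #|B|%:R -> t ^+ 3 = #|D|%:R ->
  (r = 0%N /\ u ^+ 3 * z ^+ 3 <= G ^+ 2) \/ ((1 < r)%N /\ G = u ^+ 3 / r%:R) ->
  #|rects pt A B C D|%:R <= K * (u ^+ 3 * z ^+ 3 + z ^+ 3 * t ^+ 3
     + n%:R * (u ^+ 2 * z ^+ 2 * t ^+ 2) + r%:R * (z ^+ 3 * #|C|%:R) + u * t ^+ 2 * G)) ->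
  0 < K -> forall a b c d, (a <= c)%N -> (b <= d)%N -> (b + d <= a + c)%N ->
  level_weight (a, b, c, d) <= K * weight_bound a b c d.
Proof.
move=> hK K0 a b c d ac bd abcd; rewrite /level_weight /=.
have acz : a%:Z <= c%:Z by []. have bdz : b%:Z <= d%:Z by [].
have abcdz : b%:Z + d%:Z <= a%:Z + c%:Z by rewrite -!PoszD.
set Q := #|rects _ _ _ _ _|%:R.
have [E|ne] := boolP ((level a == finset.set0) || (level b == finset.set0) || (level d ==
  finset.set0)).
  rewrite /Q rects_empty // mulr0; apply: mulr_ge0; [exact: ltW|exact: weight_bound_ge0].
move: ne; rewrite !negb_or => /andP[/andP[na nb] nd].
(* Cube root of the mass; [w] below is the cube root of the cardinality. *)
pose s e := p e `^ 3^-1.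
have s3 e : s e ^+ 3 = p e.
  by rewrite /s -powR_mulrn ?powR_ge0 // -powRrM mulVf // powRr1 // level_mass_ge0.
have pE e : #|level e|%:R = p e * tw (6 * e%:Z).
  by rewrite /level_mass -mulrA -twD addNr /tw expr0z mulr1.
have p_gt0 e : level e != finset.set0 -> 0 < p e.
  by move=> h; rewrite /level_mass mulr_gt0 ?tw_gt0 // ltr0n card_gt0.
have s_gt0 e : level e != finset.set0 -> 0 < s e by move=> /p_gt0 h; rewrite /s powR_gt0.
have p0 := level_mass_ge0; have De := decay_ge0 R; have pp e f : 0 <= p e * p f by exact: mulr_ge0.
have s5 e : level e != finset.set0 -> s e <= 5.
  move=> h; have s0 := s_gt0 _ h; rewrite leNgt; apply/negP => h5.
  have : 5 ^+ 3 < s e ^+ 3 by rewrite ltr_pXn2r ?nnegrE // ltW.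
  by rewrite s3 => h6; have := level_mass_le e; move: h6; rewrite !exprS expr0; lra.
pose w e := s e * tw (2 * e%:Z).
have w_gt0 e : level e != finset.set0 -> 0 < w e by move=> h; rewrite mulr_gt0 ?tw_gt0 ?s_gt0.
have wX e k : w e ^+ k = s e ^+ k * tw (2 * k%:Z * e%:Z).
  by rewrite /w exprMn twX; congr (_ * tw _); ring.
have w3 e : w e ^+ 3 = #|level e|%:R by rewrite wX s3 pE; congr (_ * tw _); ring.
set X := tw (- (3 * _)).
have X0 : 0 < X by exact: tw_gt0.
have sa := s_gt0 _ na; have sb := s_gt0 _ nb; have sd := s_gt0 _ nd.
(* Only the last two terms of the rectangle bound depend on [r] and [G]; the others are settled here
   for both cases. *)
have comb G r : 0 < G -> (r = 0%N /\ w a ^+ 3 * w b ^+ 3 <= G ^+ 2) \/ ((1 < r)%N /\ G = w a ^+ 3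
  / r%:R) ->
  X * (r%:R * (w b ^+ 3 * #|level c|%:R)) + X * (w a * w d ^+ 2 * G) <=
  125 * (p a * 1 * (decay (c%:Z - a%:Z) * decay (d%:Z - c%:Z)))
  + 65 * (p d * 1 * (decay (d%:Z - c%:Z) * decay (c%:Z - a%:Z)))
  + p b * p c * (decay (d%:Z - c%:Z) * decay (c%:Z - a%:Z))
  + 2 * (p b * p c * (decay (d%:Z - c%:Z) * decay (a%:Z + c%:Z - b%:Z - d%:Z))) ->
  X * Q <= K * weight_bound a b c d.
  move=> G0 hr h; have := hK T pt (level a) (level b) (level c) (level d) n (w a) (w b) (w d) G r
    pt_inj Tn n0 (w_gt0 _ na) (w_gt0 _ nb) (w_gt0 _ nd) G0 (w3 a) (w3 b) (w3 d) hr.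
  rewrite -/Q -(ler_pM2l X0) => hQ; apply: le_trans hQ _.
  rewrite mulrCA ler_pM2l // !mulrDr.
  have t1 : X * (w a ^+ 3 * w b ^+ 3) <= p a * p b * (decay (c%:Z - a%:Z) * decay (d%:Z - b%:Z)).
    rewrite !wX !s3 [leLHS](_ : _ = p a * p b * (X * (tw (2 * 3%:Z * a%:Z) * tw (2 * 3%:Z *
      b%:Z)))); last by ring.
    by rewrite ler_wpM2l // /X /decay -!twD; apply: tw_le; exact: exponent_ab.
  have t2 : X * (w b ^+ 3 * w d ^+ 3) <= p b * p d * (1 * decay (a%:Z + c%:Z - b%:Z - d%:Z)).
    rewrite !wX !s3 [leLHS](_ : _ = p b * p d * (X * (tw (2 * 3%:Z * b%:Z) * tw (2 * 3%:Z *
      d%:Z)))); last by ring.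
    by rewrite ler_wpM2l // /X mul1r /decay -!twD; apply: tw_le; exact: exponent_bd.
  have t3 : X * (n%:R * (w a ^+ 2 * w b ^+ 2 * w d ^+ 2)) <=
      n%:R * (p a * p b * (decay (c%:Z - a%:Z) * decay (2 * a%:Z - b%:Z - d%:Z)))
  + n%:R * (p b * p d * (decay (2 * a%:Z - b%:Z - d%:Z) * decay (c%:Z - a%:Z)))
  + n%:R * (p a * p d * (decay (c%:Z - a%:Z) * decay (2 * a%:Z - b%:Z - d%:Z))).
    rewrite -!mulrDr mulrCA ler_wpM2l ?ler0n // [decay (2 * _ - _ - _) * _]mulrC -!mulrDl.
    (* The masses enter as the product of the cube roots of [p a * p b], [p b * p d] and
       [p a * p d], to which [mul3_le] applies. *)
    have -> : X * (w a ^+ 2 * w b ^+ 2 * w d ^+ 2) = ((s a * s b) * (s b * s d) * (s a * s d)) *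
       (X * (tw (2 * 2%:Z * a%:Z) * tw (2 * 2%:Z * b%:Z) * tw (2 * 2%:Z * d%:Z))).
      by rewrite !wX; ring.
    apply: ler_pM.
    - by rewrite !mulr_ge0 ?ltW.
    - by rewrite !mulr_ge0 ?tw_ge0 ?ltW.
    - by rewrite -!s3 -!exprMn; apply: mul3_le; rewrite mulr_ge0 ?ltW.
    - by rewrite /X /decay -!twD; apply: tw_le; exact: exponent_abd.
  rewrite /weight_bound; move: t1 t2 t3 h.
  set D1 := p a * p b * _; set D2 := p b * p d * _; set D3 := n%:R * _; set D4 := n%:R * _.
  set D5 := n%:R * _; set D6 := 125 * _; set D7 := 65 * _; set D8 := p b * p c * _.
  set D9 := 2 * _; set Y1 := X * _; set Y2 := X * _; set Y3 := X * _; set Y4 := X * _;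
    set Y5 := X * _.
  clear; lra.
have sad : s a * s d ^+ 2 <= p a + p d.
  have := mul3_le (ltW sa) (ltW sd) (ltW sd); rewrite -!s3.
  have [h _|h _] := leP (s a) (s d).
    apply: (@le_trans _ _ (s d ^+ 3)); first by rewrite [s d ^+ 3]exprS ler_pM2r ?exprn_gt0.
    by rewrite lerDr exprn_ge0 ?ltW.
  apply: (@le_trans _ _ (s a ^+ 3)); last by rewrite lerDl exprn_ge0 ?ltW.
  by rewrite [s a ^+ 3]exprS ler_pM2l // ler_pXn2r ?nnegrE ?ltW.
(* For [d <= c] the trivial count of the pairs [(a, b)] is enough: take [r = 0], and [G] with
   [#|A| * #|B| <= G ^+ 2] because every mass is at most 65. *)
have [dc|cd] := leqP d c.
  apply: (comb (65 * tw (3 * a%:Z + 3 * b%:Z)) 0%N).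
  - by rewrite mulr_gt0 ?tw_gt0.
  - left; split=> //; rewrite !wX !s3 exprMn twX.
    rewrite [leLHS](_ : _ = p a * p b * (tw (2 * 3%:Z * a%:Z) * tw (2 * 3%:Z * b%:Z)));
      last by ring.
    apply: ler_pM; rewrite ?mulr_ge0 ?tw_ge0 //.
      by rewrite expr2; apply: ler_pM; rewrite ?level_mass_le.
    by rewrite -twD; apply: tw_le; exact: (exponent_square acz bdz abcdz).
  rewrite mul0r mulr0 add0r.
  apply: (@le_trans _ _ ((p a + p d) * (65 * (decay (c%:Z - a%:Z) * decay (d%:Z - c%:Z))))).
    rewrite [leLHS](_ : _ = (s a * s d ^+ 2) * (65 * (X * (tw (2 * a%:Z) * tw (2 * 2%:Z * d%:Z) *
      tw (3 * a%:Z + 3 * b%:Z))))); last by rewrite wX /w; ring.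
    apply: ler_pM => //.
    - by rewrite mulr_ge0 ?exprn_ge0 ?ltW.
    - by rewrite !mulr_ge0 ?tw_ge0 ?ltW.
    - by rewrite ler_pM2l // /X /decay -!twD; apply: tw_le; exact: exponent_inner.
  have dd : 0 <= decay (c%:Z - a%:Z) * decay (d%:Z - c%:Z) by rewrite mulr_ge0.
  have e1 : 0 <= p a * (decay (c%:Z - a%:Z) * decay (d%:Z - c%:Z)) by rewrite mulr_ge0.
  have e2 : 0 <= p b * p c * (decay (d%:Z - c%:Z) * decay (c%:Z - a%:Z)) by rewrite !mulr_ge0
    ?tw_ge0.
  have e3 : 0 <= p b * p c * (decay (d%:Z - c%:Z) * decay (a%:Z + c%:Z - b%:Z - d%:Z)) by rewrite
    !mulr_ge0 ?tw_ge0.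
  rewrite [decay (d%:Z - c%:Z) * decay (c%:Z - a%:Z)]mulrC in e2 *.
  exact: split_inner.
have [E E1 [eE EE]] := exponent_choice acz bdz abcdz.
have cdz : c%:Z < d%:Z by [].
have rE : (2 ^ E)%:R = tw E%:Z by rewrite natrX.
have r0 : 0 < (2 ^ E)%:R :> R by rewrite rE tw_gt0.
apply: (comb (w a ^+ 3 / (2 ^ E)%:R) (2 ^ E)%N).
- by rewrite divr_gt0 // exprn_gt0 ?w_gt0.
- right; split=> //; by rewrite -[1%N](expn0 2) ltn_exp2l.
have y1 : X * ((2 ^ E)%:R * (w b ^+ 3 * #|level c|%:R)) <=
    p b * p c * (decay (d%:Z - c%:Z) * decay (c%:Z - a%:Z)) +
    2 * (p b * p c * (decay (d%:Z - c%:Z) * decay (a%:Z + c%:Z - b%:Z - d%:Z))).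
  rewrite rE pE wX s3 mulrCA.
  rewrite [leLHS](_ : _ = p b * p c * (X * (tw E%:Z * (tw (2 * 3%:Z * b%:Z) * tw (6 * c%:Z)))));
    last by ring.
  rewrite [X in _ + X]mulrCA -mulrDr ler_wpM2l //.
  have e2 : 0 <= decay (d%:Z - c%:Z) * decay (c%:Z - a%:Z) by rewrite mulr_ge0.
  have e3 : 0 <= decay (d%:Z - c%:Z) * decay (a%:Z + c%:Z - b%:Z - d%:Z) by rewrite mulr_ge0.
  rewrite /X; case: EE => EE.
    apply: (@le_trans _ _ (decay (d%:Z - c%:Z) * decay (c%:Z - a%:Z)));
      last by rewrite lerDl mulr_ge0.
    by rewrite /decay -!twD; apply: tw_le; exact: exponent_bc.
  (* Here [r = 2], the origin of the factor 2 in the last term of [weight_bound]. *)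
  apply: (@le_trans _ _ (2 * (decay (d%:Z - c%:Z) * decay (a%:Z + c%:Z - b%:Z - d%:Z))));
    last by rewrite lerDr.
  rewrite EE [leLHS](_ : _ = tw 1 * tw (- (3 * (a%:Z + b%:Z + c%:Z + d%:Z)) + (2 * 3 * b%:Z + 6 *
    c%:Z))); last first.
    by rewrite -!twD; congr (tw _); ring.
  have -> : tw 1 = 2 by rewrite /tw expr1z.
  by rewrite ler_pM2l // /decay -!twD; apply: tw_le; exact: exponent_bc1.
have y2 : X * (w a * w d ^+ 2 * (w a ^+ 3 / (2 ^ E)%:R)) <=
    125 * (p a * 1 * (decay (c%:Z - a%:Z) * decay (d%:Z - c%:Z))).
  have -> : (2 ^ E)%:R^-1 = tw (- E%:Z) :> R by rewrite rE /tw -invr_expz.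
  rewrite [leLHS](_ : _ = (s a * s d ^+ 2) * p a * (X * (tw (8 * a%:Z) * tw (4 * d%:Z) * tw (-
    E%:Z)))); last first.
    rewrite -s3 !wX /w.
    have -> : tw (8 * a%:Z) = tw (2 * a%:Z) * tw (2 * 3%:Z * a%:Z) by rewrite -twD; congr (tw _);
      ring.
    have -> : tw (4 * d%:Z) = tw (2 * 2%:Z * d%:Z) by congr (tw _); ring.
    ring.
  rewrite mulr1 [leRHS]mulrA; apply: ler_pM.
  - by rewrite mulr_ge0 // mulr_ge0 ?exprn_ge0 ?ltW.
  - by rewrite !mulr_ge0 ?tw_ge0 ?ltW.
  - rewrite ler_wpM2r // (_ : 125 = 5 * 5 ^+ 2); last by ring.
    apply: ler_pM; [exact: ltW|by rewrite exprn_ge0 // ltW|exact: s5|].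
    by rewrite ler_pXn2r ?nnegrE ?s5 // ltW.
  - by rewrite /X /decay -!twD; apply: tw_le; exact: exponent_outer.
have e1 : 0 <= p d * 1 * (decay (d%:Z - c%:Z) * decay (c%:Z - a%:Z)) by rewrite !mulr_ge0 ?tw_ge0.
move: y1 y2 e1; clear.
set Z1 := p d * 1 * _; set Z2 := p b * p c * _; set Z3 := 2 * _; set Z4 := 125 * _.
set Y1 := X * _; set Y2 := X * _; lra.
Qed.

Lemma sum_weight_bound :
  \sum_(j : I * I * I * I) weight_bound j.1.1.1 j.1.1.2 j.1.2 j.2 <= 65 ^+ 2 * 300 * n%:R.
Proof.
have p0 := level_mass_ge0.
have De x : 0 <= decay x by exact: decay_ge0.
have n1 : 1 <= n%:R :> R by rewrite ler1n.
have m2 : (n.+1)%:R <= 2 * n%:R :> R by rewrite -natr1; lra.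
have one : \sum_(i : I) (1 : R) <= n.+1%:R by rewrite sumr_const card_ord.
have dp (f : I -> int) (c : int) : (forall i : I, f i = 1 * i%:Z + c) -> \sum_i decay (f i) <= 4.
  exact: decay_sum_affine.
have dm (f : I -> int) (c : int) : (forall i : I, f i = -1 * i%:Z + c) -> \sum_i decay (f i) <= 4.
  exact: decay_sum_affine.
have d2 (f : I -> int) (c : int) : (forall i : I, f i = 2 * i%:Z + c) -> \sum_i decay (f i) <= 4.
  exact: decay_sum_affine.
rewrite /weight_bound !big_split /= -!mulr_sumr.
(* The permutations bring each term to the shape of [weighted_sum]: indices with masses first, then
   an order in which each decay is summed over an index on which it depends with nonzero slope. *)
have perm2 (F : I -> I -> I -> I -> R) : \sum_(j : I * I * I * I) F j.1.1.1 j.1.1.2 j.1.2 j.2 =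
    \sum_(x : I * I * I * I) F x.1.2 x.1.1.1 x.2 x.1.1.2.
  rewrite (reindex_inj (h := fun x : I * I * I * I => (x.1.2, x.1.1.1, x.2, x.1.1.2))) //.
  by move=> [[[? ?] ?] ?] [[[? ?] ?] ?] [] -> -> -> ->.
have perm5 (F : I -> I -> I -> I -> R) : \sum_(j : I * I * I * I) F j.1.1.1 j.1.1.2 j.1.2 j.2 =
    \sum_(x : I * I * I * I) F x.1.1.1 x.2 x.1.2 x.1.1.2.
  rewrite (reindex_inj (h := fun x : I * I * I * I => (x.1.1.1, x.2, x.1.2, x.1.1.2))) //.
  by move=> [[[? ?] ?] ?] [[[? ?] ?] ?] [] -> -> -> ->.
have perm7 (F : I -> I -> I -> I -> R) : \sum_(j : I * I * I * I) F j.1.1.1 j.1.1.2 j.1.2 j.2 =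
    \sum_(x : I * I * I * I) F x.2 x.1.1.2 x.1.2 x.1.1.1.
  rewrite (reindex_inj (h := fun x : I * I * I * I => (x.2, x.1.1.2, x.1.2, x.1.1.1))) //.
  by move=> [[[? ?] ?] ?] [[[? ?] ?] ?] [] -> -> -> ->.
have perm8 (F : I -> I -> I -> I -> R) : \sum_(j : I * I * I * I) F j.1.1.1 j.1.1.2 j.1.2 j.2 =
    \sum_(x : I * I * I * I) F x.2 x.1.1.1 x.1.1.2 x.1.2.
  rewrite (reindex_inj (h := fun x : I * I * I * I => (x.2, x.1.1.1, x.1.1.2, x.1.2))) //.
  by move=> [[[? ?] ?] ?] [[[? ?] ?] ?] [] -> -> -> ->.
have W := weighted_sum.
have t1 : \sum_(j : I * I * I * I) p j.1.1.1 * p j.1.1.2 *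
    (decay (j.1.2%:Z - j.1.1.1%:Z) * decay (j.2%:Z - j.1.1.2%:Z)) <= 65 * 65 * (4 * 4).
  apply: (W _ _ p p (fun a b c => decay (c%:Z - a%:Z)) (fun a b c d => decay (d%:Z - b%:Z)));
    rewrite ?ler0n //.
    by move=> a b; apply: (dp _ (- a%:Z)) => i; ring.
  by move=> a b c; apply: (dp _ (- b%:Z)) => i; ring.
have t2 : \sum_(j : I * I * I * I) p j.1.1.2 * p j.2 *
    (1 * decay (j.1.1.1%:Z + j.1.2%:Z - j.1.1.2%:Z - j.2%:Z)) <= 65 * 65 * (n.+1%:R * 4).
  rewrite (perm2 (fun a b c d => p b * p d * (1 * decay (a%:Z + c%:Z - b%:Z - d%:Z)))) /=.
  apply: (W _ _ p p (fun _ _ _ => 1) (fun b d a c => decay (a%:Z + c%:Z - b%:Z - d%:Z)));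
    rewrite ?ler0n //.
  by move=> b d a; apply: (dp _ (a%:Z - b%:Z - d%:Z)) => i; ring.
have t3 : \sum_(j : I * I * I * I) p j.1.1.1 * p j.1.1.2 *
    (decay (j.1.2%:Z - j.1.1.1%:Z) * decay (2 * j.1.1.1%:Z - j.1.1.2%:Z - j.2%:Z)) <= 65 * 65 *
      (4 * 4).
  apply: (W _ _ p p (fun a b c => decay (c%:Z - a%:Z)) (fun a b c d => decay (2 * a%:Z - b%:Z -
    d%:Z))); rewrite ?ler0n //.
    by move=> a b; apply: (dp _ (- a%:Z)) => i; ring.
  by move=> a b c; apply: (dm _ (2 * a%:Z - b%:Z)) => i; ring.
have t4 : \sum_(j : I * I * I * I) p j.1.1.2 * p j.2 *
    (decay (2 * j.1.1.1%:Z - j.1.1.2%:Z - j.2%:Z) * decay (j.1.2%:Z - j.1.1.1%:Z)) <= 65 * 65 *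
      (4 * 4).
  rewrite (perm2 (fun a b c d => p b * p d * (decay (2 * a%:Z - b%:Z - d%:Z) * decay (c%:Z -
    a%:Z)))) /=.
  apply: (W _ _ p p (fun b d a => decay (2 * a%:Z - b%:Z - d%:Z)) (fun b d a c => decay (c%:Z -
    a%:Z))); rewrite ?ler0n //.
    by move=> a b; apply: (d2 _ (- a%:Z - b%:Z)) => i; ring.
  by move=> a b c; apply: (dp _ (- c%:Z)) => i; ring.
have t5 : \sum_(j : I * I * I * I) p j.1.1.1 * p j.2 *
    (decay (j.1.2%:Z - j.1.1.1%:Z) * decay (2 * j.1.1.1%:Z - j.1.1.2%:Z - j.2%:Z)) <= 65 * 65 *
      (4 * 4).
  rewrite (perm5 (fun a b c d => p a * p d * (decay (c%:Z - a%:Z) * decay (2 * a%:Z - b%:Z -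
    d%:Z)))) /=.
  apply: (W _ _ p p (fun a d c => decay (c%:Z - a%:Z)) (fun a d c b => decay (2 * a%:Z - b%:Z -
    d%:Z))); rewrite ?ler0n //.
    by move=> a b; apply: (dp _ (- a%:Z)) => i; ring.
  by move=> a b c; apply: (dm _ (2 * a%:Z - b%:Z)) => i; ring.
have t6 : \sum_(j : I * I * I * I) p j.1.1.1 * 1 *
    (decay (j.1.2%:Z - j.1.1.1%:Z) * decay (j.2%:Z - j.1.2%:Z)) <= 65 * n.+1%:R * (4 * 4).
  apply: (W _ _ p (fun=> 1) (fun a b c => decay (c%:Z - a%:Z)) (fun a b c d => decay (d%:Z -
    c%:Z))); rewrite ?ler0n //.
    by move=> a b; apply: (dp _ (- a%:Z)) => i; ring.
  by move=> a b c; apply: (dp _ (- c%:Z)) => i; ring.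
have t7 : \sum_(j : I * I * I * I) p j.2 * 1 *
    (decay (j.2%:Z - j.1.2%:Z) * decay (j.1.2%:Z - j.1.1.1%:Z)) <= 65 * n.+1%:R * (4 * 4).
  rewrite (perm7 (fun a b c d => p d * 1 * (decay (d%:Z - c%:Z) * decay (c%:Z - a%:Z)))) /=.
  apply: (W _ _ p (fun=> 1) (fun d b c => decay (d%:Z - c%:Z)) (fun d b c a => decay (c%:Z -
    a%:Z))); rewrite ?ler0n //.
    by move=> a b; apply: (dm _ (a%:Z)) => i; ring.
  by move=> a b c; apply: (dm _ (c%:Z)) => i; ring.
have t8 : \sum_(j : I * I * I * I) p j.1.1.2 * p j.1.2 *
    (decay (j.2%:Z - j.1.2%:Z) * decay (j.1.2%:Z - j.1.1.1%:Z)) <= 65 * 65 * (4 * 4).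
  rewrite (perm8 (fun a b c d => p b * p c * (decay (d%:Z - c%:Z) * decay (c%:Z - a%:Z)))) /=.
  apply: (W _ _ p p (fun b c d => decay (d%:Z - c%:Z)) (fun b c d a => decay (c%:Z - a%:Z)));
    rewrite ?ler0n //.
    by move=> a b; apply: (dp _ (- b%:Z)) => i; ring.
  by move=> a b c; apply: (dm _ (b%:Z)) => i; ring.
have t9 : \sum_(j : I * I * I * I) p j.1.1.2 * p j.1.2 *
    (decay (j.2%:Z - j.1.2%:Z) * decay (j.1.1.1%:Z + j.1.2%:Z - j.1.1.2%:Z - j.2%:Z)) <= 65 * 65
      * (4 * 4).
  rewrite (perm8 (fun a b c d => p b * p c * (decay (d%:Z - c%:Z) * decay (a%:Z + c%:Z - b%:Z -
    d%:Z)))) /=.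
  apply: (W _ _ p p (fun b c d => decay (d%:Z - c%:Z)) (fun b c d a => decay (a%:Z + c%:Z - b%:Z
    - d%:Z))); rewrite ?ler0n //.
    by move=> a b; apply: (dp _ (- b%:Z)) => i; ring.
  by move=> a b c; apply: (dp _ (b%:Z - a%:Z - c%:Z)) => i; ring.
exact: (weight_total n1 m2 t1 t2 t3 t4 t5 t6 t7 t8 t9).
Qed.

End LevelBound.

(** * Symmetries of the rectangle *)

Section RectangleSymmetry.
Variables (T : finType) (pt : T -> int * int).
Hypothesis pt_inj : injective pt.
Implicit Types (A B C D : {set T}).

Lemma card_rects_symmetry (s : T * T * T * T -> T * T * T * T) A B C D A' B' C' D' :
  injective s -> (forall q, q \in rects pt A B C D -> s q \in rects pt A' B' C' D') ->
  (forall q, q \in rects pt A' B' C' D' -> s q \in rects pt A B C D) ->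
  #|rects pt A B C D| = #|rects pt A' B' C' D'|.
Proof.
move=> inj h1 h2; apply/eqP; rewrite eqn_leq; apply/andP; split;
  by apply: (card_inj_into (f := s)) => // x y _ _; apply: inj.
Qed.

Definition swap_ac (I : Type) (q : I * I * I * I) := (q.1.2, q.1.1.2, q.1.1.1, q.2).
Definition swap_bd (I : Type) (q : I * I * I * I) := (q.1.1.1, q.2, q.1.2, q.1.1.2).
Definition swap_diagonals (I : Type) (q : I * I * I * I) := (q.1.1.2, q.1.1.1, q.2, q.1.2).

Lemma swap_ac_inj (I : Type) : injective (@swap_ac I).
Proof. by move=> [[[? ?] ?] ?] [[[? ?] ?] ?] [] -> -> -> ->. Qed.
Lemma swap_bd_inj (I : Type) : injective (@swap_bd I).
Proof. by move=> [[[? ?] ?] ?] [[[? ?] ?] ?] [] -> -> -> ->. Qed.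
Lemma swap_diagonals_inj (I : Type) : injective (@swap_diagonals I).
Proof. by move=> [[[? ?] ?] ?] [[[? ?] ?] ?] [] -> -> -> ->. Qed.

Lemma rects_swap_ac A B C D : #|rects pt A B C D| = #|rects pt C B A D|.
Proof.
apply: (card_rects_symmetry (@swap_ac_inj T)) => -[[[a b] c] d];
  rewrite !inE /qrect /qa /qb /qc /qd /= => /and5P[-> -> -> -> r];
  exact: (rect_flip (rect_rot pt_inj (rect_rot pt_inj r))).
Qed.

Lemma rects_swap_bd A B C D : #|rects pt A B C D| = #|rects pt A D C B|.
Proof.
apply: (card_rects_symmetry (@swap_bd_inj T)) => -[[[a b] c] d];
  rewrite !inE /qrect /qa /qb /qc /qd /= => /and5P[-> -> -> -> r]; exact: rect_flip r.
Qed.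

Lemma rects_swap_diagonals A B C D : #|rects pt A B C D| = #|rects pt B A D C|.
Proof.
apply: (card_rects_symmetry (@swap_diagonals_inj T)) => -[[[a b] c] d];
  rewrite !inE /qrect /qa /qb /qc /qd /= => /and5P[-> -> -> -> r];
  exact: (rect_flip (rect_rot pt_inj r)).
Qed.

End RectangleSymmetry.

(** * The weighted count of rectangles *)

Section RectangleEnergy.
Variable R : realType.

(* Exchanging [a] and [c], [b] and [d], or the two diagonals maps rectangles to
   rectangles, so the levels may be assumed to satisfy [a <= c], [b <= d] and
   [b + d <= a + c]. *)
Lemma sum_level_weight : exists2 K : R, 0 < K &
  forall (T : finType) (pt : T -> int * int) n (lev : T -> 'I_n.+1),
  injective pt -> (#|T| < 4 ^ n)%N -> (0 < n)%N -> \sum_a level_mass R lev a <= 65 ->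
  \sum_j level_weight R pt lev j <= K * n%:R.
Proof.
have [K K0 hK] := rects_bound R.
have M0 : 0 < 65 ^+ 2 * 300 :> R := mulr_gt0 (exprn_gt0 2 (ltr0Sn R 64)) (ltr0Sn R 299).
exists (8 * K * (65 ^+ 2 * 300)); first exact: mulr_gt0 (mulr_gt0 (ltr0Sn R 7) K0) M0.
move=> T pt n lev pt_inj Tn n0 mass.
pose W := level_weight R pt lev.
have W0 j : 0 <= W j by rewrite mulr_ge0 ?tw_ge0 ?ler0n.
pose P1 (j : 'I_n.+1 * 'I_n.+1 * 'I_n.+1 * 'I_n.+1) := (j.1.1.1 <= j.1.2)%N.
pose P2 (j : 'I_n.+1 * 'I_n.+1 * 'I_n.+1 * 'I_n.+1) := (j.1.1.2 <= j.2)%N.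
pose P3 (j : 'I_n.+1 * 'I_n.+1 * 'I_n.+1 * 'I_n.+1) := (j.1.1.2 + j.2 <= j.1.1.1 + j.1.2)%N.
have s1 j : W (swap_ac j) = W j.
  rewrite /W /level_weight /swap_ac /= (rects_swap_ac pt_inj).
  by congr (tw _ (- (3 * _)) * _); ring.
have s2 j : W (swap_bd j) = W j.
  rewrite /W /level_weight /swap_bd /= rects_swap_bd.
  by congr (tw _ (- (3 * _)) * _); ring.
have s3 j : W (swap_diagonals j) = W j.
  rewrite /W /level_weight /swap_diagonals /= (rects_swap_diagonals pt_inj).
  by congr (tw _ (- (3 * _)) * _); ring.
have h1 : \sum_j W j <= 2 * \sum_(j | P1 j) W j.
  apply: (half_sum (s := @swap_ac _) (Q := xpredT)) => //; first exact: swap_ac_inj.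
  by move=> j _; rewrite /P1 /swap_ac /= -ltnNge; exact: ltnW.
have h2 : \sum_(j | P1 j) W j <= 2 * \sum_(j | P1 j && P2 j) W j.
  apply: (half_sum (s := @swap_bd _)) => //; first exact: swap_bd_inj.
  by move=> j; rewrite /P1 /P2 /swap_bd /= => -> /=; rewrite -ltnNge; exact: ltnW.
have h3 : \sum_(j | P1 j && P2 j) W j <= 2 * \sum_(j | (P1 j && P2 j) && P3 j) W j.
  apply: (half_sum (s := @swap_diagonals _) (Q := fun j => P1 j && P2 j)) => //.
    exact: swap_diagonals_inj.
  move=> j; rewrite /P1 /P2 /P3 /swap_diagonals /= => /andP[-> ->] /=.
  by rewrite -ltnNge; exact: ltnW.
have h4 : \sum_(j | (P1 j && P2 j) && P3 j) W j <= K * (65 ^+ 2 * 300 * n%:R).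
  apply: (@le_trans _ _ (\sum_j K * weight_bound R lev j.1.1.1 j.1.1.2 j.1.2 j.2)); last first.
    by rewrite -mulr_sumr ler_pM2l //; exact: sum_weight_bound.
  rewrite [leRHS](bigID (fun j => (P1 j && P2 j) && P3 j)) /= -[leLHS]addr0; apply: lerD.
    apply: ler_sum => -[[[a b] c] d] /andP[/andP[ac bd] abcd].
    exact: (level_weight_bound pt_inj Tn n0 mass hK K0).
  apply: sumr_ge0 => j _; apply: mulr_ge0; [exact: ltW|exact: weight_bound_ge0].
have -> : 8 * K * (65 ^+ 2 * 300) * n%:R = 2 * (2 * (2 * (K * (65 ^+ 2 * 300 * n%:R)))) by ring.
apply: (le_trans h1); rewrite ler_pM2l //; apply: (le_trans h2); rewrite ler_pM2l //.
by apply: (le_trans h3); rewrite ler_pM2l.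
Qed.

(* The last level [n] collects all the values below [8 ^- n]. *)
Lemma level_exists (T : finType) (f : T -> R) n : (forall x, 0 <= f x) ->
  \sum_x f x ^+ 2 <= 1 -> exists lev : T -> 'I_n.+1, forall x,
  f x <= tw R (- (3 * (lev x)%:Z)) /\
  (tw R (- (3 * (lev x)%:Z)) <= 8 * f x \/ lev x = ord_max).
Proof.
move=> f0 f1.
have fx1 x : f x <= 1.
  have : f x ^+ 2 <= 1.
    by apply: le_trans f1; rewrite (bigD1 x) //= lerDl sumr_ge0 // => y _; rewrite exprn_ge0.
  by rewrite expr_le1.
pose pr x j := tw R (- (3 * j.+1%:Z)) < f x.
pose k x := find (pr x) (iota 0 n).
have kn x : (k x < n.+1)%N by rewrite ltnS -[leqRHS](size_iota 0) find_size.
exists (fun x => Ordinal (kn x)) => x /=; split.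
  case E: (k x) => [|i]; first by rewrite mulr0 oppr0 /tw expr0z.
  have ik : (i < find (pr x) (iota 0 n))%N by rewrite -/(k x) E.
  have := before_find 0%N ik; rewrite nth_iota;
    last by rewrite (leq_trans ik) // -[leqRHS](size_iota 0) find_size.
  by rewrite add0n /pr => /negbT; rewrite -leNgt.
have [h|h] := ltnP (k x) n; last by right; apply: val_inj => /=; apply/eqP;
  rewrite eqn_leq h -ltnS kn.
left; have : has (pr x) (iota 0 n) by rewrite has_find size_iota.
move=> /(nth_find 0%N); rewrite -/(k x) nth_iota // add0n /pr => h2.
have -> : tw R (- (3 * (k x)%:Z)) = 8 * tw R (- (3 * (k x).+1%:Z)).
  have -> : (8 : R) = tw R 3 by rewrite /tw -exprnP; ring.
  by rewrite -twD; congr (tw R _); lia.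
by rewrite ler_pM2l // ltW.
Qed.

Lemma rect_energy_normalized : exists2 K : R, 0 < K &
  forall (T : finType) (pt : T -> int * int) (f : T -> R) n,
  injective pt -> (#|T| < 4 ^ n)%N -> (0 < n)%N -> (forall x, 0 <= f x) ->
  \sum_x f x ^+ 2 <= 1 ->
  \sum_(q | qrect pt q) f (qa q) * f (qb q) * f (qc q) * f (qd q) <= K * n%:R.
Proof.
have [K K0 hK] := sum_level_weight.
exists K => // T pt f n pt_inj Tn n0 f0 f1.
have [lev hlev] := level_exists n f0 f1.
have mass : \sum_a level_mass R lev a <= 65.
  have -> : \sum_a level_mass R lev a = \sum_x tw R (- (6 * (lev x)%:Z)).
    rewrite [RHS](partition_big lev xpredT) //=; apply: eq_bigr => a _.
    rewrite (eq_bigr (fun=> tw R (- (6 * a%:Z)))); last by move=> x /eqP ->.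
    rewrite sumr_const /level_mass mulr_natl; congr (_ *+ _).
    by apply: eq_card => x; rewrite inE.
  (* The bound [8 ^- lev <= 8 * f x] accounts for [64 * f x ^+ 2]. The last level adds at most
     [4 ^ n * 2 ^ (- 6 n) <= 1] in total, hence 65. *)
  apply: (@le_trans _ _ (\sum_x (64 * f x ^+ 2 + tw R (- (6 * n%:Z))))).
    apply: ler_sum => x _; have [h1 h2] := hlev x.
    have e6 (i : nat) : tw R (- (6 * i%:Z)) = tw R (- (3 * i%:Z)) ^+ 2.
      by rewrite twX; congr (tw R _); ring.
    case: h2 => [h2|->]; last by rewrite lerDr mulr_ge0 // exprn_ge0.
    apply: (@le_trans _ _ (64 * f x ^+ 2)); last by rewrite lerDl tw_ge0.
    rewrite e6; have -> : 64 * f x ^+ 2 = (8 * f x) ^+ 2 by ring.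
    by rewrite ler_pXn2r ?nnegrE ?tw_ge0 ?mulr_ge0.
  rewrite big_split /= -mulr_sumr.
  have -> : \sum_(x : T) tw R (- (6 * n%:Z)) = #|T|%:R * tw R (- (6 * n%:Z)).
    by rewrite sumr_const -[LHS]mulr_natl; congr (_%:R * _); apply: eq_card.
  have -> : (65 : R) = 64 * 1 + 1 by ring.
  apply: lerD; first by rewrite ler_pM2l.
  apply: (@le_trans _ _ ((4 ^ n)%:R * tw R (- (6 * n%:Z)))).
    by rewrite ler_wpM2r ?tw_ge0 // ler_nat ltnW.
  have -> : (4 ^ n)%:R = tw R (2 * n%:Z).
    by rewrite natrX /tw -exprz_exp; congr (_ ^+ n); rewrite -exprnP; ring.
  rewrite -twD -[leRHS](_ : tw R 0 = 1); last by rewrite /tw expr0z.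
  by apply: tw_le; lia.
apply: le_trans (hK T pt n lev pt_inj Tn n0 mass).
pose lv (q : T * T * T * T) := (lev (qa q), lev (qb q), lev (qc q), lev (qd q)).
rewrite (partition_big lv xpredT) //=; apply: ler_sum => j _.
rewrite /level_weight; set c := tw R _.
apply: (@le_trans _ _ (\sum_(q | qrect pt q && (lv q == j)) c)).
  apply: ler_sum => q /andP[_ /eqP E]; rewrite /c -E /lv /=.
  rewrite [X in _ <= tw R X](_ : _ = - (3 * (lev (qa q))%:Z) + - (3 * (lev (qb q))%:Z)
     + - (3 * (lev (qc q))%:Z) + - (3 * (lev (qd q))%:Z)); last by ring.
  rewrite !twD; have h x := (hlev x).1.
  by do 3!(apply: ler_pM; rewrite ?mulr_ge0 ?h //).
rewrite sumr_const -[leLHS]mulr_natr.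
rewrite le_eqVlt; apply/orP; left; apply/eqP; congr (_ * _%:R); apply: eq_card => q.
case: j {c} => [[[a b] c] d]; apply/idP/idP.
  move=> /andP[r /eqP[h1 h2 h3 h4]].
  by rewrite finset.in_set /level !finset.in_set h1 h2 h3 h4 !eqxx.
rewrite finset.in_set /level !finset.in_set => /and5P[/eqP h1 /eqP h2 /eqP h3 /eqP h4 r].
by apply/andP; split=> //; rewrite /lv h1 h2 h3 h4.
Qed.

Theorem rect_energy : exists2 K : R, 0 < K &
  forall (T : finType) (pt : T -> int * int) (f : T -> R) n,
  injective pt -> (#|T| < 4 ^ n)%N -> (0 < n)%N -> (forall x, 0 <= f x) ->
  \sum_(q | qrect pt q) f (qa q) * f (qb q) * f (qc q) * f (qd q)
    <= K * n%:R * (\sum_x f x ^+ 2) ^+ 2.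
Proof.
have [K K0 hK] := rect_energy_normalized.
exists K => // T pt f n pt_inj Tn n0 f0.
set F := \sum_x f x ^+ 2.
have F0 : 0 <= F by rewrite sumr_ge0 // => x _; rewrite exprn_ge0.
have [FE|Fn] := eqVneq F 0.
  have fx0 x : f x = 0.
    have : f x ^+ 2 <= 0 by rewrite -FE /F (bigD1 x) //= lerDl sumr_ge0 // => y _;
      rewrite exprn_ge0.
    move=> h; apply/eqP; rewrite -sqrf_eq0 eq_le h exprn_ge0 //.
  rewrite big1 ?mulr_ge0 ?exprn_ge0 ?ler0n ?(ltW K0) // => q _; by rewrite fx0 !mul0r.
have Fp : 0 < F by rewrite lt_neqAle eq_sym Fn.
pose r := Num.sqrt F; have r0 : 0 < r by rewrite sqrtr_gt0.
have r2 : r ^+ 2 = F by rewrite sqr_sqrtr.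
have := hK T pt (fun x => f x / r) n pt_inj Tn n0.
have g0 x : 0 <= f x / r by rewrite divr_ge0 // ltW.
have g1 : \sum_x (f x / r) ^+ 2 <= 1.
  under eq_bigr do rewrite expr_div_n r2.
  by rewrite -mulr_suml mulfV.
move=> /(_ g0 g1).
under eq_bigr => q _.
  rewrite (_ : _ * _ = f (qa q) * f (qb q) * f (qc q) * f (qd q) / (r ^+ 4)); last first.
    by field; rewrite gt_eqF.
  over.
by rewrite -mulr_suml ler_pdivrMr ?exprn_gt0 // (_ : r ^+ 4 = F ^+ 2) // -r2; ring.
Qed.

End RectangleEnergy.

(** * Integrals of trigonometric polynomials *)

Section TrigIntegrals.
Variable R : realType.
Local Open Scope classical_set_scope.

Lemma measurable_cos d (T : measurableType d) (D : set T) (h : T -> R) :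
  measurable_fun D h -> measurable_fun D (fun x => cos (h x)).
Proof.
move=> mh; apply: (@measurableT_comp _ _ _ _ _ _ (@cos R)) => //.
apply: continuous_measurable_fun; exact: continuous_cos.
Qed.

Lemma measurable_sin d (T : measurableType d) (D : set T) (h : T -> R) :
  measurable_fun D h -> measurable_fun D (fun x => sin (h x)).
Proof.
move=> mh; apply: (@measurableT_comp _ _ _ _ _ _ (@sin R)) => //.
apply: continuous_measurable_fun; exact: continuous_sin.
Qed.

Lemma sin_int_periodic (t : R) (n : int) : sin (t + n%:~R * (2 * pi)) = sin t.
Proof.
have P (m : nat) s : sin (s + m%:R * (2 * pi)) = sin s :> R.
  elim: m s => [|m IH] s; first by rewrite mul0r addr0.
  have -> : s + m.+1%:R * (2 * pi) = s + m%:R * (2 * pi) + pi *+ 2.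
    by rewrite -addn1 natrD; ring.
  by rewrite sinD2pi IH.
case: (intP n) => [|m|m]; first by rewrite mul0r addr0.
  by rewrite -[_%:~R]/(m.+1%:R) P.
by rewrite -(P m.+1) rmorphN /= -[_%:~R]/(m.+1%:R); congr sin; ring.
Qed.

Lemma one_cos_ge0 (e t : R) : 0 <= e <= 1 -> 0 <= 1 + e * cos t.
Proof. by move=> e01; have := cos_geN1 t; have := cos_le1 t; nra. Qed.

Lemma integral_one_cos (n : int) (e t : R) :
  (\int[lebesgue_measure]_(x in `[0%R, (2 * pi)%R]) (1 + e * cos (t + n%:~R * x))%:E
   = (2 * pi * (1 + e * ((n == 0)%:R * cos t)))%:E)%E.
Proof.
have p0 : 0 < 2 * pi :> R by rewrite mulr_gt0 ?pi_gt0.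
have [->|n0] := eqVneq n 0.
  rewrite (eq_integral (cst (1 + e * cos t)%:E)); last first.
    by move=> x _; rewrite mul0r addr0.
  rewrite integral_cst //= lebesgue_measure_itv /= lte_fin p0 -EFinD -EFinM.
  by congr EFin; ring.
pose k : R := n%:~R.
have k0 : k != 0 by rewrite intr_eq0.
have Dh (x : R) : is_derive x 1 (fun x => t + k * x) k.
  rewrite -[X in is_derive _ _ _ X]add0r -[X in 0 + X]mulr1.
  by apply: is_deriveD; apply: is_deriveZ.
have D (x : R) : is_derive x 1 (fun x => x + e / k * sin (t + k * x)) (1 + e * cos (t + k * x)).
  have -> : 1 + e * cos (t + k * x) = 1 + (e / k) *: (cos (t + k * x) * k).
    by congr (1 + _); rewrite -[RHS]/(e / k * (cos (t + k * x) * k)); field.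
  by apply: is_deriveD; apply: is_deriveZ; apply: is_derive1_comp.
have cF : continuous (fun x => x + e / k * sin (t + k * x)).
  by move=> x; apply: differentiable_continuous; apply/derivable1_diffP; apply: ex_derive.
have cf : continuous (fun x => 1 + e * cos (t + k * x)).
  move=> x; apply: cvgD; first exact: cvg_cst.
  apply: cvgM; first exact: cvg_cst.
  apply: differentiable_continuous; apply/derivable1_diffP.
  by apply: ex_derive; apply: is_derive1_comp.
rewrite (@continuous_FTC2 _ (fun x => 1 + e * cos (t + k * x)) (fun x => x + e / k * sin (t + k *
  x)))//.
- by rewrite -EFinB sin_int_periodic mulr0 addr0 mul0r; congr EFin; ring.
- exact: continuous_subspaceT.
- split.
  + by move=> x _; apply: ex_derive.
  + exact/cvg_at_right_filter/cF.
  + exact/cvg_at_left_filter/cF.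
- by move=> x _; rewrite derive1E; apply: derive_val.
Qed.

(** The family [1 + e * cos] is stable under integrating out one variable, which replaces [e] by
    [e * (n == 0)%:R]; for [0 <= e <= 1] it is nonnegative and Tonelli applies. [B] stays abstract
    because space uses half-open intervals and time a closed one. *)
Lemma integral_prod_one_cos d (T : measurableType d)
    (mu : {sigma_finite_measure set T -> \bar R}) (A : set T) (B : set R)
    (h : T -> R) (n : int) (e t : R) :
  0 <= e <= 1 -> measurable A -> measurable B -> measurable_fun setT h ->
  (forall e t : R, 0 <= e <= 1 ->
    (\int[lebesgue_measure]_(x in B) (1 + e * cos (t + n%:~R * x))%:E
     = (2 * pi * (1 + e * ((n == 0)%:R * cos t)))%:E)%E) ->
  (\int[mu \x (@lebesgue_measure R)]_(z in A `*` B)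
      (1 + e * cos (t + (h z.1 + n%:~R * z.2)))%:E
   = (2 * pi)%:E * \int[mu]_(x in A) (1 + e * (n == 0)%:R * cos (t + h x))%:E)%E.
Proof.
move=> e01 mA mB mh HB.
have mf : measurable_fun setT (fun z : T * R => 1 + e * cos (t + (h z.1 + n%:~R * z.2))).
  apply: measurable_funD => //; apply: measurable_funM => //; apply: measurable_cos.
  apply: measurable_funD => //; apply: measurable_funD.
    exact: (measurableT_comp mh).
  by apply: measurable_funM => //; exact: measurable_snd.
rewrite integral_mkcond fubini_tonelli1; last 2 first.
- apply/(measurable_restrictT _ (measurableX mA mB)).
  apply: measurable_funTS; exact/measurable_EFinP.
- move=> z; rewrite patchE; case: ifP => // _; rewrite lee_fin; exact: one_cos_ge0.
rewrite -ge0_integralZl_EFin //; last 3 first.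
- by move=> x _; rewrite lee_fin; apply: one_cos_ge0; case: eqP; rewrite ?mulr1 ?mulr0 ?lexx ?ler01.
- apply/measurable_EFinP; apply: measurable_funD => //; apply: measurable_funM => //.
  by apply: measurable_cos; apply: measurable_funD => //; exact: measurable_funTS.
- by rewrite mulr_ge0 ?pi_ge0.
rewrite [RHS]integral_mkcond; apply: eq_integral => x _.
rewrite /fubini_F patchE; case: ifPn => xA.
  rewrite -EFinM -mulrA -HB // [RHS]integral_mkcond; apply: eq_integral => y _.
  rewrite !patchE in_setX xA /= addrA; by case: ifP.
apply: integral0_eq => y _; rewrite patchE in_setX (negPf xA) //.
Qed.

Lemma torus_domE : @torus_dom R = `[0, 2 * pi[ `*` `[0, 2 * pi[.
Proof. by apply/seteqP; split => -[x y] /=; rewrite !in_itv. Qed.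

Lemma spacetime_domE : @spacetime_dom R = @torus_dom R `*` `[0, 2 * pi].
Proof.
by apply/seteqP; split => -[x y] /= [] xT; rewrite in_itv /= => yT;
  split=> //; [exact: set_mem | exact: mem_set].
Qed.

Lemma measurable_torus_dom : measurable (@torus_dom R).
Proof. by rewrite torus_domE; apply: measurableX; exact: measurable_itv. Qed.

Lemma measurable_spacetime_dom : measurable (@spacetime_dom R).
Proof.
rewrite spacetime_domE; apply: measurableX; last exact: measurable_itv.
exact: measurable_torus_dom.
Qed.

Lemma measurable_zdot (xi : int * int) : measurable_fun setT (@zdot R xi).
Proof.
by apply: measurable_funD; exact: measurable_funM.
Qed.

Lemma integral_one_cos_co (n : int) (e t : R) :
  (\int[lebesgue_measure]_(x in `[0%R, (2 * pi)%R[) (1 + e * cos (t + n%:~R * x))%:E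
   = (2 * pi * (1 + e * ((n == 0)%:R * cos t)))%:E)%E.
Proof.
rewrite integral_itv_bndo_bndc ?integral_one_cos //.
apply/measurable_EFinP; apply: measurable_funTS; apply: measurable_funD => //.
apply: measurable_funM => //; apply: measurable_cos; exact: measurable_funD.
Qed.

Lemma integral_torus_one_cos (xi : int * int) (e t : R) : 0 <= e <= 1 ->
  (\int[@leb2 R]_(x in @torus_dom R) (1 + e * cos (t + zdot xi x))%:E
   = ((2 * pi) ^+ 2 * (1 + e * ((xi == (0, 0))%:R * cos t)))%:E)%E.
Proof.
move=> e01; rewrite torus_domE.
rewrite [LHS](@integral_prod_one_cos _ _ (@lebesgue_measure R) _ _
  (fun x : R => xi.1%:~R * x) xi.2) //.
- rewrite integral_one_cos_co -EFinM; congr EFin; case: xi => a b /=.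
  by rewrite xpair_eqE; case: eqP; case: eqP => /= _ _; ring.
- exact: measurable_funM.
- by move=> e' t' _; exact: integral_one_cos_co.
Qed.

Lemma sigma_finite_leb2 : sigma_finite setT (@leb2 R).
Proof.
have /sigma_finiteP[F [TF nF Foo]] := sigma_finiteT (@lebesgue_measure R).
exists (fun n => F n `*` F n) => [|n]; last first.
  have [mF lF] := Foo n; split; first exact: measurableX.
  by rewrite [X in (X < _)%E]product_measure1E // lte_mul_pinfty // ge0_fin_numE.
apply/seteqP; split => // -[x y] _.
have [n _ Fx] : (\bigcup_n F n) x by rewrite -TF.
have [m _ Fy] : (\bigcup_n F n) y by rewrite -TF.
exists (maxn n m) => //; split => /=.
  by apply: (subsetPset _ _ (nF _ _ (leq_maxl n m))).
by apply: (subsetPset _ _ (nF _ _ (leq_maxr n m))).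
Qed.

(* The library's own instance for products of sigma-finite measures is shadowed
   by the one for products of finite measures, hence cannot be inferred. *)
HB.instance Definition _ := Measure.on (@leb2 R).
HB.instance Definition _ := Measure_isSigmaFinite.Build _ _ _ (@leb2 R) sigma_finite_leb2.

Lemma integral_spacetime_one_cos (xi : int * int) (n : int) (t : R) :
  (\int[@leb3 R]_(z in @spacetime_dom R) (1 + cos (t + (zdot xi z.1 + n%:~R * z.2)))%:E
   = ((2 * pi) ^+ 3 * (1 + ((xi == (0, 0)) && (n == 0))%:R * cos t))%:E)%E.
Proof.
under eq_integral do rewrite -[X in 1 + X]mul1r.
rewrite spacetime_domE [LHS](@integral_prod_one_cos _ _ (@leb2 R) _ _ (@zdot R xi) n) //.
- rewrite integral_torus_one_cos; last by case: eqP => _ /=; rewrite !(mul1r, lexx, ler01, mulr0).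
  by rewrite -EFinM; congr EFin; case: eqP; case: eqP => _ _ /=; ring.
- by rewrite ler01 lexx.
- exact: measurable_torus_dom.
- exact: measurable_zdot.
- by move=> e' t' _; exact: integral_one_cos.
Qed.

End TrigIntegrals.

(** * Powers of exponential sums as sums of cosines *)

Section PhaseSums.
Variables (R : realType) (I : finType) (r p : I -> R).

Lemma sqr_phase_sum :
  (\sum_i r i * cos (p i)) ^+ 2 + (\sum_i r i * sin (p i)) ^+ 2
  = \sum_(x : I * I) r x.1 * r x.2 * cos (p x.1 - p x.2).
Proof.
rewrite !expr2 !big_distrlr /= -big_split /=.
rewrite -(pair_bigA _ (fun i j => r i * r j * cos (p i - p j))) /=.
apply: eq_bigr => i _; rewrite -big_split /=; apply: eq_bigr => j _.
by rewrite cosB; ring.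
Qed.

(** A product of cosines differs from the cosine of the sum by a product of sines, and the sine sum
    vanishes because it is odd under exchange of its two indices. *)
Lemma quartic_phase_sum :
  ((\sum_i r i * cos (p i)) ^+ 2 + (\sum_i r i * sin (p i)) ^+ 2) ^+ 2
  = \sum_(q : I * I * I * I) r (qa q) * r (qb q) * r (qc q) * r (qd q)
      * cos (p (qa q) - p (qb q) + (p (qc q) - p (qd q))).
Proof.
have S0 : \sum_(x : I * I) r x.1 * r x.2 * sin (p x.1 - p x.2) = 0.
  set s := LHS; suff : s = - s by move=> ?; lra.
  rewrite {1}/s -sumrN (reindex_inj (can_inj (@swap_pairK _ _))).
  apply: eq_bigr => -[i j] _ /=; rewrite -opprB sinN; ring.
rewrite sqr_phase_sum expr2 big_distrlr /=.
rewrite -(pair_bigA _ (fun (t : I * I * I) d => r t.1.1 * r t.1.2 * r t.2 * r d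
      * cos (p t.1.1 - p t.1.2 + (p t.2 - p d)))) /=.
rewrite -(pair_bigA _ (fun (x : I * I) c => \sum_d r x.1 * r x.2 * r c * r d
      * cos (p x.1 - p x.2 + (p c - p d)))) /=.
transitivity (\sum_(x : I * I) \sum_(y : I * I)
   (r x.1 * r x.2 * cos (p x.1 - p x.2) * (r y.1 * r y.2 * cos (p y.1 - p y.2))
   - r x.1 * r x.2 * sin (p x.1 - p x.2) * (r y.1 * r y.2 * sin (p y.1 - p y.2)))).
  apply: eq_bigr => x _; rewrite sumrB -!mulr_sumr S0 mulr0 subr0.
  by rewrite mulr_sumr.
apply: eq_bigr => x _; rewrite pair_bigA /=; apply: eq_bigr => y _.
by rewrite [in RHS]cosD; ring.
Qed.

End PhaseSums.

(** * Resonant quadruples *)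

Section ResonantSums.
Variables (R : realType) (T : finType) (pt : T -> int * int) (r : T -> R).

Definition quad_shift (q : T * T * T * T) : int * int :=
  ((pt (qa q)).1 - (pt (qb q)).1 + ((pt (qc q)).1 - (pt (qd q)).1),
   (pt (qa q)).2 - (pt (qb q)).2 + ((pt (qc q)).2 - (pt (qd q)).2)).

Definition inorm2 (xi : int * int) : int := xi.1 ^+ 2 + xi.2 ^+ 2.

Definition quad_energy (q : T * T * T * T) : int :=
  inorm2 (pt (qa q)) - inorm2 (pt (qb q)) + (inorm2 (pt (qc q)) - inorm2 (pt (qd q))).

Definition resonant (q : T * T * T * T) :=
  (quad_shift q == (0, 0)) && (quad_energy q == 0).

(** Substituting [c = b + d - a] into the energy relation leaves twice the inner product of [b - a]
    and [d - a], so a nondegenerate quadruple has a right angle at [a]. *)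
Lemma resonant_cases (q : T * T * T * T) : injective pt -> resonant q ->
  [|| qrect pt q, (qa q == qb q) && (qc q == qd q) | (qa q == qd q) && (qb q == qc q)].
Proof.
move=> inj /andP[]; rewrite xpair_eqE /quad_energy /inorm2 => /andP[/eqP e1 /eqP e2] /eqP e3.
have [ab|ab] /= := eqVneq (qa q) (qb q).
  suff -> : qc q = qd q by rewrite eqxx orbT.
  rewrite ab !subrr !add0r in e1 e2.
  by apply/inj/injective_projections; exact: subr0_eq.
have [ad|ad] /= := eqVneq (qa q) (qd q).
  suff -> : qb q = qc q by rewrite eqxx !orbT.
  rewrite ad in e1 e2; apply/inj/injective_projections; apply/eqP; rewrite eq_sym -subr_eq0.
    by rewrite -e1; apply/eqP; ring.
  by rewrite -e2; apply/eqP; ring.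
rewrite orbF /qrect /rect /perp ab ad /= /dot3 /dx /dy.
move: e1 e2 e3; case: (pt (qa q)) => a1 a2; case: (pt (qb q)) => b1 b2.
case: (pt (qc q)) => c1 c2; case: (pt (qd q)) => d1 d2 /= e1 e2 e3.
have ec1 : c1 = b1 + d1 - a1 by clear -e1; lia.
have ec2 : c2 = b2 + d2 - a2 by clear -e2; lia.
rewrite ec1 ec2 in e3 *; clear -e3; apply/and3P; split; apply/eqP; [|by ring|by ring].
have /eqP : 2 * ((b1 - a1) * (d1 - a1) + (b2 - a2) * (d2 - a2)) = 0 by rewrite -e3; ring.
by rewrite mulf_eq0 => /orP[|/eqP].
Qed.

Lemma sum_resonant_le : injective pt -> (forall x, 0 <= r x) ->
  \sum_(q | resonant q) r (qa q) * r (qb q) * r (qc q) * r (qd q)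
  <= \sum_(q | qrect pt q) r (qa q) * r (qb q) * r (qc q) * r (qd q)
     + 2 * (\sum_x r x ^+ 2) ^+ 2.
Proof.
move=> inj r0; pose A q := r (qa q) * r (qb q) * r (qc q) * r (qd q).
have A0 q : 0 <= A q by rewrite !mulr_ge0.
have D : \sum_(q : T * T * T * T | (qa q == qb q) && (qc q == qd q)) A q
    = (\sum_x r x ^+ 2) ^+ 2.
  rewrite expr2 big_distrlr pair_bigA /=.
  rewrite (reindex_onto (fun x : T * T => (x.1, x.1, x.2, x.2)) (fun q => (qa q, qc q))) /=.
    by apply: eq_big => [[i j]|[i j] _]; rewrite /A /qa /qb /qc /qd /= ?eqxx //; ring.
  by move=> [[[a b] c] d]; rewrite /qa /qb /qc /qd /= => /andP[/eqP-> /eqP->].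
have E : \sum_(q : T * T * T * T | (qa q == qd q) && (qb q == qc q)) A q
    = (\sum_x r x ^+ 2) ^+ 2.
  rewrite expr2 big_distrlr pair_bigA /=.
  rewrite (reindex_onto (fun x : T * T => (x.1, x.2, x.2, x.1)) (fun q => (qa q, qb q))) /=.
    by apply: eq_big => [[i j]|[i j] _]; rewrite /A /qa /qb /qc /qd /= ?eqxx //; ring.
  by move=> [[[a b] c] d]; rewrite /qa /qb /qc /qd /= => /andP[/eqP-> /eqP->].
rewrite mulr_natl mulr2n -{1}D -E !(big_mkcond _ A) -!big_split /=.
apply: ler_sum => q _.
have := @resonant_cases q inj; case: resonant => [/(_ isT)|_].
  case: (qrect _ _) => /= => [_|/orP[]->].
  - by rewrite lerDl addr_ge0 //; case: ifP.
  - by rewrite add0r lerDl; case: ifP.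
  - by rewrite add0r lerDr; case: ifP.
by rewrite !addr_ge0 //; case: ifP.
Qed.
End ResonantSums.

(** * Integrals of nonnegative trigonometric polynomials *)

Section TrigPolynomial.
Variables (R : realType) (d : measure_display) (X : measurableType d).
Variables (mu : {measure set X -> \bar R}) (D : set X) (V : R) (I : finType).
Variables (w a : I -> R) (g : I -> X -> R) (b : pred I).
Hypothesis mD : measurable D.
Hypothesis muD : (\int[mu]_(z in D) 1 = V%:E)%E.
Hypothesis w_ge0 : forall i, 0 <= w i.
Hypothesis mg : forall i, measurable_fun setT (g i).
Hypothesis integral_mode : forall i,
  (\int[mu]_(z in D) (1 + cos (a i + g i z))%:E = (V * (1 + (b i)%:R * cos (a i)))%:E)%E.

(* Adding the constant [\sum_i w i] makes every mode nonnegative, so that only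
   the monotone theory of the integral is needed. *)
Lemma integral_trig_polynomial (f : X -> R) : (forall z, 0 <= f z) ->
  (forall z, f z = \sum_i w i * cos (a i + g i z)) ->
  (\int[mu]_(z in D) (f z)%:E = (V * \sum_(i | b i) w i * cos (a i))%:E)%E.
Proof.
move=> f0 fE; pose S := \sum_i w i.
have S0 : 0 <= S by apply: sumr_ge0.
pose h i z := w i * (1 + cos (a i + g i z)).
have mcosh i : measurable_fun setT (fun z => cos (a i + g i z)).
  by apply: measurable_cos; exact: measurable_funD.
have mh i : measurable_fun setT (h i).
  by apply: measurable_funM => //; apply: measurable_funD.
have h0 i z : 0 <= h i z by rewrite mulr_ge0 // -lerBlDl sub0r cos_geN1.
have mf : measurable_fun setT f.
  rewrite (funext fE).
  by apply: measurable_sum => i; exact: measurable_funM.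
have IS : (\int[mu]_(z in D) (f z)%:E + (V * S)%:E
   = \sum_i \int[mu]_(z in D) (h i z)%:E)%E.
  rewrite mulrC EFinM -muD -ge0_integralZl_EFin //.
  rewrite -ge0_integralD //; first 1 last.
  - by move=> z _; rewrite lee_fin.
  - by apply/measurable_EFinP; exact: measurable_funTS.
  - by move=> z _; rewrite mule1 lee_fin.
  transitivity (\int[mu]_(z in D) (\sum_i (h i z)%:E))%E; last first.
    apply: ge0_integral_sum => // i; last by move=> z _; rewrite lee_fin.
    by apply/measurable_EFinP; exact: (measurable_funTS (mh i)).
  apply: eq_integral => z _; rewrite mule1 -EFinD sumEFin; congr EFin.
  by rewrite fE /S -big_split /=; apply: eq_bigr => i _; rewrite /h; ring.
have {}IS : (\int[mu]_(z in D) (f z)%:E + (V * S)%:E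
   = (V * (\sum_(i | b i) w i * cos (a i)) + V * S)%:E)%E.
  rewrite IS -mulrDr [X in X + S]big_mkcond /S -big_split mulr_sumr -sumEFin /=.
  apply: eq_bigr => i _; rewrite /h.
  under eq_integral do rewrite EFinM.
  rewrite ge0_integralZl_EFin //; first last.
    apply/measurable_EFinP; apply: measurable_funTS.
    exact: (measurable_funD (measurable_cst _) (mcosh i)).
  rewrite integral_mode -EFinM; congr EFin.
  by case: (b i) => /=; ring.
move/(congr1 (fun x => x - (V * S)%:E)%E): IS.
by rewrite addeK // -EFinB addrK.
Qed.

End TrigPolynomial.

(** * The space-time integral of the fourth power *)

Section QuarticIntegral.
Variables (R : realType) (T : finType) (pt : T -> int * int) (r th : T -> R).
Local Open Scope classical_set_scope.

Definition wave_phase (z : R * R * R) (i : T) : R :=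
  th i + (zdot (pt i) z.1 - z.2 * znorm2 R (pt i)).

Definition wave_sqr (z : R * R * R) : R :=
  (\sum_i r i * cos (wave_phase z i)) ^+ 2 + (\sum_i r i * sin (wave_phase z i)) ^+ 2.

Definition quad_weight (q : T * T * T * T) := r (qa q) * r (qb q) * r (qc q) * r (qd q).

Definition quad_angle (q : T * T * T * T) :=
  th (qa q) - th (qb q) + (th (qc q) - th (qd q)).

Lemma wave_quartic (z : R * R * R) :
  wave_sqr z ^+ 2 = \sum_q quad_weight q
    * cos (quad_angle q + (zdot (quad_shift pt q) z.1 + (- quad_energy pt q)%:~R * z.2)).
Proof.
rewrite /wave_sqr quartic_phase_sum; apply: eq_bigr => q _; congr (_ * cos _).
rewrite /wave_phase /quad_angle /quad_shift /quad_energy /zdot /znorm2 /inorm2.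
by rewrite !(intrB, intrD, intrN, rmorphXn) /=; ring.
Qed.

Lemma integral_spacetime_1 : (\int[@leb3 R]_(z in @spacetime_dom R) 1 = ((2 * pi) ^+ 3)%:E)%E.
Proof.
have := integral_spacetime_one_cos (0, 0) 0 (pi / 2 : R).
rewrite cos_pihalf mulr0 addr0 mulr1 => <-.
by apply: eq_integral => z _; rewrite /zdot !mul0r !addr0 cos_pihalf addr0.
Qed.

Lemma integral_wave_quartic : (forall i, 0 <= r i) ->
  (\int[@leb3 R]_(z in @spacetime_dom R) (wave_sqr z ^+ 2)%:E
    = ((2 * pi) ^+ 3 * \sum_(q | resonant pt q) quad_weight q * cos (quad_angle q))%:E)%E.
Proof.
move=> r0.
rewrite (@integral_trig_polynomial _ _ _ (@leb3 R) _ ((2 * pi) ^+ 3) _ quad_weight quad_angle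
  (fun q (z : R * R * R) => zdot (quad_shift pt q) z.1 + (- quad_energy pt q)%:~R * z.2)
    (resonant pt)) //.
- exact: measurable_spacetime_dom.
- exact: integral_spacetime_1.
- by move=> q; rewrite !mulr_ge0.
- move=> q; apply: measurable_funD.
    by apply: (measurableT_comp (@measurable_zdot R _)); exact: measurable_fst.
  by apply: measurable_funM => //; exact: measurable_snd.
- by move=> q; rewrite integral_spacetime_one_cos oppr_eq0.
- by move=> z; exact: sqr_ge0.
- exact: wave_quartic.
Qed.

End QuarticIntegral.

Section ParsevalTorus.
Variables (R : realType) (T : finType) (pt : T -> int * int) (r th : T -> R).
Local Open Scope classical_set_scope.
Hypothesis pt_inj : injective pt.

Definition torus_phase (x : R * R) (i : T) : R := th i + zdot (pt i) x.

Definition torus_sqr (x : R * R) : R :=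
  (\sum_i r i * cos (torus_phase x i)) ^+ 2 + (\sum_i r i * sin (torus_phase x i)) ^+ 2.

Lemma integral_torus_1 : (\int[@leb2 R]_(z in @torus_dom R) 1 = ((2 * pi) ^+ 2)%:E)%E.
Proof.
have := @integral_torus_one_cos R (0, 0) 0 0.
rewrite mul0r addr0 mulr1 => <-; last by rewrite lexx ler01.
by apply: eq_integral => z _; rewrite mul0r addr0.
Qed.

Lemma integral_torus_sqr : (forall i, 0 <= r i) ->
  (\int[@leb2 R]_(x in @torus_dom R) (torus_sqr x)%:E
    = ((2 * pi) ^+ 2 * \sum_i r i ^+ 2)%:E)%E.
Proof.
move=> r0.
pose xi (p : T * T) := ((pt p.1).1 - (pt p.2).1, (pt p.1).2 - (pt p.2).2).
rewrite (@integral_trig_polynomial _ _ _ (@leb2 R) _ ((2 * pi) ^+ 2) _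
  (fun p => r p.1 * r p.2) (fun p => th p.1 - th p.2) (fun p => @zdot R (xi p)) (fun p => xi p ==
    (0, 0))).
- congr (_ * _)%:E.
  rewrite (reindex_onto (fun i => (i, i)) (fun p => p.1)) /=; last first.
    move=> [i j] /= /eqP[]; move=> /eqP e1 /eqP e2; rewrite !subr_eq0 in e1 e2.
    by congr pair; apply: pt_inj; apply: injective_projections; apply/eqP.
  apply: eq_big => [i|i _]; first by rewrite /xi /= !subrr !eqxx.
  by rewrite subrr cos0 mulr1.
- exact: measurable_torus_dom.
- exact: integral_torus_1.
- by move=> p; rewrite mulr_ge0.
- by move=> p; exact: measurable_zdot.
- move=> p; have := @integral_torus_one_cos R (xi p) 1 (th p.1 - th p.2).
  rewrite mul1r ler01 lexx => <- //.
  by apply: eq_integral => x _; rewrite mul1r.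
- by move=> x; rewrite addr_ge0 ?sqr_ge0.
- move=> x; rewrite /torus_sqr sqr_phase_sum; apply: eq_bigr => p _; congr (_ * cos _).
  by rewrite /torus_phase /xi /zdot /= !rmorphB /=; ring.
Qed.

End ParsevalTorus.

Section Rintegral.
Variables (R : realType) (d : measure_display) (X : measurableType d).
Variables (mu : {measure set X -> \bar R}) (D : set X).
Hypothesis mD : measurable D.

Lemma Rintegral_sum (I : finType) (h : I -> X -> R) :
  (forall i, mu.-integrable D (EFin \o h i)) ->
  Rintegral mu D (fun x => \sum_i h i x) = \sum_i Rintegral mu D (h i).
Proof.
move=> ih; rewrite /Rintegral.
under eq_integral do rewrite -sumEFin.
rewrite (integral_sum mD ih) sum_fine // => i _.
exact: (integrable_fin_num mD (ih i)).
Qed.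

Lemma ge0_integrable (f : X -> R) : measurable_fun D f -> (forall x, 0 <= f x) ->
  (\int[mu]_(x in D) (f x)%:E < +oo)%E -> mu.-integrable D (EFin \o f).
Proof.
move=> mf f0 If; apply/integrableP; split; first exact/measurable_EFinP.
by under eq_integral do rewrite /= ger0_norm //.
Qed.

End Rintegral.

(** * Bessel's inequality on the torus *)

Section Bessel.
Variables (R : realType) (T : finType) (pt : T -> int * int) (r th : T -> R).
Variables (phi : R * R -> R[i]) (M : R).
Local Open Scope classical_set_scope.
Hypothesis pt_inj : injective pt.
Hypothesis r_ge0 : forall i, 0 <= r i.
Hypothesis mRe : measurable_fun (@torus_dom R) (fun x => Re (phi x)).
Hypothesis mIm : measurable_fun (@torus_dom R) (fun x => Im (phi x)).
Hypothesis phi_sqr : (\int[@leb2 R]_(x in @torus_dom R) (cmod (phi x) ^+ 2)%:E = M%:E)%E.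
Hypothesis coefE : forall i,
  fourier_coef phi (pt i) = (r i * cos (th i) +i* (r i * sin (th i)))%C.

Lemma sqr_cmod (z : R[i]) : cmod z ^+ 2 = Re z ^+ 2 + Im z ^+ 2.
Proof. by rewrite sqr_sqrtr // addr_ge0 ?sqr_ge0. Qed.

Lemma integrable_sqr_phi :
  (@leb2 R).-integrable (@torus_dom R) (EFin \o (fun x => cmod (phi x) ^+ 2)).
Proof.
apply: ge0_integrable => [|x|]; rewrite ?sqr_ge0 ?phi_sqr ?ltry //.
under eq_fun do rewrite sqr_cmod.
by apply: measurable_funD; apply: measurable_funX.
Qed.

(** The torus has finite measure and [|u| <= 1 + u ^+ 2], so domination of the squares suffices. *)
Lemma integrable_le_phi (u : R * R -> R) : measurable_fun (@torus_dom R) u ->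
  (forall x, u x ^+ 2 <= cmod (phi x) ^+ 2) ->
  (@leb2 R).-integrable (@torus_dom R) (EFin \o u).
Proof.
move=> mu ule; have mD := @measurable_torus_dom R.
have i1 : (@leb2 R).-integrable (@torus_dom R) (EFin \o cst 1).
  by apply: ge0_integrable => //; rewrite integral_torus_1 ltry.
have := @integrableD _ _ _ (@leb2 R) _ mD _ _ i1 integrable_sqr_phi.
apply: le_integrable => //; first exact/measurable_EFinP.
move=> x _; rewrite /= lee_fin [leRHS]ger0_norm ?addr_ge0 ?sqr_ge0 //.
have := ule x; rewrite -[u x ^+ 2]real_normK ?num_real //; have := normr_ge0 (u x); nra.
Qed.

Let re_mode i (x : R * R) := Re (phi x * cexpi (- zdot (pt i) x)).
Let im_mode i (x : R * R) := Im (phi x * cexpi (- zdot (pt i) x)).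

Let re_modeE i x : re_mode i x = Re (phi x) * cos (zdot (pt i) x) + Im (phi x) * sin (zdot (pt i)
  x).
Proof.
by rewrite /re_mode /cexpi; case: (phi x) => a b /=; rewrite cosN sinN; ring.
Qed.

Let im_modeE i x : im_mode i x = Im (phi x) * cos (zdot (pt i) x) - Re (phi x) * sin (zdot (pt i)
  x).
Proof.
by rewrite /im_mode /cexpi; case: (phi x) => a b /=; rewrite cosN sinN; ring.
Qed.

Let mcosz i : measurable_fun (@torus_dom R) (fun x => cos (zdot (pt i) x)).
Proof. by apply: measurable_funTS; apply: measurable_cos; exact: measurable_zdot. Qed.

Let msinz i : measurable_fun (@torus_dom R) (fun x => sin (zdot (pt i) x)).
Proof.
by apply: measurable_funTS; apply: measurable_sin; exact: measurable_zdot.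
Qed.

Let integrable_re_mode i : (@leb2 R).-integrable (@torus_dom R) (EFin \o re_mode i).
Proof.
apply: integrable_le_phi => [|x].
  by rewrite (funext (re_modeE i)); apply: measurable_funD; exact: measurable_funM.
rewrite sqr_cmod re_modeE; have := cos2Dsin2 (zdot (pt i) x).
have := sqr_ge0 (Re (phi x) * sin (zdot (pt i) x) - Im (phi x) * cos (zdot (pt i) x)).
nra.
Qed.

Let integrable_im_mode i : (@leb2 R).-integrable (@torus_dom R) (EFin \o im_mode i).
Proof.
apply: integrable_le_phi => [|x].
  by rewrite (funext (im_modeE i)); apply: measurable_funB; exact: measurable_funM.
rewrite sqr_cmod im_modeE; have := cos2Dsin2 (zdot (pt i) x).
have := sqr_ge0 (Re (phi x) * cos (zdot (pt i) x) + Im (phi x) * sin (zdot (pt i) x)).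
nra.
Qed.

Let pi2 : (2 * pi) ^+ 2 != 0 :> R.
Proof. by rewrite expf_neq0 // mulf_neq0 // gt_eqF ?pi_gt0. Qed.

Let Rintegral_re_mode i : Rintegral (@leb2 R) (@torus_dom R) (re_mode i) = (2 * pi) ^+ 2 * (r i *
  cos (th i)).
Proof.
have := coefE i; rewrite /fourier_coef -/(re_mode i) -/(im_mode i).
set a := Rintegral _ _ _; set b := Rintegral _ _ _.
move/(congr1 (@Re R)); rewrite /= mul0r subr0 => <-; by rewrite mulVKf.
Qed.

Let Rintegral_im_mode i : Rintegral (@leb2 R) (@torus_dom R) (im_mode i) = (2 * pi) ^+ 2 * (r i *
  sin (th i)).
Proof.
have := coefE i; rewrite /fourier_coef -/(re_mode i) -/(im_mode i).
set a := Rintegral _ _ _; set b := Rintegral _ _ _.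
move/(congr1 (@Im R)); rewrite /= mul0r addr0 => <-; by rewrite mulVKf.
Qed.

(* Integrate [2 Re (phi * conj P) <= |phi|^2 + |P|^2], where [P] is the partial
   Fourier sum of [phi]. *)
Lemma bessel_torus : (2 * pi) ^+ 2 * \sum_i r i ^+ 2 <= M.
Proof.
have mD := @measurable_torus_dom R.
pose h i x := r i * (cos (th i) * re_mode i x + sin (th i) * im_mode i x).
have igc i : (@leb2 R).-integrable (@torus_dom R) (EFin \o (fun x => cos (th i) * re_mode i x)).
  exact: (@integrableZl _ _ _ (@leb2 R) _ mD _ _ (integrable_re_mode i)).
have iks i : (@leb2 R).-integrable (@torus_dom R) (EFin \o (fun x => sin (th i) * im_mode i x)).
  exact: (@integrableZl _ _ _ (@leb2 R) _ mD _ _ (integrable_im_mode i)).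
have ih i : (@leb2 R).-integrable (@torus_dom R) (EFin \o h i).
  exact: (@integrableZl _ _ _ (@leb2 R) _ mD _ _ (@integrableD _ _ _ (@leb2 R) _ mD _ _ (igc i)
    (iks i))).
have hE : Rintegral (@leb2 R) (@torus_dom R) (fun x => \sum_i h i x)
    = (2 * pi) ^+ 2 * \sum_i r i ^+ 2.
  rewrite Rintegral_sum // mulr_sumr; apply: eq_bigr => i _.
  rewrite RintegralZl // ?RintegralD // ?RintegralZl // ?Rintegral_re_mode ?Rintegral_im_mode;
    last 1 first.
    exact: (@integrableD _ _ _ (@leb2 R) _ mD _ _ (igc i) (iks i)).
  by have := cos2Dsin2 (th i); move: (cos _) (sin _) => c s cs; rewrite -[RHS]mulr1 -cs; ring.
have isum : (@leb2 R).-integrable (@torus_dom R) (EFin \o (fun x => \sum_i h i x)).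
  rewrite (_ : _ \o _ = fun x => \sum_i (h i x)%:E)%E; last first.
    by apply/funext => x /=; rewrite sumEFin.
  by apply: integrable_sum => // i _; exact: ih.
have mph i : measurable_fun (@torus_dom R) (fun x => torus_phase pt th x i).
  apply: measurable_funTS; apply: measurable_funD => //; exact: measurable_zdot.
have iT : (@leb2 R).-integrable (@torus_dom R) (EFin \o torus_sqr pt r th).
  apply: ge0_integrable => //.
  - apply: measurable_funD; apply: measurable_funX; apply: measurable_sum => i.
      by apply: measurable_funM => //; exact: (measurable_cos (mph i)).
    by apply: measurable_funM => //; exact: (measurable_sin (mph i)).
  - by move=> x; rewrite addr_ge0 ?sqr_ge0.
  - by rewrite integral_torus_sqr // ltry.
have : Rintegral (@leb2 R) (@torus_dom R) (fun x => 2 * \sum_i h i x)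
   <= Rintegral (@leb2 R) (@torus_dom R) (fun x => cmod (phi x) ^+ 2 + torus_sqr pt r th x).
  apply: le_Rintegral => //.
  - exact: (@integrableZl _ _ _ (@leb2 R) _ mD _ _ isum).
  - exact: (@integrableD _ _ _ (@leb2 R) _ mD _ _ integrable_sqr_phi iT).
  move=> x _; rewrite sqr_cmod /torus_sqr.
  set C := \sum_i _ * cos _; set S := \sum_i _ * sin _.
  have -> : \sum_i h i x = Re (phi x) * C + Im (phi x) * S.
    rewrite !mulr_sumr -big_split /=; apply: eq_bigr => i _.
    by rewrite /h re_modeE im_modeE /torus_phase cosD sinD; ring.
  have := sqr_ge0 (Re (phi x) - C); have := sqr_ge0 (Im (phi x) - S); nra.
rewrite RintegralZl // RintegralD //; last exact: integrable_sqr_phi.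
rewrite hE {1 2}/Rintegral phi_sqr integral_torus_sqr //=; lra.
Qed.

End Bessel.

(** * The Strichartz estimate *)

Section ComplexWave.
Variable R : realType.

Lemma polar_form (z : R[i]) :
  exists th, z = (cmod z * cos th +i* (cmod z * sin th))%C.
Proof.
have m0 : 0 <= cmod z by apply: sqrtr_ge0.
have := sqr_cmod z; case: z m0 => x y /=; set m := cmod _ => m0 mE.
have [m_eq0|mn0] := eqVneq m 0.
  rewrite m_eq0 expr2 mul0r in mE; exists 0; rewrite m_eq0 !mul0r.
  have /eqP : x ^+ 2 + y ^+ 2 = 0 by rewrite -mE.
  by rewrite paddr_eq0 ?sqr_ge0 // !sqrf_eq0 => /andP[/eqP-> /eqP->].
have ab : (x / m) ^+ 2 + (y / m) ^+ 2 = 1.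
  by rewrite !expr_div_n -mulrDl -mE divff // expf_neq0.
have a1 : -1 <= x / m <= 1 by have := sqr_ge0 (y / m); move: ab; rewrite !expr2; nra.
have c1 : cos (acos (x / m)) = x / m by apply: acosK; rewrite in_itv.
have s1 : sin (acos (x / m)) = `|y / m|.
  by rewrite sin_acos // -sqrtr_sqr; congr Num.sqrt; rewrite -ab; ring.
have mK u : m * (u / m) = u by rewrite mulrC divfK.
(* [acos] only reaches the upper half plane; the sign of the imaginary part decides the sign of the
   angle. *)
case: (lerP 0 (y / m)) => y0; [exists (acos (x / m))|exists (- acos (x / m))].
  by rewrite c1 s1 ger0_norm // !mK.
by rewrite cosN sinN c1 s1 ltr0_norm // opprK !mK.
Qed.

Lemma sum_complexE (I : finType) (u v : I -> R) :
  \sum_i (u i +i* v i)%C = ((\sum_i u i) +i* (\sum_i v i))%C.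
Proof.
by elim: (index_enum I) => [|i s IH]; rewrite ?big_nil // !big_cons IH.
Qed.

Lemma cmod_schrod_proj (S : {fset (int * int)}) (phi : R * R -> R[i]) (r th : S -> R)
    (z : R * R * R) :
  (forall i : S, fourier_coef phi (val i) = (r i * cos (th i) +i* (r i * sin (th i)))%C) ->
  cmod (schrod_proj S phi z.2 z.1) ^+ 2 = wave_sqr val r th z.
Proof.
move=> cE; rewrite sqr_cmod /schrod_proj big_seq_fsetE /=.
rewrite (eq_bigr (fun i : S => (r i * cos (wave_phase val th z i)
   +i* (r i * sin (wave_phase val th z i)))%C)) ?sum_complexE //.
move=> i _; rewrite cE /cexpi /wave_phase /=.
apply/eqP; rewrite eq_complex /= !(cosD, sinD, cosN, sinN).
by apply/andP; split; apply/eqP; ring.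
Qed.

Lemma Lnorm_indic d (X : measurableType d) (mu : {measure set X -> \bar R})
    (D : set X) (f : X -> R) n : (forall x, 0 <= f x) -> (0 < n)%N ->
  Lnorm mu n%:R%:E (fun x => (\1_D x * f x)%:E)
  = ((\int[mu]_(x in D) (f x ^+ n)%:E) `^ n%:R^-1)%E.
Proof.
move=> f0 n0; rewrite unlock; congr (_ `^ _)%E.
rewrite [RHS]integral_mkcond; apply: eq_integral => x _.
rewrite patchE indicE /=; case: ifP => _.
  by rewrite mul1r ger0_norm // powR_mulrn.
by rewrite mul0r normr0 powR0 // pnatr_eq0 -lt0n.
Qed.

(** From [1 - 1/2 <= expR (- 1/2)] follows [expR (1/2) <= 2], and squaring gives [expR 1 <= 4]. *)
Lemma ln4_ge1 : 1 <= ln 4 :> R.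
Proof.
have h : 2^-1 <= expR (- 2^-1) :> R by have := expR_ge1Dx (- 2^-1 : R); lra.
have : expR 1 <= 4 :> R.
  have -> : 1 = 2^-1 + 2^-1 :> R by lra.
  rewrite expRD; rewrite expRN in h.
  have p := expR_gt0 (2^-1 : R); have : expR (2^-1) <= 2 :> R.
    by rewrite -lef_pV2 ?posrE.
  nra.
by move=> h4; rewrite -[leLHS](expRK 1) ler_ln ?posrE ?expR_gt0.
Qed.

Lemma trunc_log4_le_logm N : (0 < N)%N ->
  (trunc_log 4 N).+1%:R <= 2 * logm (N%:R : R).
Proof.
move=> N0; set k := trunc_log 4 N.
have kN : (4 ^ k <= N)%N by rewrite trunc_logP.
have kl : k%:R <= ln (N%:R : R).
  apply: (@le_trans _ _ (k%:R * ln 4)); first by rewrite ler_peMr // ln4_ge1.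
  by rewrite mulr_natl -lnXn // -natrX ler_ln ?posrE ?ltr0n ?expn_gt0 // ler_nat.
have l1 : 1 <= logm (N%:R : R) by rewrite le_max lexx.
have l2 : ln (N%:R : R) <= logm (N%:R : R) by rewrite le_max lexx orbT.
by rewrite -addn1 natrD; lra.
Qed.

End ComplexWave.

Section Strichartz.
Variable R : realType.

Lemma coef_sqr_sum_le (S : {fset (int * int)}) (phi : R * R -> R[i]) (r th : S -> R) (M : R) :
  (forall i, 0 <= r i) ->
  (forall i : S, fourier_coef phi (val i) = (r i * cos (th i) +i* (r i * sin (th i)))%C) ->
  in_L2_T2 phi ->
  (\int[@leb2 R]_(x in @torus_dom R) (cmod (phi x) ^+ 2)%:E = M%:E)%E ->
  (2 * pi) ^+ 2 * \sum_i r i ^+ 2 <= M.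
Proof.
move=> r0 cE [mRe [mIm _]] ME.
by apply: bessel_torus cE => //; exact: val_inj.
Qed.

(** [2 * K] pays for the rectangles, as the number of classes is at most [2 * logm], and the
    remaining 2 for the degenerate quadruples, as [1 <= logm]. *)
Lemma integral_schrod_quartic_le (K : R) (S : {fset (int * int)}) (phi : R * R -> R[i])
    (r th : S -> R) :
  (forall (T : finType) (pt : T -> int * int) (f : T -> R) n, injective pt ->
    (#|T| < 4 ^ n)%N -> (0 < n)%N -> (forall x, 0 <= f x) ->
    \sum_(q | qrect pt q) f (qa q) * f (qb q) * f (qc q) * f (qd q)
      <= K * n%:R * (\sum_x f x ^+ 2) ^+ 2) ->
  0 < K -> S != fset0 -> (forall i, 0 <= r i) ->
  (forall i : S, fourier_coef phi (val i) = (r i * cos (th i) +i* (r i * sin (th i)))%C) ->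
  (\int[@leb3 R]_(z in @spacetime_dom R) (cmod (schrod_proj S phi z.2 z.1) ^+ 4)%:E
    <= ((2 * pi) ^+ 3 * ((2 * K + 2) * logm (#|` S|%:R) * (\sum_i r i ^+ 2) ^+ 2))%:E)%E.
Proof.
move=> HK K0 S0 r0 cE.
under eq_integral do rewrite -[4%N]/(2 * 2)%N exprM (cmod_schrod_proj _ cE).
rewrite integral_wave_quartic // lee_fin ler_wpM2l //.
  by rewrite exprn_ge0 // mulr_ge0 // pi_ge0.
pose X := (\sum_i r i ^+ 2) ^+ 2.
have X0 : 0 <= X by exact: sqr_ge0.
have N0 : (0 < #|` S|)%N by rewrite cardfs_gt0.
have l1 : 1 <= logm (#|` S|%:R : R) by rewrite le_max lexx.
apply: (@le_trans _ _ (\sum_(q | resonant val q) r (qa q) * r (qb q) * r (qc q) * r (qd q))).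
  apply: ler_sum => q _; rewrite -[leRHS]mulr1 ler_wpM2l ?cos_le1 //.
  by rewrite !mulr_ge0.
apply: le_trans (sum_resonant_le val_inj r0) _; rewrite -/X.
have := @HK S val r (trunc_log 4 #|` S|).+1 val_inj.
rewrite -cardfE trunc_log_ltn // => /(_ isT isT r0); rewrite -/X => H.
have := @trunc_log4_le_logm R _ N0; move: (_.+1%:R) H => n H nl.
have : K * n * X <= K * (2 * logm (#|` S|%:R)) * X.
  by rewrite ler_wpM2r // ler_wpM2l // ltW.
nra.
Qed.

End Strichartz.

Theorem theorem1p1 (R : realType) :
  exists c : R, 0 < c /\
    forall (S : {fset (int * int)}) (phi : R * R -> R[i]),
      S != fset0 ->
      in_L2_T2 phi ->
      (L4norm_spacetime (schrod_proj S phi)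
        <= (c * (logm (#|` S|%:R : R)) `^ (4^-1))%:E * L2norm_T2 phi)%E.
Proof.
have [K K0 HK] := rect_energy R.
have p0 : 0 < pi :> R := pi_gt0 R.
(* The space-time volume gives [(2 * pi) ^+ 3], and the square of Bessel's inequality divides by
   [(2 * pi) ^+ 4]. *)
have [C C0 CE] : exists2 C : R, 0 < C & C = (2 * K + 2) / (2 * pi).
  by eexists; last reflexivity; rewrite divr_gt0 //; lra.
exists (C `^ 4^-1); split=> [|S phi S0 phiL2]; first exact: powR_gt0.
have [_ [_ phi_lt]] := phiL2.
pose I2 := (\int[@leb2 R]_(x in @torus_dom R) (cmod (phi x) ^+ 2)%:E)%E.
have L2E : L2norm_T2 phi = (I2 `^ 2^-1)%E.
  by apply: Lnorm_indic => // x; exact: sqrtr_ge0.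
have I20 : (0 <= I2)%E by apply: integral_ge0 => x _; rewrite lee_fin sqr_ge0.
have I2lt : (I2 < +oo)%E.
  by rewrite L2E in phi_lt; apply: lty_poweRy phi_lt; rewrite invr_neq0.
have [M ME] : exists M, I2 = M%:E.
  by exists (fine I2); rewrite fineK // ge0_fin_numE.
have M0 : 0 <= M by rewrite -lee_fin -ME.
have [th thE] := boolp.choice (fun i : S => polar_form (fourier_coef phi (val i))).
pose r (i : S) := cmod (fourier_coef phi (val i)).
have r0 i : 0 <= r i by exact: sqrtr_ge0.
have B := coef_sqr_sum_le r0 thE phiL2 ME.
have Q := integral_schrod_quartic_le HK K0 S0 r0 thE.
have -> : L4norm_spacetime (schrod_proj S phi) =
    ((\int[@leb3 R]_(z in @spacetime_dom R) (cmod (schrod_proj S phi z.2 z.1) ^+ 4)%:E) `^ 4^-1)%E.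
  apply: (@Lnorm_indic _ _ _ (@leb3 R) _ (fun z => cmod (schrod_proj S phi z.2 z.1))) => // z.
  exact: sqrtr_ge0.
rewrite L2E ME.
set L := logm _; have L1 : 1 <= L by rewrite le_max lexx.
have L0 : 0 <= L by lra.
apply: (@le_trans _ _ ((C * L * M ^+ 2)%:E `^ 4^-1)%E).
  apply: gt0_ler_poweR.
  - by rewrite invr_ge0.
  - rewrite in_itv /= leey andbT; apply: integral_ge0 => z _.
    by rewrite lee_fin exprn_ge0 // sqrtr_ge0.
  - by rewrite in_itv /= leey andbT lee_fin !mulr_ge0 ?sqr_ge0 // ltW.
  apply: le_trans Q _; rewrite lee_fin -/L.
  set X := \sum_i _ in B *.
  have X0 : 0 <= X by apply: sumr_ge0 => i _; exact: sqr_ge0.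
  have XM : ((2 * pi) ^+ 2 * X) ^+ 2 <= M ^+ 2.
    by apply: lerXn2r => //; rewrite nnegrE // mulr_ge0 // sqr_ge0.
  have -> : (2 * pi) ^+ 3 * ((2 * K + 2) * L * X ^+ 2) = C * L * ((2 * pi) ^+ 2 * X) ^+ 2.
    by rewrite CE; move: (pi : R) p0 => p p0; field; rewrite gt_eqF.
  by rewrite ler_wpM2l // mulr_ge0 // ltW.
rewrite !poweR_EFin -EFinM lee_fin powRM ?sqr_ge0 ?mulr_ge0 ?(ltW C0) //.
rewrite [(C * L) `^ _]powRM ?(ltW C0) // -powR_mulrn // -powRrM.
by have -> : 2 * 4^-1 = 2^-1 :> R by lra.
Qed.
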